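(* Let $(k,\sigma)$ be an algebraically closed inversive difference field of characteristic zero, $(\mathcal{U},\sigma)$ a sufficiently saturated model of $\mathrm{ACFA}_0$ extending it, and $\mathcal{C}=\mathrm{Fix}(\sigma)$ its fixed field. Suppose $q\in S_{\mathrm{qf}}(k)$ is rational and quantifier-free internal to $\mathcal{C}$. If $q$ is weakly orthogonal to $\mathcal{C}$ then it is isolated by a quantifier-free formula. Geometric formulation: Suppose $(V,\phi)$ is an isotrivial rational $\sigma$-variety over $k$ with no nonconstant invariant rational functions. Then $(V,\phi)$ has only finitely many maximal proper invariant subvarieties over $k$.
   Context: A difference field is inversive if its endomorphism is surjective. $\mathrm{ACFA}_0$ is the theory of difference-closed fields of characteristic zero; parameter sets and parameter fields are small. $S_{\mathrm{qf}}(k)$ is the set of complete quantifier-free types over $k$ in the language of difference rings. $q(x)\in S_{\mathrm{qf}}(k)$ is rational if it implies $\sigma(x)=f(x)$ for some tuple $f$ of rational functions over $k$. Independence $A\perp\!\!\!\perp_C B$ (nonforking) means $\langle A\cup C\rangle^{\mathrm{alg}}$ is algebraically disjoint from $\langle B\cup C\rangle^{\mathrm{alg}}$ over $\langle C\rangle^{\mathrm{alg}}$, where $\langle\cdot\rangle$ is the generated difference field. $q$ is quantifier-free internal to $\mathcal{C}$ if for all $a\models q$ there is a difference field extension $K\supseteq k$ with $a\perp\!\!\!\perp_k K$ and $a\in K\langle c\rangle^{\mathrm{perf}}$ for some tuple $c$ from $\mathcal{C}$, where $K\langle c\rangle$ is the difference field generated by $c$ over $K$ and perf denotes perfect closure.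 A rational $q$ is weakly orthogonal to $\mathcal{C}$ if $a\perp\!\!\!\perp_k c$ for some (equivalently any) $a\models q$ and every finite tuple $c$ from $\mathcal{C}$. A superscript $\sigma$ on a variety, rational map or rational function over $k$ denotes its transform under $\sigma$ acting on coefficients. A rational $\sigma$-variety over $k$ is an irreducible variety $V$ over $k$ with a dominant rational map $\phi:V\dashrightarrow V^\sigma$ over $k$. An invariant subvariety of $(V,\phi)$ is an irreducible Zariski closed $X\subseteq V$ over $k$ with $X\cap\mathrm{dom}(\phi)\ne\emptyset$ and $\phi(X)$ Zariski dense in $X^\sigma$; maximality is with respect to inclusion among proper invariant subvarieties. A rational map $g:V\dashrightarrow W$ is equivariant $(V,\phi)\dashrightarrow(W,\psi)$ if $\psi\circ g=g^\sigma\circ\phi$. $(V,\phi)$ is isotrivial if there exist a rational $\sigma$-variety $(Z,\psi)$ over $k$, an $\ell\ge0$, an invariant subvariety $Y$ of $(\mathbb{A}^\ell\times Z,\mathrm{id}\times\psi)$, and an equivariant birational map $g:(V\times Z,\phi\times\psi)\dashrightarrow(Y,\mathrm{id}\times\psi)$ over $k$ commuting with the projections to $Z$. An invariant rational function on $(V,\phi)$ is $\lambda\in k(V)$ with $\lambda=\lambda^\sigma\circ\phi$; nonconstant means $\lambda\notin k$. *)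

(* Defs.v *)
From HB Require Import structures.
From mathcomp Require Import all_boot all_order all_algebra.
From mathcomp Require Import mpoly.
From Stdlib Require List.

Set Implicit Arguments.
Unset Strict Implicit.
Unset Printing Implicit Defensive.

Import GRing.Theory.
Local Open Scope ring_scope.

(** * First-order formulas in the language of difference rings *)

(* Parameters come from [P], free variables are indexed by ['I_n]. *)
Inductive dterm (P : Type) (n : nat) : Type :=
| DVar of 'I_n
| DCst of P
| DZero
| DOne
| DAdd of dterm P n & dterm P n
| DOpp of dterm P n
| DMul of dterm P n & dterm P n
| DSig of dterm P n.

(* [DEx] binds the variable [ord0]. *)
Inductive dform (P : Type) (n : nat) : Type :=
| DEq of dterm P n & dterm P n
| DNot of dform P n
| DAnd of dform P n & dform P n
| DEx of dform P n.+1.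

Fixpoint qfree P n (f : dform P n) : bool :=
  match f with
  | DEq _ _ => true
  | DNot g => qfree g
  | DAnd g h => qfree g && qfree h
  | DEx _ => false
  end.

Fixpoint deval P (F : fieldType) (s : F -> F) (h : P -> F) n
    (e : 'I_n -> F) (t : dterm P n) : F :=
  match t with
  | DVar i => e i
  | DCst c => h c
  | DZero => 0
  | DOne => 1
  | DAdd t u => deval s h e t + deval s h e u
  | DOpp t => - deval s h e t
  | DMul t u => deval s h e t * deval s h e u
  | DSig t => s (deval s h e t)
  end.

Definition econs (T : Type) n (x : T) (e : 'I_n -> T) : 'I_n.+1 -> T :=
  fun i => oapp e x (unlift ord0 i).

Fixpoint dholds P (F : fieldType) (s : F -> F) (h : P -> F) n
    (e : 'I_n -> F) (f : dform P n) {struct f} : Prop :=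
  match f with
  | DEq t u => deval s h e t = deval s h e u
  | DNot g => ~ dholds s h e g
  | DAnd g1 g2 => dholds s h e g1 /\ dholds s h e g2
  | DEx g => exists x : F, dholds s h (econs x e) g
  end.

Definition realises P (F : fieldType) (s : F -> F) (h : P -> F) n
    (p : dform P n -> Prop) (a : 'I_n -> F) : Prop :=
  forall f, p f -> dholds s h a f.

Definition fin_satisfiable P (F : fieldType) (s : F -> F) (h : P -> F) n
    (p : dform P n -> Prop) : Prop :=
  forall l : seq (dform P n), List.Forall p l ->
    exists a : 'I_n -> F, List.Forall (dholds s h a) l.

(** * Models of ACFA_0 and saturation *)

(* A finite system of difference equations and inequations is the same as a
   quantifier-free formula, up to taking disjunctions. *)
Definition difference_closed (U : fieldType) (s : {rmorphism U -> U}) : Prop :=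
  forall (L : fieldType) (t : {rmorphism L -> L}) (j : {rmorphism U -> L}),
    (forall x, j (s x) = t (j x)) ->
  forall n (f : dform U n), qfree f ->
    (exists b : 'I_n -> L, dholds t j b f) ->
    exists a : 'I_n -> U, dholds s id a f.

Definition acfa0 (U : fieldType) (s : {rmorphism U -> U}) : Prop :=
  [pchar U] =i pred0 /\ difference_closed s.

(* The type [kappa] stands for its cardinal; [small kappa A] is |A| < |kappa|. *)
Definition small (kappa : Type) (U : Type) (A : U -> Prop) : Prop :=
  ~ exists f : kappa -> U, injective f /\ forall t, A (f t).

Definition saturated (kappa : Type) (U : fieldType)
    (s : {rmorphism U -> U}) : Prop :=
  forall A : U -> Prop, small kappa A ->
  forall n (p : dform {x : U | A x} n -> Prop),
    fin_satisfiable s (@proj1_sig U A) p ->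
    exists a : 'I_n -> U, realises s (@proj1_sig U A) p a.

(** * Difference subfields and independence *)

Definition fixed_field (U : fieldType) (s : U -> U) : U -> Prop :=
  fun x => s x = x.

Definition img (S T : Type) (f : S -> T) : T -> Prop :=
  fun y => exists x, y = f x.

Definition union (T : Type) (A B : T -> Prop) : T -> Prop :=
  fun x => A x \/ B x.

Definition diff_subfield (U : fieldType) (s : U -> U) (L : U -> Prop) : Prop :=
  [/\ L 1,
      forall x y, L x -> L y -> L (x - y),
      forall x y, L x -> L y -> L (x / y)
    & forall x, L x -> L (s x)].

Definition dgen (U : fieldType) (s : U -> U) (A : U -> Prop) : U -> Prop :=
  fun x => forall L, diff_subfield s L -> (forall y, A y -> L y) -> L x.

Definition alg_closure (U : fieldType) (L : U -> Prop) : U -> Prop :=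
  fun x => exists p : {poly U}, [/\ p != 0, forall i, L p`_i & root p x].

Definition perf_closure (U : fieldType) (L : U -> Prop) : U -> Prop :=
  fun x => L x \/ exists p e : nat, p \in [pchar U] /\ L (x ^+ (p ^ e)).

Definition alg_indep (U : fieldType) (L : U -> Prop) n (a : 'I_n -> U) : Prop :=
  forall p : {mpoly U[n]}, (forall m, L p@_m) -> p.@[a] = 0 -> p = 0.

Definition alg_disjoint (U : fieldType) (L1 L2 L0 : U -> Prop) : Prop :=
  forall n (a : 'I_n -> U), (forall i, L1 (a i)) ->
    alg_indep L0 a -> alg_indep L2 a.

Definition indep (U : fieldType) (s : U -> U) (A C B : U -> Prop) : Prop :=
  alg_disjoint (alg_closure (dgen s (union A C)))
               (alg_closure (dgen s (union B C)))
               (alg_closure (dgen s C)).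

(** * Quantifier-free types over [k] *)

Section QFTypes.
Context (k U : fieldType) (s : {rmorphism U -> U}) (iota : {rmorphism k -> U}).
Context (n : nat).
Implicit Type q : dform k n -> Prop.

Definition complete_qf_type q : Prop :=
  [/\ forall f, q f -> qfree f,
      fin_satisfiable s iota q
    & forall f, qfree f -> q f \/ q (DNot f)].

Definition rational_type q : Prop :=
  exists num den : 'I_n -> {mpoly k[n]},
  forall a, realises s iota q a -> forall i,
    (map_mpoly iota (den i)).@[a] != 0 /\
    s (a i) = (map_mpoly iota (num i)).@[a] / (map_mpoly iota (den i)).@[a].

Definition qf_internal (kappa : Type) q : Prop :=
  forall a, realises s iota q a ->
  exists K : U -> Prop,
    [/\ diff_subfield s K, forall c, K (iota c), small kappa K,
        indep s (img a) (img iota) K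
      & exists m (c : 'I_m -> U), (forall i, fixed_field s (c i)) /\
          forall i, perf_closure (dgen s (union K (img c))) (a i)].

Definition weakly_orthogonal q : Prop :=
  exists a, realises s iota q a /\
  forall m (c : 'I_m -> U), (forall i, fixed_field s (c i)) ->
    indep s (img a) (img iota) (img c).

Definition qf_isolated q : Prop :=
  exists f : dform k n, [/\ qfree f, q f
    & forall a, dholds s iota a f -> realises s iota q a].

End QFTypes.

(** * Varieties *)

(* Varieties are presented by finitely many affine charts, and identified with
   their sets of [k]-points, [k] being algebraically closed in all uses.
   The chart [i] is the zero set of [aeqs i] in affine [adim i]-space; the
   points of the charts [i] and [j] to be identified are cut out by
   [aglue i j] in the product of these two charts. *)
Record atlas (k : fieldType) := Atlas {
  chart : finType;
  adim : chart -> nat;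
  aeqs : forall i : chart, seq {mpoly k[adim i]};
  aglue : forall i j : chart, seq {mpoly k[adim i + adim j]} }.

Definition zeros (k : fieldType) n (E : seq {mpoly k[n]}) (v : 'I_n -> k) :=
  forall p, p \in E -> p.@[v] = 0.

Definition vcat (T : Type) m n (v : 'I_m -> T) (w : 'I_n -> T) :
    'I_(m + n) -> T :=
  fun i => match split i with inl a => v a | inr b => w b end.

(* Substitution of the variable [f i] for the variable [i]. *)
Definition mren (k : fieldType) m n (f : 'I_m -> 'I_n) (p : {mpoly k[m]}) :
    {mpoly k[n]} := comp_mpoly [tuple 'X_(f i) | i < m] p.

Definition pt (k : fieldType) (V : atlas k) :=
  {i : chart V & 'I_(adim i) -> k}.

Definition mkpt (k : fieldType) (V : atlas k) (i : chart V)
  (v : 'I_(adim i) -> k) : pt V := existT _ i v.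

Definition onv (k : fieldType) (V : atlas k) (x : pt V) : Prop :=
  zeros (aeqs (tag x)) (tagged x).

Definition same (k : fieldType) (V : atlas k) (x y : pt V) : Prop :=
  [/\ onv x, onv y
    & zeros (aglue (tag x) (tag y)) (vcat (tagged x) (tagged y))].

Definition fdef (k : fieldType) m n (den : 'I_n -> {mpoly k[m]})
  (v : 'I_m -> k) : Prop := forall i, (den i).@[v] != 0.

Definition fval (k : fieldType) m n (num den : 'I_n -> {mpoly k[m]})
  (v : 'I_m -> k) : 'I_n -> k := fun i => (num i).@[v] / (den i).@[v].

(* The identification is an equivalence relation, trivial on each chart. By
   the last clause the points common to two charts form an open subset of
   each, and the transition maps are regular. The variety is separated since
   the zero set of [aglue i j] is closed in the product of the charts. *)
Definition is_variety (k : fieldType) (V : atlas k) : Prop :=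
  [/\ forall (i : chart V) v w,
        same (mkpt (i := i) v) (mkpt w) <-> onv (mkpt (i := i) v) /\ v =1 w,
      forall x y : pt V, same x y -> same y x,
      forall x y z : pt V, same x y -> same y z -> same x z
    & forall x y : pt V, same x y ->
        exists num den : 'I_(adim (tag y)) -> {mpoly k[adim (tag x)]},
          fdef den (tagged x) /\
          forall v, onv (mkpt (i := tag x) v) -> fdef den v ->
            same (mkpt (i := tag x) v) (mkpt (i := tag y) (fval num den v))].

(** ** Closed subsets *)

Definition closed_data (k : fieldType) (V : atlas k) :=
  forall i : chart V, seq {mpoly k[adim i]}.

Definition inC (k : fieldType) (V : atlas k) (C : closed_data V) (x : pt V) :=
  onv x /\ zeros (C (tag x)) (tagged x).

Definition is_closed (k : fieldType) (V : atlas k) (C : closed_data V) : Prop :=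
  forall x y, same x y -> inC C x -> inC C y.

Definition irreducible (k : fieldType) (V : atlas k) : Prop :=
  (exists x : pt V, onv x) /\
  forall C D : closed_data V, is_closed C -> is_closed D ->
    (forall x, onv x -> inC C x \/ inC D x) ->
    (forall x, onv x -> inC C x) \/ (forall x, onv x -> inC D x).

Definition sub (k : fieldType) (V : atlas k) (X : closed_data V) : atlas k :=
  @Atlas k (chart V) (@adim k V) (fun i => aeqs i ++ X i) (@aglue k V).

(** ** Affine spaces and products *)

Definition aspace (k : fieldType) (l : nat) : atlas k :=
  @Atlas k unit (fun _ => l) (fun _ => [::])
    (fun _ _ => [seq 'X_(lshift l i) - 'X_(rshift l i) | i <- enum 'I_l]).

Definition prodv (k : fieldType) (V W : atlas k) : atlas k :=
  @Atlas k (chart V * chart W)%type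
    (fun i => adim i.1 + adim i.2)%N
    (fun i => map (mren (@lshift _ _)) (aeqs i.1) ++
              map (mren (@rshift _ _)) (aeqs i.2))
    (fun i j =>
       map (mren (vcat (fun a => lshift _ (lshift _ a))
                       (fun b => rshift _ (lshift _ b)))) (aglue i.1 j.1) ++
       map (mren (vcat (fun a => lshift _ (rshift _ a))
                       (fun b => rshift _ (rshift _ b)))) (aglue i.2 j.2)).

Definition pr2 (k : fieldType) (V W : atlas k) (x : pt (prodv V W)) : pt W :=
  mkpt (i := (tag x).2) (fun b => tagged x (rshift _ b)).

(** ** Rational maps *)

(* A rational map is presented by a tuple of rational functions on one chart
   of [V], with values in one chart of [W]. *)
Record ratmap (k : fieldType) (V W : atlas k) := Ratmap {
  rsrc : chart V;
  rtgt : chart W;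
  rnum : 'I_(adim rtgt) -> {mpoly k[adim rsrc]};
  rden : 'I_(adim rtgt) -> {mpoly k[adim rsrc]} }.

Definition is_ratmap (k : fieldType) (V W : atlas k) (f : ratmap V W) : Prop :=
  (exists v, onv (mkpt (i := rsrc f) v) /\ fdef (@rden _ _ _ f) v) /\
  forall v, onv (mkpt (i := rsrc f) v) -> fdef (@rden _ _ _ f) v ->
    onv (mkpt (i := rtgt f) (fval (@rnum _ _ _ f) (@rden _ _ _ f) v)).

(* The value at [x] read off from the given presentation. *)
Definition pval (k : fieldType) (V W : atlas k) (f : ratmap V W)
    (x : pt V) (y : pt W) : Prop :=
  exists v, [/\ same x (mkpt (i := rsrc f) v), fdef (@rden _ _ _ f) v
    & same y (mkpt (i := rtgt f) (fval (@rnum _ _ _ f) (@rden _ _ _ f) v))].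

Definition rat_equiv (k : fieldType) (V W : atlas k) (f g : ratmap V W) :=
  forall x y y', pval f x y -> pval g x y' -> same y y'.

(* The graph of the rational map on its full domain of definition. *)
Definition rval (k : fieldType) (V W : atlas k) (f : ratmap V W)
    (x : pt V) (y : pt W) : Prop :=
  exists g, [/\ is_ratmap g, rat_equiv f g & pval g x y].

Definition rdom (k : fieldType) (V W : atlas k) (f : ratmap V W) (x : pt V) :=
  exists y, rval f x y.

Definition rcomp (A B C : Type) (R : A -> B -> Prop) (S : B -> C -> Prop) :
    A -> C -> Prop := fun x z => exists y, R x y /\ S y z.

(* Equality of two composites of rational maps on an irreducible variety [V]:
   both are defined somewhere, and they agree wherever both are defined. *)
Definition rat_agree (k : fieldType) (V W : atlas k)
    (R S : pt V -> pt W -> Prop) : Prop :=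
  [/\ exists x y, R x y, exists x y, S x y
    & forall x y y', R x y -> S x y' -> same y y'].

Definition dominant (k : fieldType) (V W : atlas k) (f : ratmap V W) : Prop :=
  forall C : closed_data W, is_closed C ->
    (forall x y, rval f x y -> inC C y) -> forall y, onv y -> inC C y.

Definition rat_id (k : fieldType) (V : atlas k) (x y : pt V) : Prop :=
  same x y.

Definition birational (k : fieldType) (V W : atlas k) (g : ratmap V W) : Prop :=
  is_ratmap g /\ exists h : ratmap W V,
    [/\ is_ratmap h,
        rat_agree (rcomp (rval g) (rval h)) (@rat_id k V)
      & rat_agree (rcomp (rval h) (rval g)) (@rat_id k W)].

(** ** Transforms under an endomorphism of the base field *)

Section Twist.
Context (k : fieldType) (s : {rmorphism k -> k}).

Definition twist (V : atlas k) : atlas k :=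
  @Atlas k (chart V) (@adim k V)
    (fun i => map (map_mpoly s) (aeqs i))
    (fun i j => map (map_mpoly s) (aglue i j)).

Definition twistC (V : atlas k) (C : closed_data V) : closed_data (twist V) :=
  fun i => map (map_mpoly s) (C i).

Definition twistR (V W : atlas k) (f : ratmap V W) :
    ratmap (twist V) (twist W) :=
  @Ratmap k (twist V) (twist W) (rsrc f) (rtgt f)
    (fun i => map_mpoly s (rnum (r := f) i))
    (fun i => map_mpoly s (rden (r := f) i)).

(** ** Rational sigma-varieties *)

Definition rational_svariety (V : atlas k) (phi : ratmap V (twist V)) : Prop :=
  [/\ is_variety V, irreducible V, is_ratmap phi & dominant phi].

Definition invariant_subvariety (V : atlas k) (phi : ratmap V (twist V))
    (X : closed_data V) : Prop :=
  [/\ is_closed X, irreducible (sub X), exists x, inC X x /\ rdom phi x,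
      forall x y, inC X x -> rval phi x y -> inC (twistC X) y
    & forall C : closed_data (twist V), is_closed C ->
        (forall x y, inC X x -> rval phi x y -> inC C y) ->
        forall y, inC (twistC X) y -> inC C y].

Definition proper_closed (V : atlas k) (X : closed_data V) : Prop :=
  exists x, onv x /\ ~ inC X x.

Definition subC (V : atlas k) (X Y : closed_data V) : Prop :=
  forall x, inC X x -> inC Y x.

Definition max_proper_invariant (V : atlas k) (phi : ratmap V (twist V))
    (X : closed_data V) : Prop :=
  [/\ invariant_subvariety phi X, proper_closed X
    & forall Y, invariant_subvariety phi Y -> proper_closed Y -> subC X Y -> subC Y X].

(* The two maps are given by their graphs so that [psi] may be the restriction
   to a closed subvariety of a rational map of the ambient variety. *)
Definition equivariant (V W : atlas k) (phi : pt V -> pt (twist V) -> Prop)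
    (psi : pt W -> pt (twist W) -> Prop) (g : ratmap V W) : Prop :=
  @rat_agree k V (twist W) (rcomp (rval g) psi) (rcomp phi (rval (twistR g))).

Definition sprod (V Z : atlas k) (phi : ratmap V (twist V))
    (psi : ratmap Z (twist Z)) : ratmap (prodv V Z) (twist (prodv V Z)) :=
  @Ratmap k (prodv V Z) (twist (prodv V Z))
    (rsrc phi, rsrc psi) (rtgt phi, rtgt psi)
    (vcat (fun a => mren (@lshift _ _) (rnum (r := phi) a))
          (fun b => mren (@rshift _ _) (rnum (r := psi) b)))
    (vcat (fun a => mren (@lshift _ _) (rden (r := phi) a))
          (fun b => mren (@rshift _ _) (rden (r := psi) b))).

Definition aspace_id (l : nat) : ratmap (aspace k l) (twist (aspace k l)) :=
  @Ratmap k (aspace k l) (twist (aspace k l)) tt tt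
    (fun i => 'X_i) (fun _ => 1).

Definition isotrivial (V : atlas k) (phi : ratmap V (twist V)) : Prop :=
  exists (Z : atlas k) (psi : ratmap Z (twist Z)) (l : nat)
         (Y : closed_data (prodv (aspace k l) Z))
         (g : ratmap (prodv V Z) (sub Y)),
    [/\ rational_svariety psi,
        invariant_subvariety (sprod (aspace_id l) psi) Y,
        birational g,
        @equivariant (prodv V Z) (sub Y) (rval (sprod phi psi))
          (rval (sprod (aspace_id l) psi)) g
      & forall x y, rval g x y ->
          same (pr2 x) (@pr2 k (aspace k l) Z y)].

(* Elements of k(V) are rational maps from [V] to the affine line. *)
Definition invariant_function (V : atlas k) (phi : ratmap V (twist V))
    (lam : ratmap V (aspace k 1)) : Prop :=
  is_ratmap lam /\
  @rat_agree k V (aspace k 1) (rval lam) (rcomp (rval phi) (rval (twistR lam))).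

Definition constant_function (V : atlas k) (lam : ratmap V (aspace k 1)) :=
  exists c : k, forall x y, rval lam x y -> tagged y ord0 = c.

End Twist.

(* Main.v *)
From HB Require Import structures.
Require Import Defs.
From mathcomp Require Import all_boot all_order all_algebra.
From mathcomp Require Import mpoly.
From mathcomp Require Import fieldext generic_quotient ring_quotient fraction.
From mathcomp Require Import ring.
From Stdlib Require Import Classical ClassicalEpsilon FunctionalExtensionality.
Set Implicit Arguments. Unset Strict Implicit. Unset Printing Implicit Defensive.
Import Order.TTheory GRing.Theory.
Local Open Scope ring_scope.

(** Both parts rest on one statement about a tuple [a] such that [s a] is a
    rational function of [a] over [k], where [s] is the endomorphism. Suppose
    that [a] is rational over a difference field [K] in fixed elements, that [a]
    and [K] are independent over [k], and that all fixed elements of [k(a)] lie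
    in [k]. Then there is a polynomial [h] over [k] with [h(a) <> 0] such that
    every irreducible set of [k]-points in the locus of [a] which is invariant
    under the dynamics, and on which [h] is not identically zero, is dense in
    that locus. This is [invariant_sets_dense].

    The reason is as follows. Linear algebra over constants
    ([internal_constants]) allows to take the fixed elements in [K(a)]: there is
    a finite tuple [c] of constants of [K(a)] with [K(c) = K(a)]. On an invariant
    set [X] the coordinates [c], being rational functions over [K], are moved by
    the dynamics as by [s] alone. So the ideal over [K] of the image of [X] in
    these coordinates is stable under [s], and it is generated by polynomials
    with constant coefficients ([fixed_span]). If [X] is not dense, one of them,
    [P0], does not vanish at [c]. On the other hand, since the constants of
    [k(a)] are in [k], the field [k(a)] is linearly disjoint over [k] from all
    constants ([fixed_indep]). So [a] can be specialised to a point [x0] of [X]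
    with the constants of [K(a)] unmoved ([B_specialise]). Then [P0(c) <> 0] is
    unmoved as well, while [c], as a function of [a], takes at [x0] a value
    annihilated by [P0]. The polynomial [h] is what is needed to extend the
    specialisation to the finitely many elements of [K] involved
    ([extend_list]).

    In the statement about types, [K] is the field given by internality, and
    weak orthogonality says that [k(a)] has no constants outside [k]. Internality
    provides independence in the form of algebraic disjointness, and since [k] is
    algebraically closed, tuples that are disjoint from [K] can be specialised
    to [k] over [K] ([specialise]). By Hilbert's basis theorem finitely many
    equations define the locus of [a]. They isolate the type, together with the
    equations of the dynamics and [h <> 0]: the [k]-points of the locus of
    another solution [b] form an invariant set as above, so [b] has the same
    ideal as [a], hence the same quantifier-free type.

    In the geometric statement [a] is the generic point of [V], [K] is the
    function field of the variety [Z] trivialising [V], and independence holds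
    because the pair of generic points is generic on the product. The
    trivialisation maps the dynamics to the identity on affine space, so its
    coordinates are fixed elements, which generate [K(a)] over [K]
    ([generic_point_internal]). Fixed elements of [k(a)] are invariant rational
    functions ([fixed_const]). It follows that all proper invariant subvarieties
    are contained in one proper closed subset of [V], at least in one chart
    ([proper_invariant_not_dense]). Apply this to a family of maximal ones. If the closure of its union is irreducible, it
    is itself a proper invariant subvariety, and by maximality the family has
    one member. Otherwise it splits into two closed pieces, each member of the
    family lies in one of them, and Noetherian induction concludes
    ([finitely_many]).

    Rational maps come as formulas on one chart, with values defined through
    all equivalent presentations. Most of the geometry below serves to read such
    maps, their composites, products and transforms in prescribed charts near
    generic points; this only uses that locally they are graphs of rational
    tuples ([locrat]). *)

(** * Subrings, subfields and polynomial functions *)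

Record subring (U : fieldType) (B : U -> Prop) : Prop := Subring {
  sr1 : B 1;
  srB : forall x y, B x -> B y -> B (x - y);
  srM : forall x y, B x -> B y -> B (x * y) }.

Record subfield (U : fieldType) (B : U -> Prop) : Prop := Subfield {
  sf_sr : subring B;
  sfV : forall x, B x -> B x^-1 }.

Section SubringTheory.
Variables (U : fieldType) (B : U -> Prop) (hB : subring B).

Lemma sr0 : B 0.
Proof. by rewrite -(subrr 1); apply: (srB hB); apply: sr1. Qed.
Lemma srN x : B x -> B (- x).
Proof. by move=> hx; rewrite -sub0r; apply: (srB hB) => //; apply: sr0. Qed.
Lemma srD x y : B x -> B y -> B (x + y).
Proof. by move=> hx hy; rewrite -[y]opprK; apply: (srB hB) => //; apply: srN. Qed.
Lemma srX x n : B x -> B (x ^+ n).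
Proof.
move=> hx; elim: n => [|n IH]; first exact: sr1.
by rewrite exprS; apply: srM.
Qed.
Lemma sr_nat n : B n%:R.
Proof.
elim: n => [|n IH]; first exact: sr0.
by rewrite -addn1 natrD; apply: srD => //; apply: sr1.
Qed.
Lemma sr_sum I (r : seq I) (P : pred I) (F : I -> U) :
  (forall i, P i -> B (F i)) -> B (\sum_(i <- r | P i) F i).
Proof. by move=> h; apply: big_ind => //; [apply: sr0|apply: srD]. Qed.
Lemma sr_prod I (r : seq I) (P : pred I) (F : I -> U) :
  (forall i, P i -> B (F i)) -> B (\prod_(i <- r | P i) F i).
Proof. by move=> h; apply: big_ind => //; [apply: sr1|apply: srM]. Qed.

End SubringTheory.

Lemma sf_div (U : fieldType) (B : U -> Prop) (hB : subfield B) x y :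
  B x -> B y -> B (x / y).
Proof. by move=> hx hy; apply: (srM (sf_sr hB)) => //; apply: sfV. Qed.

(** Polynomials are handled as functions rather than through their
    coefficients: below they are only evaluated, and substitutions into them
    stay in the class by construction. *)
Inductive polyfun (U : fieldType) (B : U -> Prop) (I : Type) :
    ((I -> U) -> U) -> Prop :=
| PfC c : B c -> polyfun B (fun _ => c)
| PfX i : polyfun B (fun v => v i)
| PfD f g : polyfun B f -> polyfun B g -> polyfun B (fun v => f v + g v)
| PfM f g : polyfun B f -> polyfun B g -> polyfun B (fun v => f v * g v).

Section PolyfunTheory.
Variables (U : fieldType) (B : U -> Prop) (hB : subring B).

Lemma polyfun_mono I (B' : U -> Prop) (f : (I -> U) -> U) :
  (forall x, B x -> B' x) -> polyfun B f -> polyfun B' f.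
Proof.
move=> h; elim=> [c /h ?|i|f1 f2 _ IH1 _ IH2|f1 f2 _ IH1 _ IH2].
- exact: PfC.
- exact: PfX.
- exact: PfD.
- exact: PfM.
Qed.

Lemma polyfun_sub I (f g : (I -> U) -> U) :
  polyfun B f -> polyfun B g -> polyfun B (fun v => f v - g v).
Proof.
move=> hf hg; suff -> : (fun v => f v - g v) = (fun v => f v + -1 * g v).
  apply: PfD => //; apply: PfM => //; apply: PfC; apply: srN => //; exact: sr1.
by apply: functional_extensionality => v; rewrite mulN1r.
Qed.

Lemma polyfun_sum I J (r : seq J) (P : pred J) (F : J -> (I -> U) -> U) :
  (forall j, P j -> polyfun B (F j)) ->
  polyfun B (fun v => \sum_(j <- r | P j) F j v).
Proof.
move=> h; elim: r => [|j r IH].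
  suff -> : (fun v => \sum_(j <- [::] | P j) F j v) = (fun=> 0).
    (by apply: PfC; apply: sr0).
  by apply: functional_extensionality => v; rewrite big_nil.
case Pj: (P j); last first.
  suff -> : (fun v => \sum_(i <- j :: r | P i) F i v)
      = (fun v => \sum_(i <- r | P i) F i v) by [].
  by apply: functional_extensionality => v; rewrite big_cons Pj.
suff -> : (fun v => \sum_(i <- j :: r | P i) F i v)
      = (fun v => F j v + \sum_(i <- r | P i) F i v) by apply: PfD => //; apply: h.
by apply: functional_extensionality => v; rewrite big_cons Pj.
Qed.

Lemma polyfun_prod I J (r : seq J) (P : pred J) (F : J -> (I -> U) -> U) :
  (forall j, P j -> polyfun B (F j)) ->
  polyfun B (fun v => \prod_(j <- r | P j) F j v).
Proof.
move=> h; elim: r => [|j r IH].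
  suff -> : (fun v => \prod_(j <- [::] | P j) F j v) = (fun=> 1).
    (by apply: PfC; apply: sr1).
  by apply: functional_extensionality => v; rewrite big_nil.
case Pj: (P j); last first.
  suff -> : (fun v => \prod_(i <- j :: r | P i) F i v)
      = (fun v => \prod_(i <- r | P i) F i v) by [].
  by apply: functional_extensionality => v; rewrite big_cons Pj.
suff -> : (fun v => \prod_(i <- j :: r | P i) F i v)
      = (fun v => F j v * \prod_(i <- r | P i) F i v) by apply: PfM => //; apply: h.
by apply: functional_extensionality => v; rewrite big_cons Pj.
Qed.

Lemma polyfun_exp I (f : (I -> U) -> U) n : polyfun B f -> polyfun B (fun v => f v ^+ n).
Proof.
move=> hf; elim: n => [|n IH]; first (by apply: PfC; apply: sr1).
suff -> : (fun v => f v ^+ n.+1) = (fun v => f v * f v ^+ n) by apply: PfM.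
by apply: functional_extensionality => v; rewrite exprS.
Qed.

Lemma polyfun_val I (S : U -> Prop) (f : (I -> U) -> U) v : subring S -> polyfun B f ->
  (forall x, B x -> S x) -> (forall i, S (v i)) -> S (f v).
Proof.
move=> hS hf hBS hv; elim: hf => [c /hBS|i|f1 f2 _ IH1 _ IH2|f1 f2 _ IH1 _ IH2] //.
- exact: srD.
- exact: srM.
Qed.

Lemma polyfun_comp I J (f : (I -> U) -> U) (G : I -> (J -> U) -> U) :
  polyfun B f -> (forall i, polyfun B (G i)) -> polyfun B (fun y => f (fun i => G i y)).
Proof.
move=> hf hG; elim: hf => [c hc|i|f1 f2 _ IH1 _ IH2|f1 f2 _ IH1 _ IH2].
- exact: PfC.
- exact: hG.
- exact: PfD.
- exact: PfM.
Qed.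

(** The exponent [d] only depends on [f]: one power of the product of the
    denominators clears them at all points [y] at once. *)
Lemma polyfun_clear (J : Type) (I' : finType) (f : (I' -> U) -> U)
    (A D : I' -> (J -> U) -> U) :
  polyfun B f -> (forall i, polyfun B (A i)) -> (forall i, polyfun B (D i)) ->
  exists P d, polyfun B P /\ forall y, (forall i, D i y != 0) ->
    P y = f (fun i => A i y / D i y) * (\prod_i D i y) ^+ d.
Proof.
move=> hf hA hD; elim: hf => [c hc|i|f1 f2 _ [P1 [d1 [h1 e1]]] _ [P2 [d2 [h2 e2]]]
   |f1 f2 _ [P1 [d1 [h1 e1]]] _ [P2 [d2 [h2 e2]]]].
- by exists (fun=> c), 0%N; split=> [|y _]; [apply: PfC|rewrite expr0 mulr1].
- exists (fun y => A i y * \prod_(j | j != i) D j y), 1%N; split.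
    by apply: PfM => //; apply: polyfun_prod => j _.
  move=> y hy; by rewrite expr1 [in RHS](bigD1 i) //= mulrA divfK.
- exists (fun y => P1 y * (\prod_i D i y) ^+ d2 + P2 y * (\prod_i D i y) ^+ d1), (d1 + d2)%N.
  have hp e : polyfun B (fun y => (\prod_i D i y) ^+ e).
    by apply: polyfun_exp; apply: polyfun_prod.
  split; first by apply: PfD; apply: PfM.
  by move=> y hy; rewrite e1 // e2 // mulrDl exprD mulrA -!mulrA; congr (_ + _ * _); rewrite mulrC.
- exists (fun y => P1 y * P2 y), (d1 + d2)%N; split; first exact: PfM.
  by move=> y hy; rewrite e1 // e2 // exprD mulrACA.
Qed.

(** Monomials have their coefficients in every subring [S]. Separating the
    coefficients of [f] from the evaluation in this way is how linear algebra
    over [B] enters. *)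
Lemma polyfun_decomp I (S : U -> Prop) (f : (I -> U) -> U) : subring S -> polyfun B f ->
  exists (J : finType) (kap : J -> U) (g : J -> (I -> U) -> U),
  [/\ forall j, B (kap j), forall j, polyfun S (g j)
    & forall v, f v = \sum_j kap j * g j v].
Proof.
move=> hS; elim=> [c hc|i|f1 f2 _ [J1 [k1 [g1 [hk1 hg1 e1]]]] _ [J2 [k2 [g2 [hk2 hg2 e2]]]]
   |f1 f2 _ [J1 [k1 [g1 [hk1 hg1 e1]]]] _ [J2 [k2 [g2 [hk2 hg2 e2]]]]].
- exists unit, (fun=> c), (fun _ _ => 1); split=> // [j|v]; first (by apply: PfC; apply: sr1).
  by rewrite (bigD1 tt) //= big1 ?addr0 ?mulr1 // => -[].
- exists unit, (fun=> 1), (fun _ v => v i); split=> // [j|j|v]; first exact: sr1.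
    exact: PfX.
  by rewrite (bigD1 tt) //= big1 ?addr0 ?mul1r // => -[].
- exists (J1 + J2)%type, (fun j => match j with inl x => k1 x | inr x => k2 x end),
    (fun j => match j with inl x => g1 x | inr x => g2 x end).
  split=> [[j|j]|[j|j]|v] //.
  by rewrite big_sumType /= e1 e2.
- exists (J1 * J2)%type, (fun j => k1 j.1 * k2 j.2), (fun j v => g1 j.1 v * g2 j.2 v).
  split=> [j|j|v]; [exact: srM|exact: PfM|].
  rewrite e1 e2 big_distrlr /= pair_big /=; apply: eq_bigr => j _.
  by rewrite mulrACA.
Qed.

End PolyfunTheory.

(** The endomorphism is applied to the coefficients. *)
Lemma polyfun_twist (U : fieldType) (s : {rmorphism U -> U}) (B : U -> Prop)
    (hs : forall x, B x -> B (s x)) (I : Type) (f : (I -> U) -> U) :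
  polyfun B f -> exists g, polyfun B g /\ forall v, g (fun i => s (v i)) = s (f v).
Proof.
elim=> [c hc|i|f1 f2 _ [g1 [h1 e1]] _ [g2 [h2 e2]]|f1 f2 _ [g1 [h1 e1]] _ [g2 [h2 e2]]].
- by exists (fun=> s c); split => //; apply: PfC; apply: hs.
- by exists (fun v => v i); split => //; apply: PfX.
- by exists (fun v => g1 v + g2 v); split=> [|v]; [apply: PfD|rewrite e1 e2 rmorphD].
- by exists (fun v => g1 v * g2 v); split=> [|v]; [apply: PfM|rewrite e1 e2 rmorphM].
Qed.

(** With coefficients coming from [k], polynomial functions are the same as
    formal polynomials over [k]. *)
Lemma polyfun_mpoly (k U : fieldType) (iota : {rmorphism k -> U}) n (p : {mpoly k[n]}) :
  polyfun (img iota) (fun v => (map_mpoly iota p).@[v]).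
Proof.
have hI : subring (img iota).
  split; first by exists 1; rewrite rmorph1.
    by move=> _ _ [x ->] [y ->]; exists (x - y); rewrite rmorphB.
  by move=> _ _ [x ->] [y ->]; exists (x * y); rewrite rmorphM.
elim/mpolyind: p => [|c m p _ _ IH].
  suff -> : (fun v => (map_mpoly iota (0 : {mpoly k[n]})).@[v]) = (fun=> 0).
    by apply: PfC; exists 0; rewrite rmorph0.
  by apply: functional_extensionality => v; rewrite !raddf0.
suff -> : (fun v => (map_mpoly iota (c *: 'X_[m] + p)).@[v])
   = (fun v => iota c * \prod_i v i ^+ m i + (map_mpoly iota p).@[v]).
  apply: PfD => //; apply: PfM; first by apply: PfC; exists c.
  apply: polyfun_prod => // i _; apply: polyfun_exp => //; exact: PfX.
apply: functional_extensionality => v.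
by rewrite raddfD /= mevalD map_mpolyZ mevalZ map_mpolyX mevalX.
Qed.

Lemma mpoly_of_polyfun (k U : fieldType) (iota : {rmorphism k -> U}) n f :
  polyfun (img iota) f -> exists p : {mpoly k[n]}, forall v, f v = (map_mpoly iota p).@[v].
Proof.
elim=> [_ [c ->]|i|f1 f2 _ [p1 e1] _ [p2 e2]|f1 f2 _ [p1 e1] _ [p2 e2]].
- by exists c%:MP => v; rewrite map_mpolyC mevalC.
- by exists 'X_i => v; rewrite map_mpolyX mevalXU.
- by exists (p1 + p2) => v; rewrite e1 e2 rmorphD mevalD.
- by exists (p1 * p2) => v; rewrite e1 e2 rmorphM mevalM.
Qed.

Lemma meval_map (k U : fieldType) (iota : {rmorphism k -> U}) n (p : {mpoly k[n]}) v :
  (map_mpoly iota p).@[fun i => iota (v i)] = iota p.@[v].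
Proof.
elim/mpolyind: p => [|c m p _ _ IH]; first by rewrite !raddf0.
rewrite raddfD /= !mevalD map_mpolyZ !mevalZ map_mpolyX !mevalX rmorphD IH rmorphM.
by congr (_ * _ + _); rewrite rmorph_prod; apply: eq_bigr => i _; rewrite rmorphXn.
Qed.

Lemma img_subfield (k U : fieldType) (iota : {rmorphism k -> U}) : subfield (img iota).
Proof.
split; first split; first by exists 1; rewrite rmorph1.
- by move=> _ _ [x ->] [y ->]; exists (x - y); rewrite rmorphB.
- by move=> _ _ [x ->] [y ->]; exists (x * y); rewrite rmorphM.
- by move=> _ [x ->]; exists (x^-1); rewrite fmorphV.
Qed.

Lemma div_eq_cross (F : fieldType) (a b c d : F) : b != 0 -> d != 0 ->
  (a / b = c / d <-> a * d - c * b = 0).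
Proof.
move=> nb nd; split=> [/eqP|e]; first by rewrite eqr_div // => /eqP ->; rewrite subrr.
by apply/eqP; rewrite eqr_div // -subr_eq0 e.
Qed.

(** ** Fields generated over a subfield *)

Definition fgen (U : fieldType) (B : U -> Prop) (I : Type) (v : I -> U) : U -> Prop :=
  fun z => exists f g, [/\ polyfun B f, polyfun B g, g v != 0 & z = f v / g v].

Section Fgen.
Variables (U : fieldType) (B : U -> Prop) (hB : subring B) (I : Type) (v : I -> U).

Lemma fgen_pf f : polyfun B f -> fgen B v (f v).
Proof.
move=> hf; exists f, (fun=> 1); split=> //; first (by apply: PfC; apply: sr1).
  exact: oner_neq0.
by rewrite divr1.
Qed.
Lemma fgen_base c : B c -> fgen B v c.
Proof. by move=> hc; apply: (@fgen_pf (fun=> c)); apply: PfC. Qed.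
Lemma fgen_gen i : fgen B v (v i).
Proof. by apply: (@fgen_pf (fun v => v i)); apply: PfX. Qed.

Lemma fgen_subfield : subfield (fgen B v).
Proof.
split; first split; first (by apply: fgen_base; apply: sr1).
- move=> _ _ [f1 [g1 [hf1 hg1 n1 ->]]] [f2 [g2 [hf2 hg2 n2 ->]]].
  exists (fun v => f1 v * g2 v - f2 v * g1 v), (fun v => g1 v * g2 v); split.
  + by apply: polyfun_sub => //; apply: PfM.
  + exact: PfM.
  + by rewrite mulf_neq0.
  + by field; rewrite n1 n2.
- move=> _ _ [f1 [g1 [hf1 hg1 n1 ->]]] [f2 [g2 [hf2 hg2 n2 ->]]].
  exists (fun v => f1 v * f2 v), (fun v => g1 v * g2 v); split.
  + exact: PfM.
  + exact: PfM.
  + by rewrite mulf_neq0.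
  + by field; rewrite n1 n2.
- move=> _ [f1 [g1 [hf1 hg1 n1 ->]]].
  have [e|ne] := eqVneq (f1 v) 0.
    by rewrite e mul0r invr0; apply: fgen_base; apply: sr0.
  by exists g1, f1; split=> //; rewrite invf_div.
Qed.

Lemma fgen_min (L : U -> Prop) : subfield L -> (forall x, B x -> L x) ->
  (forall i, L (v i)) -> forall z, fgen B v z -> L z.
Proof.
move=> hL hBL hv _ [f [g [hf hg _ ->]]].
by apply: sf_div => //; apply: polyfun_val (sf_sr hL) _ hBL hv.
Qed.

Lemma fgen_stable (s : {rmorphism U -> U}) : (forall x, B x -> fgen B v (s x)) ->
  (forall i, fgen B v (s (v i))) -> forall z, fgen B v z -> fgen B v (s z).
Proof.
move=> hs hv; have hF := fgen_subfield.
apply: fgen_min => //; split; first split.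
- by rewrite rmorph1; apply: (sr1 (sf_sr hF)).
- by move=> x y hx hy; rewrite rmorphB; apply: (srB (sf_sr hF)).
- by move=> x y hx hy; rewrite rmorphM; apply: (srM (sf_sr hF)).
- by move=> x hx; rewrite fmorphV; apply: (sfV hF).
Qed.

End Fgen.

(** * Linear algebra over subfields and fixed elements *)

Section LinAlg.
Variables (U : fieldType) (J : finType).
Implicit Types (S : U -> Prop) (v : J -> U) (T : {set J}).

Definition indep_on S v T := forall c : J -> U, (forall j, S (c j)) ->
  \sum_(j in T) c j * v j = 0 -> forall j, j \in T -> c j = 0.

Lemma basis_exists S v : subfield S ->
  exists (T : {set J}) (om : J -> J -> U),
  [/\ indep_on S v T, forall i j, S (om i j)
    & forall i, v i = \sum_(j in T) om i j * v j].
Proof.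
move=> hS; have hR := sf_sr hS.
suff H n : forall T, indep_on S v T -> (#|~: T| < n)%N ->
    exists (T : {set J}) (om : J -> J -> U),
    [/\ indep_on S v T, forall i j, S (om i j)
      & forall i, v i = \sum_(j in T) om i j * v j].
  apply: (H (#|~: (set0 : {set J})|.+1) set0) => //.
  by move=> c _ _ j; rewrite inE.
elim: n => [|n IH] T hT; first by [].
rewrite ltnS => hn.
have [[i [iT hi]]|hno] := classic (exists i, i \notin T /\
    ~ exists om : J -> U, (forall j, S (om j)) /\ v i = \sum_(j in T) om j * v j).
  apply: (IH (i |: T)).
    move=> c hc; rewrite big_setU1 //= => e.
    have ci0 : c i = 0.
      have [//|ci] := eqVneq (c i) 0; case: hi; exists (fun j => - (c j / c i)).
      split=> [j|]; first by apply: srN => //; apply: sf_div.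
      apply: (mulfI ci); rewrite big_distrr /=.
      have /eqP := e; rewrite addr_eq0 => /eqP ->; rewrite -sumrN.
      by apply: eq_bigr => j _; field.
    move: e; rewrite ci0 mul0r add0r => /(hT c hc) h j.
    by rewrite !inE => /orP[/eqP ->|/h].
  apply: leq_trans hn; apply: proper_card; apply/properP; split.
    by apply/subsetP => j; rewrite !inE => /norP[].
  by exists i; rewrite !inE ?iT ?eqxx.
have ho i : exists om : J -> U, (forall j, S (om j)) /\ v i = \sum_(j in T) om j * v j.
  have [iT|iT] := boolP (i \in T).
    exists (fun j => (j == i)%:R); split=> [j|]; first exact: sr_nat.
    rewrite (bigD1 i) //= eqxx mul1r big1 ?addr0 // => j /andP[_ /negPf ->].
    by rewrite mul0r.
  by apply: NNPP => h; apply: hno; exists i.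
exists T, (fun i => proj1_sig (constructive_indefinite_description _ (ho i))).
by split=> // i; case: constructive_indefinite_description => om [h1 h2] //=.
Qed.

Variables (s : {rmorphism U -> U}) (K : U -> Prop).
Hypotheses (hK : subfield K) (sK : forall x, K x -> K (s x)).

(** Descent for semilinear actions: scale [w] so that one of its coordinates
    is [1]. Then [s w - w] has a smaller support; either it is nonzero, and
    induction applies to it, or [w] itself is fixed. *)
Lemma fixed_vector (W : (J -> U) -> Prop) :
  (forall w, W w -> forall j, K (w j)) ->
  (forall w w', W w -> W w' -> W (fun j => w j - w' j)) ->
  (forall c w, K c -> W w -> W (fun j => c * w j)) ->
  (forall w, W w -> W (fun j => s (w j))) ->
  forall w, W w -> (exists j, w j != 0) ->
  exists w', [/\ W w', forall j, s (w' j) = w' j, exists j, w' j != 0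
    & forall j, w j = 0 -> w' j = 0].
Proof.
move=> WK WB WZ Ws w.
have [n] := ubnP #|[set j | w j != 0]|; elim: n w => // n IH w.
rewrite ltnS => hn hw [j0 nj0].
pose u := fun j => (w j0)^-1 * w j.
have hu : W u by apply: WZ => //; apply: (sfV hK); apply: WK.
have hu0 : u j0 = 1 by rewrite /u mulVf.
have uw j : w j = 0 -> u j = 0 by move=> e; rewrite /u e mulr0.
pose e := fun j => s (u j) - u j.
have he : W e by apply: WB => //; apply: Ws.
have ew j : w j = 0 -> e j = 0.
  by move=> /uw h; rewrite /e h rmorph0 subr0.
have [[j1 nj1]|hno] := classic (exists j, e j != 0).
  have [||w' [h1 h2 h3 h4]] := IH e _ he.
  - apply: leq_trans hn; apply: proper_card; apply/properP; split.
      apply/subsetP => j; rewrite !inE; apply: contra => /eqP h.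
      by rewrite (ew _ h).
    by exists j0; rewrite !inE // /e hu0 rmorph1 subrr eqxx.
  - by exists j1.
  by exists w'; split=> // j /ew /h4.
exists u; split=> //.
- move=> j; apply: NNPP => h; apply: hno; exists j.
  by rewrite /e subr_eq0; apply/eqP.
- by exists j0; rewrite hu0 oner_neq0.
Qed.

(** Subtracting multiples of fixed vectors reduces the support until nothing
    is left, so that the fixed vectors span [W]. This is expressed by testing
    against a linear form [d], the form in which it is applied. *)
Lemma fixed_span (W : (J -> U) -> Prop) (d : J -> U) :
  (forall w, W w -> forall j, K (w j)) ->
  (forall w w', W w -> W w' -> W (fun j => w j - w' j)) ->
  (forall c w, K c -> W w -> W (fun j => c * w j)) ->
  (forall w, W w -> W (fun j => s (w j))) ->
  (forall w, W w -> (forall j, s (w j) = w j) -> \sum_j w j * d j = 0) ->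
  forall w, W w -> \sum_j w j * d j = 0.
Proof.
move=> WK WB WZ Ws Wd w.
have [n] := ubnP #|[set j | w j != 0]|; elim: n w => // n IH w.
rewrite ltnS => hn hw.
have [h0|hno] := classic (exists j, w j != 0); last first.
  apply: big1 => j _; have [->|h] := eqVneq (w j) 0; first by rewrite mul0r.
  by case: hno; exists j.
have [w' [h1 h2 [j1 nj1] h4]] := fixed_vector WK WB WZ Ws hw h0.
have hc : K (w j1 / w' j1) by apply: sf_div => //; apply: WK.
pose u := fun j => w j - w j1 / w' j1 * w' j.
have hu : W u by apply: WB => //; apply: WZ.
suff /IH/(_ hu) e : (#|[set j | u j != 0%R]| < n)%N.
  have -> : \sum_j w j * d j = \sum_j u j * d j + w j1 / w' j1 * \sum_j w' j * d j.
    rewrite big_distrr -big_split /=; apply: eq_bigr => j _.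
    by rewrite /u mulrBl mulrA subrK.
  by rewrite e Wd // mulr0 addr0.
apply: leq_trans hn; apply: proper_card; apply/properP; split.
  apply/subsetP => j; rewrite !inE; apply: contra => /eqP h.
  by rewrite /u h (h4 _ h) mulr0 subr0.
exists j1; rewrite !inE.
  by apply: contra nj1 => /eqP /h4 ->.
by rewrite /u divfK // subrr eqxx.
Qed.

(** The linear relations over [K] between fixed elements form a space stable
    under [s]; a nonzero fixed vector of it would be a relation over the
    constants of [K]. *)
Lemma fixed_indep (d : J -> U) (T : {set J}) :
  (forall j, s (d j) = d j) ->
  indep_on (fun z => K z /\ s z = z) d T -> indep_on K d T.
Proof.
move=> hd hT c hc e j jT; have hR := sf_sr hK.
apply: NNPP => /eqP nj.
pose W (w : J -> U) := [/\ forall j, K (w j), forall j, j \notin T -> w j = 0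
   & \sum_(j in T) w j * d j = 0].
pose c' j := if j \in T then c j else 0.
have hc' : W c'.
  split=> [i|i /negPf h|]; rewrite /c'; first by case: ifP => // _; apply: sr0.
    by rewrite h.
  by rewrite -[RHS]e; apply: eq_bigr => i ->.
have := @fixed_vector W _ _ _ _ c' hc' _; case.
- by move=> w [].
- move=> w w' [h1 h2 h3] [h1' h2' h3']; split=> [i|i hi|].
  + exact: srB.
  + by rewrite h2 // h2' // subr0.
  + under eq_bigr do rewrite mulrBl.
    by rewrite sumrB h3 h3' subr0.
- move=> z w hz [h1 h2 h3]; split=> [i|i hi|].
  + exact: srM.
  + by rewrite h2 // mulr0.
  + under eq_bigr do rewrite -mulrA.
    by rewrite -big_distrr /= h3 mulr0.
- move=> w [h1 h2 h3]; split=> [i|i hi|].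
  + exact: sK.
  + by rewrite h2 // rmorph0.
  + transitivity (s (\sum_(i in T) w i * d i)); last by rewrite h3 rmorph0.
    by rewrite rmorph_sum; apply: eq_bigr => i _; rewrite rmorphM hd.
- by exists j; rewrite /c' jT.
move=> w [[h1 h2 h3] h4 [i ni] _].
have /(hT w _ h3) h : i \in T by apply: contraNT ni => /h2 ->.
by move: ni; rewrite h ?eqxx // => l; split.
Qed.

End LinAlg.

(** * Extension of homomorphisms *)

Lemma ex_min (P : nat -> Prop) : (exists n, P n) ->
  exists n, P n /\ forall m, P m -> (n <= m)%N.
Proof.
case=> n; have [m] := ubnP n; elim: m n => // m IH n; rewrite ltnS => nm hn.
have [[i [lt hi]]|h] := classic (exists i, (i < n)%N /\ P i).
  by apply: (IH i) => //; apply: leq_trans nm.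
exists n; split=> // i hi; rewrite leqNgt; apply/negP => lt.
by apply: h; exists i.
Qed.

Definition poly_over (U : fieldType) (B : U -> Prop) (P : {poly U}) :=
  forall i, B P`_i.

Definition ring_adj (U : fieldType) (B : U -> Prop) (x : U) : U -> Prop :=
  fun z => exists P, poly_over B P /\ z = P.[x].

Section PolyOver.
Variables (U : fieldType) (B : U -> Prop) (hB : subring B).
Implicit Types P Q R : {poly U}.

Lemma poC c : B c -> poly_over B c%:P.
Proof. by move=> hc i; rewrite coefC; case: ifP => _ //; apply: sr0. Qed.
Lemma poX : poly_over B 'X.
Proof. by move=> i; rewrite coefX; apply: sr_nat. Qed.
Lemma poXn n : poly_over B 'X^n.
Proof. by move=> i; rewrite coefXn; apply: sr_nat. Qed.
Lemma poD P Q : poly_over B P -> poly_over B Q -> poly_over B (P + Q).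
Proof. by move=> hP hQ i; rewrite coefD; apply: srD. Qed.
Lemma poB P Q : poly_over B P -> poly_over B Q -> poly_over B (P - Q).
Proof. by move=> hP hQ i; rewrite coefB; apply: srB. Qed.
Lemma poM P Q : poly_over B P -> poly_over B Q -> poly_over B (P * Q).
Proof. by move=> hP hQ i; rewrite coefM; apply: sr_sum => // j _; apply: srM. Qed.
Lemma poZ c P : B c -> poly_over B P -> poly_over B (c *: P).
Proof. by move=> hc hP i; rewrite coefZ; apply: srM. Qed.

Lemma ring_adj_subring x : subring (ring_adj B x).
Proof.
split.
- by exists 1; rewrite hornerC; split=> //; apply: poC; apply: sr1.
- move=> _ _ [P [hP ->]] [Q [hQ ->]]; exists (P - Q).
  by rewrite hornerD hornerN; split=> //; apply: poB.
- move=> _ _ [P [hP ->]] [Q [hQ ->]]; exists (P * Q).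
  by rewrite hornerM; split=> //; apply: poM.
Qed.
Lemma ring_adj_base x z : B z -> ring_adj B x z.
Proof. by move=> hz; exists z%:P; rewrite hornerC; split=> //; apply: poC. Qed.
Lemma ring_adj_gen x : ring_adj B x x.
Proof. by exists 'X; rewrite hornerX; split=> //; apply: poX. Qed.

(** The point is that quotient and remainder keep their coefficients in the
    subring [B] of the field. *)
Lemma pseudo_div P : poly_over B P -> P != 0 -> forall F, poly_over B F ->
  exists N Q R, [/\ poly_over B Q, poly_over B R,
    lead_coef P ^+ N *: F = P * Q + R & (size R < size P)%N].
Proof.
move=> hP nP F; have [n] := ubnP (size F); elim: n F => // n IH F; rewrite ltnS => hn hF.
have [lt|le] := ltnP (size F) (size P).
  exists 0%N, 0, F; split=> //; last by rewrite expr0 scale1r mulr0 add0r.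
  by move=> i; rewrite coef0; apply: sr0.
pose m := (size F - size P)%N.
pose F' := lead_coef P *: F - lead_coef F *: ('X^m * P).
have hF' : poly_over B F'.
  apply: poB; first by apply: poZ => //; apply: hP.
  by apply: poZ; [apply: hF|apply: poM => //; apply: poXn].
have sP : (0 < size P)%N by rewrite size_poly_gt0.
have sF' : (size F' < size F)%N.
  rewrite -[X in (_ < X)%N](prednK (leq_trans sP le)) ltnS; apply/leq_sizeP => i.
  rewrite leq_eqVlt coefB !coefZ coefXnM => /orP[/eqP <-|].
    have -> : ((size F).-1 < m)%N = false.
      by apply/negbTE; rewrite -leqNgt /m; case: (size P) sP (size F) => // p _ [|f]; rewrite ?subSS ?leq_subr.
    rewrite !lead_coefE.
    have -> : ((size F).-1 - m)%N = (size P).-1.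
      by rewrite /m; case: (size P) sP le => // p _; case: (size F) => // f; rewrite ltnS subSS /= => ?; rewrite subKn.
    by rewrite mulrC subrr.
  move=> hi; have hi' : (size F <= i)%N by case: (size F) hi.
  rewrite (nth_default 0 hi') mulr0 sub0r.
  case: ifP => hm; first by rewrite mulr0 oppr0.
  rewrite [P`_ _]nth_default ?mulr0 ?oppr0 //.
  by rewrite leq_subRL ?(leq_trans _ hi') /m ?leq_subr // subnK.
have [N [Q [R [hQ hR e sR]]]] := IH F' (leq_trans sF' hn) hF'.
exists N.+1, (Q + (lead_coef P ^+ N * lead_coef F) *: 'X^m), R; split=> //.
  apply: poD => //; apply: poZ; last exact: poXn.
  by apply: srM => //; [apply: srX => //; apply: hP|apply: hF].
rewrite mulrDr addrAC -e /F' scalerBr !scalerA -exprSr -scalerAr [P * _]mulrC.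
by rewrite subrK.
Qed.

End PolyOver.

(** The rings met below are subsets of a field; a homomorphism on such a ring
    is a map on the whole field with arbitrary values elsewhere. *)
Record hom_on (U F : fieldType) (B : U -> Prop) (phi : U -> F) : Prop := HomOn {
  ho1 : phi 1 = 1;
  hoB : forall x y, B x -> B y -> phi (x - y) = phi x - phi y;
  hoM : forall x y, B x -> B y -> phi (x * y) = phi x * phi y }.

Section HomOnTheory.
Variables (U F : fieldType) (B : U -> Prop) (hB : subring B) (phi : U -> F).
Hypothesis hphi : hom_on B phi.

Lemma ho0 : phi 0 = 0.
Proof. by rewrite -(subrr 1) (hoB hphi) ?subrr //; apply: (sr1 hB). Qed.
Lemma hoN x : B x -> phi (- x) = - phi x.
Proof. by move=> hx; rewrite -sub0r (hoB hphi) ?ho0 ?sub0r //; apply: sr0. Qed.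
Lemma hoD x y : B x -> B y -> phi (x + y) = phi x + phi y.
Proof.
move=> hx hy; rewrite -[in LHS](opprK y) (hoB hphi) ?hoN ?opprK //; exact: srN.
Qed.
Lemma ho_sum I (r : seq I) (P : pred I) (f : I -> U) : (forall i, P i -> B (f i)) ->
  phi (\sum_(i <- r | P i) f i) = \sum_(i <- r | P i) phi (f i).
Proof.
move=> h; elim: r => [|i r IH]; first by rewrite !big_nil ho0.
rewrite !big_cons; case: ifP => // Pi; rewrite hoD ?IH //; first exact: h.
exact: sr_sum.
Qed.
Lemma hoX x n : B x -> phi (x ^+ n) = phi x ^+ n.
Proof.
move=> hx; elim: n => [|n IH]; first exact: (ho1 hphi).
by rewrite !exprS (hoM hphi) ?IH //; apply: srX.
Qed.
Lemma ho_nat n : phi n%:R = n%:R.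
Proof.
elim: n => [|n IH]; first exact: ho0.
by rewrite -addn1 !natrD hoD ?IH ?(ho1 hphi) //; [apply: sr_nat|apply: sr1].
Qed.

Lemma coef_ho P i : (map_poly phi P)`_i = phi P`_i.
Proof. by rewrite coef_map_id0 // ho0. Qed.
Lemma map_hoB P Q : poly_over B P -> poly_over B Q ->
  map_poly phi (P - Q) = map_poly phi P - map_poly phi Q.
Proof.
by move=> hP hQ; apply/polyP => i; rewrite coefB !coef_ho coefB (hoB hphi).
Qed.
Lemma map_hoZ c P : B c -> poly_over B P ->
  map_poly phi (c *: P) = phi c *: map_poly phi P.
Proof.
by move=> hc hP; apply/polyP => i; rewrite coefZ !coef_ho coefZ (hoM hphi).
Qed.
Lemma map_hoM P Q : poly_over B P -> poly_over B Q ->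
  map_poly phi (P * Q) = map_poly phi P * map_poly phi Q.
Proof.
move=> hP hQ; apply/polyP => i; rewrite coefM !coef_ho coefM ho_sum; last first.
  by move=> j _; apply: srM.
by apply: eq_bigr => j _; rewrite (hoM hphi) // !coef_ho.
Qed.
Lemma map_hoC c : map_poly phi c%:P = (phi c)%:P.
Proof. by apply/polyP => i; rewrite coef_ho !coefC; case: ifP => // _; rewrite ho0. Qed.
Lemma map_hoX : map_poly phi 'X = 'X.
Proof. by apply/polyP => i; rewrite coef_ho !coefX ho_nat. Qed.

Lemma ho_polyfun I (S : U -> Prop) (f : (I -> U) -> U) v w :
  polyfun S f -> (forall x, S x -> B x) -> (forall i, B (v i)) -> (forall i, B (w i)) ->
  (forall i, phi (v i) = phi (w i)) -> phi (f v) = phi (f w).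
Proof.
move=> hf hSB hv hw e.
suff [] : [/\ B (f v), B (f w) & phi (f v) = phi (f w)] by [].
elim: hf => [c /hSB|i|f1 f2 _ [a1 b1 e1] _ [a2 b2 e2]|f1 f2 _ [a1 b1 e1] _ [a2 b2 e2]] //.
- by split; [apply: srD|apply: srD|rewrite !hoD // e1 e2].
- by split; [apply: srM|apply: srM|rewrite !(hoM hphi) // e1 e2].
Qed.

(** The hypothesis makes the value at [P.[x]] independent of the choice of
    the polynomial [P]. *)
Lemma hom_extend x (xi : F) :
  (forall P, poly_over B P -> P.[x] = 0 -> (map_poly phi P).[xi] = 0) ->
  exists phi' : U -> F, hom_on (ring_adj B x) phi' /\
    forall P, poly_over B P -> phi' P.[x] = (map_poly phi P).[xi].
Proof.
move=> hker.
pose R z w := exists P, [/\ poly_over B P, z = P.[x] & w = (map_poly phi P).[xi]].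
pose phi' z := epsilon (inhabits (0 : F)) (R z).
have hphi' P : poly_over B P -> phi' P.[x] = (map_poly phi P).[xi].
  move=> hP; have : exists w, R P.[x] w by exists (map_poly phi P).[xi], P.
  move/(epsilon_spec (inhabits (0 : F))) => [Q [hQ e]].
  rewrite -/(phi' _) => ->; apply/eqP; rewrite eq_sym -subr_eq0; apply/eqP.
  rewrite -hornerN -hornerD -map_hoB //; apply: hker; first exact: poB.
  by rewrite hornerD hornerN e subrr.
exists phi'; split=> //; split.
- rewrite -[in LHS](hornerC 1 x) hphi' ?map_hoC ?hornerC ?(ho1 hphi) //.
  exact: (poC hB (sr1 hB)).
- move=> _ _ [P [hP ->]] [Q [hQ ->]].
  by rewrite -hornerN -hornerD !hphi' ?map_hoB ?hornerD ?hornerN //; apply: poB.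
- move=> _ _ [P [hP ->]] [Q [hQ ->]].
  by rewrite -hornerM !hphi' ?map_hoM ?hornerM //; apply: poM.
Qed.

End HomOnTheory.

Lemma hom_on_comp (U F F' : fieldType) (B : U -> Prop) (phi : U -> F)
  (j : {rmorphism F -> F'}) : hom_on B phi -> hom_on B (fun z => j (phi z)).
Proof.
move=> [h1 h2 h3]; split=> [|x y hx hy|x y hx hy]; first by rewrite h1 rmorph1.
- by rewrite h2 // rmorphB.
- by rewrite h3 // rmorphM.
Qed.

Lemma root_extension (F : fieldType) (P : {poly F}) : (1 < size P)%N ->
  exists (F' : fieldType) (j : {rmorphism F -> F'}) (x : F'), root (map_poly j P) x.
Proof.
move=> sP.
have [|n [[D [sD DP eD]] hmin]] := @ex_min (fun n => exists D : {poly F},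
   [/\ (1 < size D)%N, D %| P & n = size D]).
  by exists (size P), P; split.
have irr : irreducible_poly D.
  split=> // q sq qD; have nD : D != 0 by rewrite -size_poly_gt0 ltnW.
  have nq : q != 0 by apply: contraTneq qD => ->; rewrite dvd0p.
  rewrite -dvdp_size_eqp // eqn_leq dvdp_leq //= -eD; apply: hmin; exists q; split=> //.
    by rewrite ltn_neqAle eq_sym sq size_poly_gt0.
  exact: dvdp_trans DP.
have [L _ [z hz _]] := irredp_FAdjoin irr.
exists L, (in_alg L), z; move: hz; rewrite -!dvdp_XsubCl => /dvdp_trans; apply.
by rewrite dvdp_map.
Qed.

Definition transc (U : fieldType) (B : U -> Prop) (x : U) :=
  forall P : {poly U}, poly_over B P -> P.[x] = 0 -> P = 0.

Lemma nat_nonroot (F : fieldType) (Q : {poly F}) : [pchar F] =i pred0 -> Q != 0 ->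
  exists n : nat, Q.[n%:R] != 0.
Proof.
move=> /pcharf0P ch nQ; apply: NNPP => h.
have := max_poly_roots (rs := [seq n%:R | n <- iota 0 (size Q)]) nQ.
rewrite size_map size_iota ltnn => H; suff : false by []; apply: H.
  apply/allP => _ /mapP[n _ ->]; apply/rootP; apply: NNPP => /eqP h'.
  by apply: h; exists n.
rewrite map_inj_uniq ?iota_uniq // => m n; wlog le : m n / (m <= n)%N => [W e|e].
  by have [/W ->|/ltnW /W ->] := leqP m n.
have /eqP := e; rewrite eq_sym -subr_eq0 -natrB // ch subn_eq0 => h'.
by apply/eqP; rewrite eqn_leq le.
Qed.

Section Ext.
Variables (U : fieldType) (B : U -> Prop) (hB : subring B).

(** Take [R <> 0] of minimal degree among the combinations of [Pf] and [P]. Up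
    to scalars it divides both of them, so it does not vanish at [x] and, [P]
    being minimal, it is constant: [R = Pf * G + P * H] gives the identity. *)
Lemma alg_divides (x : U) (P Pf : {poly U}) :
  poly_over B P -> P != 0 -> P.[x] = 0 ->
  (forall Q, poly_over B Q -> Q.[x] = 0 -> Q != 0 -> (size P <= size Q)%N) ->
  poly_over B Pf -> Pf.[x] != 0 ->
  exists (G : {poly U}) (b : U), [/\ poly_over B G, B b, b != 0 & Pf.[x] * G.[x] = b].
Proof.
move=> hP nP Px hmin hPf nf.
pose I (R : {poly U}) := exists G H, [/\ poly_over B G, poly_over B H & R = Pf * G + P * H].
have I_over R : I R -> poly_over B R.
  by move=> [G [H [hG hH ->]]]; apply: poD => //; apply: poM.
have IPf : I Pf.
  exists 1, 0; split; [exact: (poC hB (sr1 hB))| |by rewrite mulr1 mulr0 addr0].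
  by move=> i; rewrite coef0; apply: sr0.
have IP : I P.
  exists 0, 1; split; [|exact: (poC hB (sr1 hB))|by rewrite mulr1 mulr0 add0r].
  by move=> i; rewrite coef0; apply: sr0.
have IB R R' Q c : B c -> I R -> I R' -> poly_over B Q -> I (c *: R - R' * Q).
  move=> hc [G [H [hG hH ->]]] [G' [H' [hG' hH' ->]]] hQ.
  exists (c *: G - G' * Q), (c *: H - H' * Q); split.
  - by apply: poB => //; [apply: poZ|apply: poM].
  - by apply: poB => //; [apply: poZ|apply: poM].
  - by rewrite -!mul_polyC; ring.
have nPf : Pf != 0 by apply: contraNneq nf => ->; rewrite horner0.
have [|n [[R [IR nR sR]] hn]] := @ex_min (fun n => exists R, [/\ I R, R != 0 & size R = n]).
  by exists (size Pf), Pf.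
have hR := I_over _ IR.
have Rdiv S : I S -> exists c Q, [/\ B c, c != 0, poly_over B Q & c *: S = R * Q].
  move=> IS; have [N [Q [T [hQ hT e sT]]]] := pseudo_div hB hR nR (I_over _ IS).
  exists (lead_coef R ^+ N), Q; split=> //.
  - by apply: srX => //; apply: hR.
  - by rewrite expf_neq0 // lead_coef_eq0.
  - have eT : T = lead_coef R ^+ N *: S - R * Q by rewrite e addrC addKr.
    have [T0|nT] := eqVneq T 0; first by rewrite e T0 addr0.
    have := fun IT : I T => hn (size T) (ex_intro _ T (And3 IT nT erefl)).
    rewrite leqNgt -sR sT => h; suff /h : I T by [].
    by rewrite eT; apply: IB => //; apply: srX => //; apply: hR.
have [c [Q [hc nc hQ eQ]]] := Rdiv _ IP.
have [c2 [Q2 [hc2 nc2 hQ2 eQ2]]] := Rdiv _ IPf.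
have nRx : R.[x] != 0.
  apply: contraNneq nf => e; have := congr1 (horner^~ x) eQ2.
  rewrite hornerZ hornerM e mul0r => /eqP.
  by rewrite mulf_eq0 (negPf nc2).
have Qx : Q.[x] = 0.
  have := congr1 (horner^~ x) eQ; rewrite hornerZ Px mulr0 hornerM => /esym/eqP.
  by rewrite mulf_eq0 (negPf nRx) => /eqP.
have nQ : Q != 0.
  apply/eqP => e; have /eqP := eQ; rewrite e mulr0 scaler_eq0 (negPf nc) (negPf nP) //.
have s1 : (size R <= 1)%N.
  have := congr1 (fun q : {poly U} => size q) eQ; rewrite size_scale // size_mul // => e.
  have := hmin Q hQ Qx nQ; rewrite e.
  have : (0 < size Q)%N by rewrite size_poly_gt0.
  have : (0 < size R)%N by rewrite size_poly_gt0.
  case: (size R) => // r _; case: (size Q) => // q _.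
  by rewrite addnS addSn /= ltnS -{2}[q]add0n leq_add2r leqn0 => /eqP ->.
have eR := size1_polyC s1.
case: IR => G [H [hG hH eGH]].
exists G, R`_0; split=> //.
  by apply: contraNneq nR => e; rewrite eR e.
have := congr1 (horner^~ x) eGH; rewrite hornerD !hornerM Px mul0r addr0 => <-.
by rewrite {1}eR hornerC.
Qed.

(** If [x] is algebraic over [B] its image is a root of the image of a minimal
    equation, which exists in an extension of [F] when the leading coefficient
    survives; [f] survives if a nonzero multiple of it in [B] does. If [x] is
    transcendental any value avoiding the zeros of the image of [f] will do, and
    integers suffice in characteristic zero. The last clause records this
    choice, which keeps the value of [x] in the prime field. *)
Lemma extend_one (x f : U) : ring_adj B x f -> f != 0 ->
  exists g, [/\ B g, g != 0 & forall (F : fieldType) (phi : U -> F),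
    [pchar F] =i pred0 -> hom_on B phi -> phi g != 0 ->
    exists (F' : fieldType) (j : {rmorphism F -> F'}) (phi' : U -> F'),
    [/\ hom_on (ring_adj B x) phi', forall z, B z -> phi' z = j (phi z), phi' f != 0
      & transc B x -> exists n : nat, phi' x = n%:R]].
Proof.
move=> [Pf [hPf ef]] nf.
have nPf : Pf != 0 by apply: contraNneq nf => e; rewrite ef e horner0.
have [tr|ntr] := classic (transc B x).
  exists (lead_coef Pf); split; [exact: hPf|by rewrite lead_coef_eq0|].
  move=> F phi ch hphi ng.
  have nQ : map_poly phi Pf != 0.
    by apply: contraNneq ng => e; rewrite lead_coefE -(coef_ho hB hphi) e coef0.
  have [n hn] := nat_nonroot ch nQ.
  have [|phi' [h1 h2]] := @hom_extend _ _ _ hB _ hphi x n%:R.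
    by move=> P hP /tr -> //; rewrite (map_hoC hB hphi) (ho0 hB hphi) hornerC.
  exists F, idfun, phi'; split=> //.
  - by move=> z hz; have := h2 _ (poC hB hz); rewrite (map_hoC hB hphi) !hornerC.
  - by rewrite ef h2.
  - by exists n; have := h2 _ (poX hB); rewrite (map_hoX hB hphi) !hornerX.
have [|n [[P [hP Px nP <-]] hmin0]] := @ex_min (fun n => exists P : {poly U},
    [/\ poly_over B P, P.[x] = 0, P != 0 & size P = n]).
  apply: NNPP => h; apply: ntr => P hP Px; apply: NNPP => /eqP nP; apply: h.
  by exists (size P), P.
have hmin Q : poly_over B Q -> Q.[x] = 0 -> Q != 0 -> (size P <= size Q)%N.
  by move=> *; apply: hmin0; exists Q.
have [G [b [hG hb nb eb]]] := alg_divides hP nP Px hmin hPf (eq_rect _ (fun z => z != 0) nf _ ef).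
exists (lead_coef P * b); split.
- by apply: srM => //; apply: hP.
- by rewrite mulf_neq0 ?lead_coef_eq0.
move=> F phi ch hphi; rewrite (hoM hphi) ?mulf_eq0 ?negb_or; [|exact: hP|exact: hb].
case/andP=> nl nphib.
have sP1 : (1 < size P)%N.
  rewrite ltnNge; apply/negP => /size1_polyC e; move: Px nP; rewrite e hornerC => ->.
  by rewrite eqxx.
have sP2 : (1 < size (map_poly phi P))%N.
  suff -> : size (map_poly phi P) = size P by [].
  by rewrite size_poly_eq.
have [F' [j [xi rxi]]] := root_extension sP2.
have hphij := hom_on_comp j hphi.
have ejm : map_poly j (map_poly phi P) = map_poly (fun z => j (phi z)) P.
  apply/polyP => i; rewrite coef_map (coef_ho hB hphi) (coef_ho hB hphij) //.
have [|phi' [h1 h2]] := @hom_extend _ _ _ hB _ hphij x xi.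
  move=> Q hQ Qx; have [N [S [R [hS hR e sR]]]] := pseudo_div hB hP nP hQ.
  have R0 : R = 0.
    apply/eqP/negPn/negP => nR; have := hmin R hR _ nR; rewrite leqNgt sR => h.
    suff /h : R.[x] = 0 by [].
    have := congr1 (horner^~ x) e; rewrite hornerD hornerM hornerZ Px Qx mul0r mulr0 add0r.
    by move=> <-.
  have hlN : B (lead_coef P ^+ N) by apply: srX => //; apply: hP.
  have := congr1 (fun q => (map_poly (fun z => j (phi z)) q).[xi]) e.
  rewrite /= R0 addr0 (map_hoZ hB hphij) // (map_hoM hB hphij) // hornerZ hornerM.
  rewrite -ejm (rootP rxi) mul0r => /eqP; rewrite mulf_eq0 fmorph_eq0.
  rewrite (hoX hB hphi) ?expf_eq0 ?(negPf nl) ?andbF /=; last exact: hP.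
  by move/eqP.
exists F', j, phi'; split=> //.
- by move=> z hz; have := h2 _ (poC hB hz); rewrite (map_hoC hB hphij) !hornerC.
- have hadj := ring_adj_subring hB x.
  have := congr1 phi' eb; rewrite -ef (hoM h1); [|by exists Pf|by exists G].
  have := h2 _ (poC hB hb); rewrite (map_hoC hB hphij) !hornerC => -> e.
  apply: contraNneq nphib => e0; rewrite -(fmorph_eq0 j) -e e0 mul0r.
  by [].
Qed.

End Ext.

Definition ring_adjs (U : fieldType) (B : U -> Prop) (l : seq U) : U -> Prop :=
  foldl (@ring_adj U) B l.

Section Adjs.
Variables (U : fieldType).

Lemma adjs_rcons B (l : seq U) x : ring_adjs B (rcons l x) = ring_adj (ring_adjs B l) x.
Proof. by rewrite /ring_adjs foldl_rcons. Qed.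

Lemma adjs_subring B (l : seq U) : subring B -> subring (ring_adjs B l).
Proof.
move=> hB; elim/last_ind: l => [|l x IH] //; rewrite adjs_rcons; exact: ring_adj_subring.
Qed.

Lemma adjs_base B (l : seq U) z : subring B -> B z -> ring_adjs B l z.
Proof.
move=> hB hz; elim/last_ind: l => [|l x IH] //; rewrite adjs_rcons.
by apply: ring_adj_base => //; apply: adjs_subring.
Qed.

Lemma adjs_gen B (l : seq U) x : subring B -> x \in l -> ring_adjs B l x.
Proof.
move=> hB; elim/last_ind: l => [|l y IH] //; rewrite adjs_rcons mem_rcons inE.
case/orP => [/eqP ->|/IH h]; first by apply: ring_adj_gen; apply: adjs_subring.
by apply: ring_adj_base => //; apply: adjs_subring.
Qed.

Lemma ring_adj_min B (S : U -> Prop) x : subring S -> (forall z, B z -> S z) -> S x ->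
  forall z, ring_adj B x z -> S z.
Proof.
move=> hS hBS hx _ [P [hP ->]]; rewrite horner_coef; apply: sr_sum => // i _.
by apply: srM => //; [apply/hBS/hP|apply: srX].
Qed.

Lemma adjs_min B (S : U -> Prop) l : subring S -> (forall z, B z -> S z) ->
  (forall x, x \in l -> S x) -> forall z, ring_adjs B l z -> S z.
Proof.
move=> hS hBS; elim/last_ind: l => [|l x IH] // hl; rewrite adjs_rcons.
apply: ring_adj_min => //; last by apply: hl; rewrite mem_rcons mem_head.
by apply: IH => y hy; apply: hl; rewrite mem_rcons inE hy orbT.
Qed.

Lemma extend_list B (l : seq U) f : subring B -> ring_adjs B l f -> f != 0 ->
  exists g, [/\ B g, g != 0 & forall (F : fieldType) (phi : U -> F),
    [pchar F] =i pred0 -> hom_on B phi -> phi g != 0 ->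
    exists (F' : fieldType) (j : {rmorphism F -> F'}) (phi' : U -> F'),
    [/\ hom_on (ring_adjs B l) phi', forall z, B z -> phi' z = j (phi z) & phi' f != 0]].
Proof.
move=> hB; elim: l B hB => [|x l IH] B hB /=.
  move=> hf nf; exists f; split=> // F phi ch hphi nphi.
  by exists F, idfun, phi.
move=> hf nf; have hA := ring_adj_subring hB x.
have [g1 [hg1 ng1 ext1]] := IH (ring_adj B x) hA hf nf.
have [g [hg ng ext]] := extend_one hB hg1 ng1.
exists g; split=> // F phi ch hphi nphi.
have [F1 [j1 [phi1 [h1 e1 n1 _]]]] := ext F phi ch hphi nphi.
have ch1 : [pchar F1] =i pred0 by move=> p; rewrite (fmorph_pchar j1) ch.
have [F2 [j2 [phi2 [h2 e2 n2]]]] := ext1 F1 phi1 ch1 h1 n1.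
exists F2, (j2 \o j1), phi2; split=> // z hz /=.
by rewrite e2 ?e1 //; apply: ring_adj_base.
Qed.

End Adjs.

(** * Algebraic independence and specialisation *)

Definition algebraic_el (U : fieldType) (B : U -> Prop) (x : U) :=
  exists P : {poly U}, [/\ poly_over B P, P != 0 & P.[x] = 0].

Section AlgIndep.
Variables (U : fieldType) (chU : [pchar U] =i pred0).
Variables (K : U -> Prop) (hK : subring K).

Lemma mpoly_over_of_polyfun n (f : ('I_n -> U) -> U) : polyfun K f ->
  exists p : {mpoly U[n]}, (forall m, K p@_m) /\ forall v, f v = p.@[v].
Proof.
elim=> [c hc|i|f1 f2 _ [p1 [h1 e1]] _ [p2 [h2 e2]]|f1 f2 _ [p1 [h1 e1]] _ [p2 [h2 e2]]].
- exists c%:MP; split=> [m|v]; last by rewrite mevalC.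
  by rewrite mcoeffC; apply: srM => //; apply: sr_nat.
- exists 'X_i; split=> [m|v]; last by rewrite mevalXU.
  by rewrite mcoeffX; apply: sr_nat.
- exists (p1 + p2); split=> [m|v]; last by rewrite mevalD e1 e2.
  by rewrite mcoeffD; apply: srD.
- exists (p1 * p2); split=> [m|v]; last by rewrite mevalM e1 e2.
  by rewrite mcoeffM; apply: sr_sum => // j _; apply: srM.
Qed.

Lemma alg_indep_polyfun n (u : 'I_n -> U) : alg_indep K u ->
  forall f, polyfun K f -> f u = 0 -> forall v, f v = 0.
Proof.
move=> hu f /mpoly_over_of_polyfun [p [hp e]]; rewrite e => /(hu p hp) p0 v.
by rewrite e p0 meval0.
Qed.

Lemma ring_adjs_polyfun n (u : nat -> U) z : ring_adjs K (mkseq u n) z ->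
  exists f : ('I_n -> U) -> U, polyfun K f /\ z = f (fun i => u i).
Proof.
apply: (@adjs_min _ K (fun z => exists f : ('I_n -> U) -> U, polyfun K f /\ z = f (fun i => u i))).
- split; first by exists (fun=> 1); split=> //; apply: PfC; apply: sr1.
    move=> _ _ [f [hf ->]] [g [hg ->]]; exists (fun v => f v - g v); split=> //.
    exact: polyfun_sub.
  move=> _ _ [f [hf ->]] [g [hg ->]]; exists (fun v => f v * g v); split=> //.
  exact: PfM.
- by move=> c hc; exists (fun=> c); split=> //; apply: PfC.
- move=> x /mapP[i]; rewrite mem_iota => /andP[_ hi] ->.
  by exists (fun v => v (Ordinal hi)); split=> //; apply: PfX.
Qed.

Lemma alg_indep_transc n (u : nat -> U) : alg_indep K (fun i : 'I_n.+1 => u i) ->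
  transc (ring_adjs K (mkseq u n)) (u n).
Proof.
move=> hu P hP Px; apply/eqP/negPn/negP => nP.
have [t ht] := nat_nonroot chU nP.
have hf i : exists f : ('I_n -> U) -> U, polyfun K f /\ P`_i = f (fun i => u i).
  exact: ring_adjs_polyfun (hP i).
pose f i := proj1_sig (constructive_indefinite_description _ (hf i)).
have hf1 i : polyfun K (f i) by rewrite /f; case: constructive_indefinite_description => g [].
have hf2 i : P`_i = f i (fun i => u i) by rewrite /f; case: constructive_indefinite_description => g [].
pose G (v : 'I_n.+1 -> U) := \sum_(i < size P) f i (fun j => v (widen_ord (leqnSn n) j)) * v ord_max ^+ i.
have hG : polyfun K G.
  apply: polyfun_sum => // i _; apply: PfM; last first.
    by apply: polyfun_exp => //; apply: PfX.
  by apply: (polyfun_comp (hf1 i)) => j; apply: PfX.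
have G0 : G (fun i => u i) = 0.
  by rewrite -[RHS]Px horner_coef; apply: eq_bigr => i _ /=; rewrite hf2.
have := alg_indep_polyfun hu hG G0 (fun i => if (i < n)%N then u i else t%:R).
move=> e; case/negP: ht; apply/eqP; rewrite -[RHS]e horner_coef.
apply: eq_bigr => i _ /=; rewrite ltnn hf2; congr (f i _ * _).
by apply: functional_extensionality => j /=; rewrite ltn_ord.
Qed.

Lemma mwiden_coef n (p : {mpoly U[n]}) : (forall m, K p@_m) -> forall m, K (mwiden p)@_m.
Proof.
move=> hp m; rewrite (mwidenE (leqnn _)) raddf_sum /=; apply: sr_sum => // i _.
by rewrite mcoeffZ mcoeffX; apply: srM => //; apply: sr_nat.
Qed.

Lemma alg_indep_widen n (u : nat -> U) : alg_indep K (fun i : 'I_n.+1 => u i) ->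
  alg_indep K (fun i : 'I_n => u i).
Proof.
move=> hu p hp e; have [k hk] : exists k, (msize p <= k)%N by exists (msize p).
have := hu (mwiden p) (mwiden_coef hp).
have -> : (mwiden p).@[fun i : 'I_n.+1 => u i] = 0.
  rewrite -[RHS]e; rewrite (mwidenE hk) [X in _ = X.@[_]](mpolywE hk) !raddf_sum /=.
  apply: eq_bigr => m _; rewrite !mevalZ !mevalX big_ord_recr /= mnmwiden_ordmax expr0 mulr1.
  by congr (_ * _); apply: eq_bigr => i _; rewrite mnmwiden_widen.
move=> /(_ erefl) w0; apply/mpolyP => m; rewrite mcoeff0.
have := congr1 (mcoeff (mnmwiden m)) w0; rewrite mcoeff0 => <-.
rewrite (mwidenE hk) [X in X@__ = _](mpolywE hk) !raddf_sum /=; apply: eq_bigr => i _.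
rewrite !mcoeffZ !mcoeffX; congr (_ * _%:R); congr (nat_of_bool _).
by rewrite (inj_eq (@inj_mnmwiden _)).
Qed.

Lemma muni_coef n (p : {mpoly U[n.+1]}) i m :
  (muni p)`_i@_m = p@_[multinom (if unlift ord_max j is Some j' then m j' else i) | j < n.+1].
Proof.
rewrite muniE coef_sum raddf_sum /=.
set m0 := [multinom _ | j < _].
have h (m' : 'X_{1..n.+1}) :
    (([multinom m' (widen_ord (leqnSn n) j) | j < n] == m) && (m' ord_max == i)) = (m' == m0).
  apply/andP/eqP => [[/eqP e1 /eqP e2]|->].
    apply/mnmP => j; rewrite mnmE; case: unliftP => [j' ->|->] //.
    by rewrite -e1 mnmE; congr (m' _); apply: val_inj; rewrite /= /bump leqNgt ltn_ord.
  split; last by rewrite mnmE unlift_none.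
  apply/eqP/mnmP => j; rewrite !mnmE.
  have -> : widen_ord (leqnSn n) j = lift ord_max j.
    by apply: val_inj; rewrite /= /bump leqNgt ltn_ord.
  by rewrite liftK.
have e (m' : 'X_{1..n.+1}) :
   ((p@_m' *: 'X_[[multinom m' (widen_ord (leqnSn n) j) | j < n]] *: 'X^(m' ord_max) : {poly {mpoly U[n]}})`_i)@_m
   = p@_m' * (m' == m0)%:R.
  rewrite coefZ coefXn -h eq_sym; case: (m' ord_max == i).
    by rewrite mulr1 mcoeffZ mcoeffX andbT.
  by rewrite mulr0 mcoeff0 andbF mulr0.
under eq_bigr do rewrite e.
have [hm|hm] := boolP (m0 \in msupp p).
  rewrite (bigD1_seq m0) ?msupp_uniq //= eqxx mulr1 big1 ?addr0 // => m' /negPf ->.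
  by rewrite mulr0.
rewrite (memN_msupp_eq0 hm) big_seq big1 // => m' hm'.
by case: eqP hm' hm => [->|]; [move=> ->|rewrite mulr0].
Qed.

Lemma muni_eval n (p : {mpoly U[n.+1]}) (u : nat -> U) :
  (map_poly (meval (fun i : 'I_n => u i)) (muni p)).[u n] = p.@[fun i => u i].
Proof.
rewrite muniE mevalE raddf_sum /= horner_sum; apply: eq_bigr => m _.
rewrite -mul_polyC rmorphM /= map_polyC /= map_polyXn hornerM hornerC hornerXn.
rewrite mevalZ mevalX big_ord_recr /= mulrA; congr (_ * _ * _).
by apply: eq_bigr => i _; rewrite mnmE.
Qed.

Lemma alg_dep_algebraic n (u : nat -> U) : alg_indep K (fun i : 'I_n => u i) ->
  ~ alg_indep K (fun i : 'I_n.+1 => u i) -> algebraic_el (ring_adjs K (mkseq u n)) (u n).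
Proof.
move=> hu hnu; apply: NNPP => h; apply: hnu => p hp e; apply/eqP/negPn/negP => np; apply: h.
exists (map_poly (meval (fun i : 'I_n => u i)) (muni p)).
have hc i m : K (muni p)`_i@_m by rewrite muni_coef.
split.
- move=> i; rewrite coef_map /= mevalE.
  have hA := adjs_subring (mkseq u n) hK.
  apply: sr_sum => // m _; apply: srM => //; first exact: adjs_base.
  apply: sr_prod => // j _; apply: srX => //; apply: adjs_gen => //.
  by apply: map_f; rewrite mem_iota /= ltn_ord.
- apply: contra np => /eqP P0; apply/eqP/mpolyP => m.
  have := muni_coef p (m ord_max) [multinom m (lift ord_max j) | j < n].
  have -> : (muni p)`_(m ord_max) = 0.
    apply: hu => //; have := congr1 (fun P : {poly U} => P`_(m ord_max)) P0.
    by rewrite /= coef_map coef0.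
  rewrite !mcoeff0 => e0; rewrite [RHS]e0; congr (p@__); apply/mnmP => j.
  by rewrite mnmE; case: unliftP => [j' ->|->] //; rewrite mnmE.
- by rewrite muni_eval.
Qed.

End AlgIndep.

Lemma root_closed (k : closedFieldType) (F : fieldType) (J : {rmorphism k -> F})
    (p : {poly k}) x : p != 0 -> root (map_poly J p) x -> img J x.
Proof.
move=> np; have [r er] := closed_field_poly_normal p.
rewrite er map_polyZ rootZ ?fmorph_eq0 ?lead_coef_eq0 // rmorph_prod /=.
elim: r {er} => [|z r IH]; first by rewrite big_nil (negPf (root1 _)).
rewrite big_cons rootM rmorphB /= map_polyX map_polyC root_XsubC => /orP[/eqP ->|/IH //].
by exists z.
Qed.

Lemma alg_indep0 (U : fieldType) (L : U -> Prop) (u : 'I_0 -> U) : alg_indep L u.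
Proof.
move=> p _; rewrite mevalE => e; apply/mpolyP => m; rewrite mcoeff0.
have hm (m' : 'X_{1..0}) : m' = m by apply/mnmP => -[].
apply/eqP/negPn/negP => np; have hs' : m \in msupp p by rewrite mcoeff_msupp.
move: e; rewrite (bigD1_seq m) ?msupp_uniq //= big_ord0 mulr1 big1; last first.
  by move=> m'; rewrite (hm m') eqxx.
by rewrite addr0 => /eqP; rewrite (negPf np).
Qed.

Section Specialise.
Variables (k : closedFieldType) (U : fieldType) (iota : {rmorphism k -> U}).
Variables (chU : [pchar U] =i pred0) (K : U -> Prop) (hK : subring K).
Hypothesis kK : forall c, K (iota c).

Let hk : subring (img iota) := sf_sr (img_subfield iota).

(** The entries of [l] can be moved to [k] while [K] stays in place. The
    target grows at every step of an adjunction, whence the embedding [j]; the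
    element [f] keeps the specialisation off a given hypersurface. *)
Definition specialisable (l : seq U) := forall f, ring_adjs K l f -> f != 0 ->
  exists (F : fieldType) (j : {rmorphism U -> F}) (phi : U -> F),
  [/\ hom_on (ring_adjs K l) phi, forall z, K z -> phi z = j z,
      forall x, x \in l -> exists c, phi x = j (iota c) & phi f != 0].

Lemma specialisable_nil : specialisable [::].
Proof. by move=> f hf nf; exists U, idfun, idfun; split. Qed.

Lemma kadjs_adjs l z : ring_adjs (img iota) l z -> ring_adjs K l z.
Proof.
apply: adjs_min; first exact: adjs_subring.
  by move=> _ [c ->]; apply: adjs_base.
by move=> x; apply: adjs_gen.
Qed.

Lemma adjs_sub (B : U -> Prop) l l' z : subring B -> {subset l <= l'} -> ring_adjs B l z -> ring_adjs B l' z.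
Proof.
move=> hB h; apply: adjs_min; first exact: adjs_subring.
  by move=> c hc; apply: adjs_base.
by move=> x /h; apply: adjs_gen.
Qed.

Lemma specialisable_transc l x : specialisable l -> transc (ring_adjs K l) x ->
  specialisable (rcons l x).
Proof.
move=> hl tx f; rewrite adjs_rcons => hf nf.
have hA := adjs_subring l hK.
have [g [hg ng ext]] := extend_one hA hf nf.
have [F [j [phi [h1 h2 h3 h4]]]] := hl g hg ng.
have chF : [pchar F] =i pred0 by move=> p; rewrite (fmorph_pchar j) chU.
have [F' [j' [phi' [h1' h2' h3' h4']]]] := ext F phi chF h1 h4.
exists F', (j' \o j), phi'; split=> //.
- by move=> z hz; rewrite h2' ?h2 //; apply: adjs_base.
- move=> y; rewrite mem_rcons inE => /orP[/eqP ->|hy].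
    by have [n ->] := h4' tx; exists n%:R; rewrite /= !rmorph_nat.
  have [c hc] := h3 _ hy; exists c; rewrite h2' ?hc //; exact: adjs_gen.
Qed.

Lemma specialisable_alg l x : specialisable l ->
  algebraic_el (ring_adjs (img iota) l) x -> specialisable (rcons l x).
Proof.
move=> hl [P [hP nP Px]] f; rewrite adjs_rcons => hf nf.
have hA := adjs_subring l hK.
have hA1 := ring_adj_subring hA x.
have hlP : ring_adjs K l (lead_coef P) by apply: kadjs_adjs; apply: hP.
have hf2 : ring_adj (ring_adjs K l) x (f * lead_coef P).
  by apply: srM => //; apply: ring_adj_base.
have nf2 : f * lead_coef P != 0 by rewrite mulf_neq0 ?lead_coef_eq0.
have [g [hg ng ext]] := extend_one hA hf2 nf2.
have [F [j [phi [h1 h2 h3 h4]]]] := hl g hg ng.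
have chF : [pchar F] =i pred0 by move=> p; rewrite (fmorph_pchar j) chU.
have [F' [j' [phi' [h1' h2' h3' _]]]] := ext F phi chF h1 h4.
move: h3'; rewrite (hoM h1') //; last exact: ring_adj_base.
rewrite mulf_eq0 negb_or => /andP[nf' nlP'].
exists F', (j' \o j), phi'; split=> //.
  by move=> z hz; rewrite h2' ?h2 //; apply: adjs_base.
move=> y; rewrite mem_rcons inE => /orP[/eqP ->|hy]; last first.
  by have [c hc] := h3 _ hy; exists c; rewrite h2' ?hc //; exact: adjs_gen.
(* the value of [x] is a root of a nonzero polynomial with coefficients in [k] *)
have hc z : ring_adjs (img iota) l z -> exists c, phi' z = j' (j (iota c)).
  move=> hz; pose S z := ring_adjs K l z /\ exists c, phi' z = j' (j (iota c)).
  suff [] : S z by []; move: z hz; apply: adjs_min => //.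
  - split; first by split; [apply: sr1|exists 1; rewrite (ho1 h1') !rmorph1].
      move=> a b [ha [c ec]] [hb [d ed]]; split; first exact: srB.
      by exists (c - d); rewrite (hoB h1') ?ec ?ed ?rmorphB //; apply: ring_adj_base.
    move=> a b [ha [c ec]] [hb [d ed]]; split; first exact: srM.
    by exists (c * d); rewrite (hoM h1') ?ec ?ed ?rmorphM //; apply: ring_adj_base.
  - move=> _ [c ->]; split; first exact: adjs_base.
    by exists c; rewrite h2' ?h2 //; apply: adjs_base.
  - move=> a ha; split; first exact: adjs_gen.
    by have [c hc] := h3 _ ha; exists c; rewrite h2' ?hc //; apply: adjs_gen.
have hcP i : exists c, phi' P`_i = j' (j (iota c)) by apply: hc; apply: hP.
pose c i := proj1_sig (constructive_indefinite_description _ (hcP i)).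
have ec i : phi' P`_i = j' (j (iota (c i))).
  by rewrite /c; case: constructive_indefinite_description.
pose p0 := \poly_(i < size P) c i.
pose J : {rmorphism k -> F'} := j' \o (j \o iota).
have hPA : poly_over (ring_adj (ring_adjs K l) x) P.
  by move=> i; apply: ring_adj_base => //; apply: kadjs_adjs.
have eP : map_poly J p0 = map_poly phi' P.
  apply/polyP => i; rewrite coef_map coef_poly (coef_ho hA1 h1') ec.
  case: ltnP => // hi; rewrite raddf0 -ec (nth_default _ hi).
  by rewrite (ho0 hA1 h1').
have rP : root (map_poly J p0) (phi' x).
  rewrite eP; apply/rootP; have := congr1 phi' Px.
  rewrite (ho0 hA1 h1') => <-; rewrite !horner_coef size_poly_eq // (ho_sum hA1 h1').
    apply: eq_bigr => i _; rewrite (coef_ho hA1 h1') (hoM h1') //.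
      by rewrite (hoX hA1 h1') //; apply: ring_adj_gen.
    by apply: srX => //; apply: ring_adj_gen.
  move=> i _; apply: srM => //; apply: srX => //; exact: ring_adj_gen.
have np0 : p0 != 0.
  apply: contraNneq nlP' => e; rewrite lead_coefE ec.
  have := congr1 (fun q : {poly k} => q`_(size P).-1) e.
  rewrite coef_poly coef0 prednK ?size_poly_gt0 // leqnn => ->.
  by rewrite !rmorph0.
exact: root_closed np0 rP.
Qed.

(** A maximal subtuple independent over [k] is also independent over [K] by
    hypothesis, so its entries can be given integral values without moving [K].
    The other entries are then roots of polynomials with coefficients in [k],
    hence lie in [k], which is algebraically closed. *)
Lemma specialise n (a : 'I_n -> U) :
  (forall r (u : 'I_r -> U), (forall i, exists j, u i = a j) ->
     alg_indep (img iota) u -> alg_indep K u) ->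
  forall h, polyfun K h -> h a != 0 ->
  exists x : 'I_n -> k, h (fun i => iota (x i)) != 0 /\
    forall f, polyfun K f -> f a = 0 -> f (fun i => iota (x i)) = 0.
Proof.
move=> hind.
have hmax (l : seq U) : exists u : seq U, [/\ {subset u <= l},
    alg_indep (img iota) (fun i : 'I_(size u) => u`_i)
    & forall x, x \in l -> algebraic_el (ring_adjs (img iota) u) x].
  elim/last_ind: l => [|l x [u [h1 h2 h3]]].
    by exists [::]; split=> //; apply: alg_indep0.
  have eu : mkseq (fun i => (rcons u x)`_i) (size u) = u.
    rewrite -[RHS](mkseq_nth 0); apply/eq_in_map => i; rewrite mem_iota /= add0n => hi.
    by rewrite nth_rcons hi.
  have eI S : alg_indep S (fun i : 'I_(size u) => u`_i) <->
              alg_indep S (fun i : 'I_(size u) => (rcons u x)`_i).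
    suff -> : (fun i : 'I_(size u) => u`_i) = (fun i : 'I_(size u) => (rcons u x)`_i) by [].
    by apply: functional_extensionality => i; rewrite nth_rcons ltn_ord.
  have ex : (rcons u x)`_(size u) = x by rewrite nth_rcons ltnn eqxx.
  have [hi|hni] := classic (alg_indep (img iota) (fun i : 'I_(size u).+1 => (rcons u x)`_i)).
    exists (rcons u x); split.
    - by move=> y; rewrite !mem_rcons !inE => /orP[->//|/h1 ->]; rewrite orbT.
    - by rewrite size_rcons.
    - move=> y; rewrite mem_rcons inE => /orP[/eqP ->|/h3 [P [hP nP Py]]].
        exists ('X - x%:P); split; last by rewrite hornerXsubC subrr.
          apply: poB; [exact: adjs_subring|apply: poX; exact: adjs_subring|].
          apply: poC; first exact: adjs_subring.
          by apply: adjs_gen; rewrite ?mem_rcons ?mem_head.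
        by rewrite polyXsubC_eq0.
      exists P; split=> // i; apply: adjs_sub (hP i) => // z.
      by rewrite mem_rcons inE orbC => ->.
  exists u; split=> //.
    by move=> y /h1; rewrite mem_rcons inE orbC => ->.
  move=> y; rewrite mem_rcons inE => /orP[/eqP ->|/h3 //].
  have := @alg_dep_algebraic U (img iota) hk (size u) (fun i => (rcons u x)`_i).
  by rewrite eu ex; apply=> //; apply/eI.
have [u [hu1 hu2 hu3]] := hmax (codom a).
have hK2 : alg_indep K (fun i : 'I_(size u) => u`_i).
  apply: hind hu2 => i; have /hu1/codomP[j ->] : u`_i \in u by apply: mem_nth.
  by exists j.
have hpre m : (m <= size u)%N -> alg_indep K (fun i : 'I_m => u`_i).
  move=> /subKn <-; elim: (size u - m)%N => [|d IH]; first by rewrite subn0.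
  have [le|lt] := leqP (size u) d.
    by have -> : (size u - d.+1 = size u - d)%N by move: le; rewrite -subn_eq0 subnS => /eqP ->.
  have e : (size u - d = (size u - d.+1).+1)%N by rewrite subnSK.
  by move: IH; rewrite e; apply: (@alg_indep_widen U K hK _ (fun i => u`_i)).
have sp n' : (n' <= size u)%N -> specialisable (take n' u).
  elim: n' => [|n' IH] hn'; first by rewrite take0; apply: specialisable_nil.
  rewrite (take_nth 0) //; apply: specialisable_transc; first exact/IH/ltnW.
  have := @alg_indep_transc U chU K hK n' (fun i => u`_i) (hpre _ hn').
  suff -> : mkseq (fun i => u`_i) n' = take n' u by [].
  apply: (@eq_from_nth _ 0); first by rewrite size_mkseq size_takel // ltnW.
  by move=> i; rewrite size_mkseq => hi; rewrite nth_mkseq // nth_take.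
have spl (l : seq U) : (forall x, x \in l -> algebraic_el (ring_adjs (img iota) u) x) ->
    specialisable (u ++ l).
  elim/last_ind: l => [|l x IH] hl; first by rewrite cats0 -(take_size u); apply: sp.
  rewrite -rcons_cat; apply: specialisable_alg.
    by apply: IH => y hy; apply: hl; rewrite mem_rcons inE hy orbT.
  have hx : x \in rcons l x by rewrite mem_rcons mem_head.
  have [P [hP nP Px]] := hl x hx.
  exists P; split=> // i; apply: adjs_sub (hP i) => // z.
  by rewrite mem_cat => ->.
have spa := spl _ hu3.
move=> h hh nh; set L := u ++ codom a in spa.
have hA := adjs_subring L hK.
have ha i : ring_adjs K L (a i).
  by apply: adjs_gen => //; rewrite mem_cat codom_f orbT.
have hKA z : K z -> ring_adjs K L z by move=> ?; apply: adjs_base.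
have [F [j [phi [h1 h2 h3 h4]]]] := spa (h a) (polyfun_val hA hh hKA ha) nh.
have hc i : exists c, phi (a i) = j (iota c).
  by apply: h3; rewrite mem_cat codom_f orbT.
pose x i := proj1_sig (constructive_indefinite_description _ (hc i)).
have ex i : phi (a i) = phi (iota (x i)).
  by rewrite (h2 (iota (x i))) // /x; case: constructive_indefinite_description.
have hxA i : ring_adjs K L (iota (x i)) by apply: hKA.
have key f : polyfun K f -> phi (f a) = j (f (fun i => iota (x i))).
  move=> hf; rewrite (ho_polyfun hA h1 hf hKA ha hxA ex) h2 //.
  by apply: (polyfun_val hK hf).
exists x; split; first by move: h4; rewrite key // fmorph_eq0.
by move=> f hf e; apply/eqP; rewrite -(fmorph_eq0 j) -key // e (ho0 hA h1).
Qed.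

End Specialise.

(** * Invariant sets and constants *)

Lemma choice_fun (A : Type) (B : A -> Type) (P : forall a, B a -> Prop) :
  (forall a, exists b, P a b) -> exists f : forall a, B a, forall a, P a (f a).
Proof.
move=> h; exists (fun a => proj1_sig (constructive_indefinite_description _ (h a))).
by move=> a; case: constructive_indefinite_description.
Qed.

Lemma fix_subring (U : fieldType) (s : {rmorphism U -> U}) (M : U -> Prop) :
  subring M -> subring (fun z => M z /\ s z = z).
Proof.
move=> hM; split.
- by rewrite rmorph1; split=> //; apply: sr1.
- by move=> x y [hx ex] [hy ey]; rewrite rmorphB ex ey; split=> //; apply: srB.
- by move=> x y [hx ex] [hy ey]; rewrite rmorphM ex ey; split=> //; apply: srM.
Qed.

Lemma fix_subfield (U : fieldType) (s : {rmorphism U -> U}) (M : U -> Prop) :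
  subfield M -> subfield (fun z => M z /\ s z = z).
Proof.
move=> hM; split; first exact: fix_subring (sf_sr hM).
by move=> x [hx ex]; rewrite fmorphV ex; split=> //; apply: sfV.
Qed.

Lemma polyfun_fixed (U : fieldType) (s : {rmorphism U -> U}) (B : U -> Prop) I
    (f : (I -> U) -> U) v :
  (forall z, B z -> s z = z) -> polyfun B f -> f (fun i => s (v i)) = s (f v).
Proof.
move=> hB; elim=> [c /hB ->|i|f1 f2 _ e1 _ e2|f1 f2 _ e1 _ e2] //.
- by rewrite rmorphD e1 e2.
- by rewrite rmorphM e1 e2.
Qed.

Lemma polyfun_finite (U : fieldType) (B : U -> Prop) I (f : (I -> U) -> U) :
  polyfun B f -> exists l : seq U, (forall z, z \in l -> B z) /\ polyfun (fun z => z \in l) f.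
Proof.
elim=> [c hc|i|f1 f2 _ [l1 [h1 p1]] _ [l2 [h2 p2]]|f1 f2 _ [l1 [h1 p1]] _ [l2 [h2 p2]]].
- exists [:: c]; split=> [z|]; first by rewrite inE => /eqP ->.
  by apply: PfC; rewrite inE.
- by exists [::]; split=> //; apply: PfX.
- exists (l1 ++ l2); split=> [z|]; first by rewrite mem_cat => /orP[/h1|/h2].
  by apply: PfD; [apply: polyfun_mono p1|apply: polyfun_mono p2] => z;
    rewrite mem_cat => ->; rewrite ?orbT.
- exists (l1 ++ l2); split=> [z|]; first by rewrite mem_cat => /orP[/h1|/h2].
  by apply: PfM; [apply: polyfun_mono p1|apply: polyfun_mono p2] => z;
    rewrite mem_cat => ->; rewrite ?orbT.
Qed.

(** Write [z * g c0 - f c0 = 0] as a linear relation over [M] between monomials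
    in the [c0], and these monomials [d] in terms of a basis of them over the
    constants of [M]. This basis is still independent over [M] by [fixed_indep],
    so the relation holds for each basis coordinate separately. As the
    coordinates of the [d] are constants of [M], any basis element with a
    nonzero denominator expresses [z] as desired. *)
Lemma internal_constants (U : fieldType) (s : {rmorphism U -> U}) (K M : U -> Prop) I
    (c0 : I -> U) z :
  subfield K -> subfield M -> (forall x, K x -> M x) -> (forall x, M x -> M (s x)) ->
  (forall i, s (c0 i) = c0 i) -> M z -> fgen K c0 z ->
  exists (J : finType) (c al be : J -> U),
  [/\ forall j, K (al j) /\ K (be j), forall j, M (c j) /\ s (c j) = c j,
      \sum_j be j * c j != 0 & z * \sum_j be j * c j = \sum_j al j * c j].
Proof.
move=> hK hM hKM sM hc0 Mz [f [g [hf hg ng ez]]].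
have hR := sf_sr hK; have hMR := sf_sr hM.
have fT : subfield (fun x => True /\ s x = x) by apply: fix_subfield; split; split.
have [J1 [k1 [m1 [hk1 hm1 e1]]]] := polyfun_decomp hR (sf_sr fT) hf.
have [J2 [k2 [m2 [hk2 hm2 e2]]]] := polyfun_decomp hR (sf_sr fT) hg.
pose d (j : J1 + J2) := match j with inl j => m1 j c0 | inr j => m2 j c0 end.
pose p (j : J1 + J2) := match j with inl j => k1 j | inr j => 0 end.
pose q (j : J1 + J2) := match j with inl j => 0 | inr j => k2 j end.
have hd j : s (d j) = d j.
  have hf0 i (m : (I -> U) -> U) : polyfun (fun x => True /\ s x = x) m -> i = m c0 -> s i = i.
    move=> hm ->; rewrite -(polyfun_fixed _ _ hm); last by move=> x [].
    by congr (m _); apply: functional_extensionality.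
  by case: j => j /=; [apply: (hf0 _ (m1 j))|apply: (hf0 _ (m2 j))].
have hp j : K (p j) by case: j => j /=; [apply: hk1|apply: sr0].
have hq j : K (q j) by case: j => j /=; [apply: sr0|apply: hk2].
have ep : f c0 = \sum_j p j * d j.
  rewrite e1 big_sumType /= [X in _ = _ + X]big1 ?addr0 // => j _; exact: mul0r.
have eq : g c0 = \sum_j q j * d j.
  rewrite e2 big_sumType /= [X in _ = X + _]big1 ?add0r // => j _; exact: mul0r.
have [T [om [hT hom dE]]] := basis_exists d (fix_subfield s hM).
have hTM := fixed_indep hM sM hd hT.
have swap (r : J1 + J2 -> U) : \sum_j r j * d j = \sum_(t in T) (\sum_j r j * om j t) * d t.
  under [RHS]eq_bigr do rewrite big_distrl /=.
  rewrite exchange_big /=; apply: eq_bigr => j _; rewrite dE big_distrr /=.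
  by apply: eq_bigr => t _; rewrite mulrA.
have rel : \sum_(t in T) (\sum_j (z * q j - p j) * om j t) * d t = 0.
  rewrite -swap; under eq_bigr do rewrite mulrBl -mulrA.
  by rewrite sumrB -big_distrr /= -ep -eq ez divfK // subrr.
have rel2 := hTM _ _ rel.
have [t [tT nt]] : exists t, t \in T /\ \sum_j q j * om j t != 0.
  apply: NNPP => h; case/negP: ng; rewrite eq swap; apply/eqP/big1 => t tT.
  have [->|nt] := eqVneq (\sum_j q j * om j t) 0; first by rewrite mul0r.
  by case: h; exists t.
exists (J1 + J2)%type, (fun j => om j t), p, q; split=> //.
apply/eqP; rewrite -subr_eq0; apply/eqP.
rewrite -[RHS](rel2 _ t tT).
  by rewrite big_distrr -sumrB /=; apply: eq_bigr => j _; rewrite mulrBl mulrA.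
move=> t'; apply: sr_sum => // j _; apply: srM => //; last by case: (hom j t').
by apply: srB => //; [apply: srM => //; apply: hKM|apply: hKM].
Qed.

Lemma meval_sumr (R : fieldType) n J (l : seq J) (P : pred J) (F : J -> {mpoly R[n]}) v :
  (\sum_(j <- l | P j) F j).@[v] = \sum_(j <- l | P j) (F j).@[v].
Proof. exact: raddf_sum. Qed.

Lemma meval_prodr (R : fieldType) n J (l : seq J) (P : pred J) (F : J -> {mpoly R[n]}) v :
  (\prod_(j <- l | P j) F j).@[v] = \prod_(j <- l | P j) (F j).@[v].
Proof. exact: rmorph_prod. Qed.

(** Since [phi] is only meaningful on [B], which need not contain the fractions
    [C i / Q], the value of [f] at these fractions is replaced by the value [z]
    of a homogenised form of [f]. *)
Lemma hom_fraction (U F : fieldType) (J : Type) (B E : U -> Prop) (phi : U -> F)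
    (f : (J -> U) -> U) (c C : J -> U) (Q : U) :
  subring B -> hom_on B phi -> (forall u, E u -> B u) -> B Q -> (forall i, B (C i)) ->
  Q != 0 -> (forall i, B (c i)) -> polyfun E f ->
  (forall i, phi (c i) * phi Q = phi (C i)) ->
  exists z e, [/\ B z, z = f (fun i => C i / Q) * Q ^+ e & phi z = phi (f c) * phi Q ^+ e].
Proof.
move=> hB hphi EB BQ BC nQ Bc hf hc.
have hQX e : B (Q ^+ e) by apply: srX.
have hv g : polyfun E g -> B (g c) by move=> hg; apply: (polyfun_val hB hg).
elim: hf => [u hu|i|f1 f2 hf1 [z1 [d1 [b1 E1 F1]]] hf2 [z2 [d2 [b2 E2 F2]]]
           |f1 f2 hf1 [z1 [d1 [b1 E1 F1]]] hf2 [z2 [d2 [b2 E2 F2]]]].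
- by exists u, 0%N; rewrite !expr0 !mulr1; split=> //; exact: EB.
- by exists (C i), 1%N; rewrite !expr1 divfK.
- exists (z1 * Q ^+ d2 + z2 * Q ^+ d1), (d1 + d2)%N; split.
  + by apply: srD => //; apply: srM.
  + by rewrite E1 E2 exprD; ring.
  + have h1 : B (z1 * Q ^+ d2) by apply: srM.
    have h2 : B (z2 * Q ^+ d1) by apply: srM.
    rewrite (hoD hB hphi h1 h2) (hoM hphi b1 (hQX d2)) (hoM hphi b2 (hQX d1)).
    rewrite (hoX hB hphi d2 BQ) (hoX hB hphi d1 BQ) (hoD hB hphi (hv _ hf1) (hv _ hf2)).
    by rewrite F1 F2 exprD; ring.
- exists (z1 * z2), (d1 + d2)%N; split; first exact: srM.
    by rewrite E1 E2 exprD mulrACA.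
  by rewrite (hoM hphi b1 b2) (hoM hphi (hv _ hf1) (hv _ hf2)) F1 F2 exprD mulrACA.
Qed.

Section Core.
Variables (k U : fieldType) (sk : {rmorphism k -> k}) (s : {rmorphism U -> U}).
Variables (iota : {rmorphism k -> U}).
Hypotheses (chU : [pchar U] =i pred0) (comm : forall x, iota (sk x) = s (iota x)).
Hypothesis inv : forall y : k, exists x, sk x = y.
Variables (n : nat) (a : 'I_n -> U) (num den : 'I_n -> {mpoly k[n]}).

Notation ev p v := ((map_mpoly iota p).@[v]).
Notation io x := (fun i => iota (x i)).

Lemma ev_sum J (l : seq J) (P : pred J) (F : J -> {mpoly k[n]}) v :
  ev (\sum_(j <- l | P j) F j) v = \sum_(j <- l | P j) ev (F j) v.
Proof. by rewrite -meval_sumr; congr (_.@[_]); exact: raddf_sum. Qed.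

Lemma evM (p q : {mpoly k[n]}) v : ev (p * q) v = ev p v * ev q v.
Proof. by rewrite rmorphM mevalM. Qed.

Lemma ev_prod J (l : seq J) (P : pred J) (F : J -> {mpoly k[n]}) v :
  ev (\prod_(j <- l | P j) F j) v = \prod_(j <- l | P j) ev (F j) v.
Proof. by rewrite -meval_prodr; congr (_.@[_]); exact: rmorph_prod. Qed.

Hypothesis hden : forall i, ev (den i) a != 0.
Hypothesis hsa : forall i, s (a i) = ev (num i) a / ev (den i) a.
Variables (K : U -> Prop) (hK : subfield K) (sK : forall x, K x -> K (s x)).
Hypothesis kK : forall c, K (iota c).
Variables (m : nat) (c0 : 'I_m -> U).
Hypotheses (hc0 : forall i, s (c0 i) = c0 i) (ha : forall i, fgen K c0 (a i)).

(** The points with coordinates in [k] of the variety on which [a] is generic. *)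
Definition locus (x : 'I_n -> k) := forall p : {mpoly k[n]}, ev p a = 0 -> p.@[x] = 0.

(* [a] is independent from [K] over [k], and [k(a)] has no new constants *)
Hypothesis hdisj : forall f, polyfun K f -> f a = 0 -> forall x, locus x -> f (io x) = 0.
Hypothesis hfix : forall z, fgen (img iota) a z -> s z = z -> img iota z.

Let hR := sf_sr hK.
Let hk := img_subfield iota.
Let hkR := sf_sr hk.

Lemma pf_mono_k I (f : (I -> U) -> U) : polyfun (img iota) f -> polyfun K f.
Proof. by apply: polyfun_mono => _ [c ->]. Qed.

Lemma pfk (p : {mpoly k[n]}) : polyfun K (fun v => ev p v).
Proof. exact/pf_mono_k/polyfun_mpoly. Qed.

Lemma kdecomp (f : ('I_n -> U) -> U) : polyfun K f ->
  exists (J : finType) (T : {set J}) (kap : J -> U) (p : J -> {mpoly k[n]}),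
  indep_on (img iota) kap T /\ forall v, f v = \sum_(t in T) kap t * ev (p t) v.
Proof.
move=> hf; have [J [kap [g [_ hg e]]]] := polyfun_decomp hR hkR hf.
have [T [om [hT hom kE]]] := basis_exists kap hk.
have /choice_fun [p hp] t : exists p : {mpoly k[n]}, forall v, \sum_j om j t * g j v = ev p v.
  apply: (@mpoly_of_polyfun k U iota n (fun v => \sum_j om j t * g j v)).
  by apply: polyfun_sum => // j _; apply: PfM => //; apply: PfC.
exists J, T, kap, p; split=> // v; rewrite e.
under [RHS]eq_bigr do rewrite -hp big_distrr /=.
rewrite exchange_big /=; apply: eq_bigr => j _; rewrite kE big_distrl /=.
by apply: eq_bigr => t _; rewrite mulrCA mulrA.
Qed.

(** Expand [f] along elements of [K] that are independent over [k]. At a point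
    with coordinates in [k], [f] vanishes only if all the coordinates of the
    expansion, which are polynomials over [k], vanish. *)
Lemma nonzero_over_k (f : ('I_n -> U) -> U) v : polyfun K f -> f v != 0 ->
  exists p : {mpoly k[n]}, ev p v != 0 /\ forall x, p.@[x] != 0 -> f (io x) != 0.
Proof.
move=> /kdecomp [J [T [kap [p [hT e]]]]] nf.
have [t [tT nt]] : exists t, t \in T /\ ev (p t) v != 0.
  apply: NNPP => h; case/negP: nf; rewrite e; apply/eqP/big1 => t tT.
  have [->|nt] := eqVneq (ev (p t) v) 0; first by rewrite mulr0.
  by case: h; exists t.
exists (p t); split=> // x nx; rewrite e; apply: contra nx => /eqP h.
have := hT (fun t => ev (p t) (io x)) _ _ t tT; rewrite meval_map => H.
rewrite -(fmorph_eq0 iota); apply/eqP/H.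
  by move=> j; rewrite meval_map; exists (p j).@[x].
by rewrite -[RHS]h; apply: eq_bigr => j _; rewrite mulrC.
Qed.

Let L := fgen (img iota) a.
Let M := fgen K a.

Lemma L_subfield : subfield L. Proof. exact: fgen_subfield. Qed.
Lemma M_subfield : subfield M. Proof. exact: fgen_subfield. Qed.

Lemma L_stable x : L x -> L (s x).
Proof.
apply: fgen_stable => // [_ [c ->]|i]; first by rewrite -comm; apply: fgen_base => //; exists (sk c).
by rewrite hsa; apply: (sf_div L_subfield); apply: (fgen_pf hkR a (f := fun v => ev _ v)); apply: polyfun_mpoly.
Qed.

Lemma LM x : L x -> M x.
Proof.
apply: fgen_min; first exact: M_subfield; first by move=> _ [c ->]; apply: fgen_base.
by move=> i; apply: fgen_gen.
Qed.

Lemma M_stable x : M x -> M (s x).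
Proof.
apply: fgen_stable => // [z hz|i]; first by apply: fgen_base => //; apply: sK.
exact/LM/L_stable/fgen_gen.
Qed.

(** [internal_constants] applies to each coordinate of [a], and the finitely
    many constants obtained are put together. *)
Lemma rational_over_constants : exists (J : finType) (c : J -> U) (A D : 'I_n -> (J -> U) -> U),
  [/\ forall i, polyfun K (A i) /\ polyfun K (D i),
      forall j, M (c j) /\ s (c j) = c j,
      forall i, D i c != 0 & forall i, a i * D i c = A i c].
Proof.
pose Pr i (x : {J : finType & (J -> U) * (J -> U) * (J -> U)}%type) :=
  let: existT J (c, al, be) := x in
  [/\ forall j, K (al j) /\ K (be j), forall j, M (c j) /\ s (c j) = c j,
      \sum_j be j * c j != 0 & a i * \sum_j be j * c j = \sum_j al j * c j].
have /choice_fun [F hF] : forall i, exists x, Pr i x.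
  move=> i; have [||J [c [al [be h]]]] := internal_constants hK M_subfield _ M_stable hc0 _ (ha i).
  - by move=> x; apply: fgen_base.
  - exact: fgen_gen.
  - by exists (existT _ J (c, al, be)).
pose J := {i : 'I_n & tag (F i)}.
pose c (j : J) := (tagged (F (tag j))).1.1 (tagged j).
exists J, c, (fun i y => \sum_j (tagged (F i)).1.2 j * y (existT _ i j)),
  (fun i y => \sum_j (tagged (F i)).2 j * y (existT _ i j)).
split.
- move=> i; have hKi j : K ((tagged (F i)).1.2 j) /\ K ((tagged (F i)).2 j).
    by have := hF i; rewrite /Pr; case: (F i) j => Ji [[ci al] be] j /= [].
  by split; apply: polyfun_sum => // j _; apply: PfM; (try exact: PfX); apply: PfC; case: (hKi j).
- by case=> i j; rewrite /c /=; have := hF i; rewrite /Pr; case: (F i) j => Ji [[ci al] be] j /= [].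
- move=> i; rewrite /c /=; have := hF i; rewrite /Pr.
  by case: (F i) => Ji [[ci al] be] /= [].
- move=> i; rewrite /c /=; have := hF i; rewrite /Pr.
  by case: (F i) => Ji [[ci al] be] /= [].
Qed.

(** ** The ring generated by [a] and the constants of [K(a)] *)

Let D0 z := M z /\ s z = z.
Let D0R : subring D0. Proof. exact: fix_subring (sf_sr M_subfield). Qed.

Definition Bring z := exists (J : finType) (r : J -> {mpoly k[n]}) (d : J -> U),
  (forall j, D0 (d j)) /\ z = \sum_j ev (r j) a * d j.

Lemma B_intro p d : D0 d -> Bring (ev p a * d).
Proof.
by move=> hd; exists unit, (fun=> p), (fun=> d); split=> //; rewrite (bigD1 tt) //= big1 ?addr0 // => -[].
Qed.

Lemma B_subring : subring Bring.
Proof.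
split.
- by have := B_intro 1 (sr1 D0R); rewrite rmorph1 meval1 mulr1.
- move=> _ _ [J1 [r1 [d1 [h1 ->]]]] [J2 [r2 [d2 [h2 ->]]]].
  exists (J1 + J2)%type, (fun j => match j with inl j => r1 j | inr j => r2 j end),
   (fun j => match j with inl j => d1 j | inr j => - d2 j end); split.
    by case=> j //; apply: srN.
  by rewrite big_sumType /= -sumrN; congr (_ + _); apply: eq_bigr => j _; rewrite mulrN.
- move=> _ _ [J1 [r1 [d1 [h1 ->]]]] [J2 [r2 [d2 [h2 ->]]]].
  exists (J1 * J2)%type, (fun j => r1 j.1 * r2 j.2), (fun j => d1 j.1 * d2 j.2); split.
    by move=> j; apply: srM.
  rewrite big_distrlr /= pair_big /=; apply: eq_bigr => j _.
  by rewrite rmorphM mevalM mulrACA.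
Qed.

Lemma B_const d : D0 d -> Bring d.
Proof. by move=> /(B_intro 1); rewrite rmorph1 meval1 mul1r. Qed.

Lemma B_poly p : Bring (ev p a).
Proof. by have := B_intro p (sr1 D0R); rewrite mulr1. Qed.

(** Constants that are independent over [k] are independent over [k(a)] by
    [fixed_indep], because all constants of [k(a)] lie in [k]. Rewriting in
    terms of such constants is also valid at the points [x], the coefficients
    of the change of basis being in [k]. *)
Lemma B_normal (J : finType) (r : J -> {mpoly k[n]}) (d : J -> U) :
  (forall j, D0 (d j)) ->
  exists (T : {set J}) (r' : J -> {mpoly k[n]}), indep_on L d T /\
    ((\sum_j ev (r j) a * d j = \sum_(t in T) ev (r' t) a * d t) /\
     forall x, \sum_j iota (r j).@[x] * d j = \sum_(t in T) iota (r' t).@[x] * d t).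
Proof.
move=> hd; have [T [om [hT hom dE]]] := basis_exists d (fix_subfield s hk).
have hTL : indep_on L d T.
  apply: (fixed_indep L_subfield L_stable) => [j|]; first by case: (hd j).
  move=> c hc; apply: hT => j; have [h1 h2] := hc j; split=> //; exact: hfix.
have /choice_fun [o ho] : forall j, exists o, forall t, om j t = iota (o t).
  move=> j; have /choice_fun [o ho] : forall t, exists o, om j t = iota o.
    by move=> t; have [[o ->] _] := hom j t; exists o.
  by exists o.
exists T, (fun t => \sum_j o j t *: r j); split=> //; split=> [|x].
- under [RHS]eq_bigr do rewrite ev_sum big_distrl /=.
  rewrite exchange_big /=; apply: eq_bigr => j _; rewrite {1}dE big_distrr /=.
  by apply: eq_bigr => t _; rewrite map_mpolyZ mevalZ ho mulrCA mulrA.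
- under [RHS]eq_bigr do rewrite meval_sumr rmorph_sum big_distrl /=.
  rewrite exchange_big /=; apply: eq_bigr => j _; rewrite {1}dE big_distrr /=.
  by apply: eq_bigr => t _; rewrite mevalZ rmorphM ho mulrCA mulrA.
Qed.

Lemma L_poly p : L (ev p a).
Proof. exact: (fgen_pf hkR a (polyfun_mpoly iota p)). Qed.

(** By [B_normal] the ring generated by [a] and the constants of [K(a)] is the
    tensor product of [k[a]] and of the ring of these constants over [k], so
    that [a] can be moved alone. The homomorphism is defined by its graph. *)
Lemma B_specialise x : locus x -> exists th : U -> U,
  [/\ hom_on Bring th, forall d, D0 d -> th d = d & forall p, th (ev p a) = iota p.@[x]].
Proof.
move=> hx.
pose Rl z w := exists (J : finType) (r : J -> {mpoly k[n]}) (d : J -> U),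
  [/\ forall j, D0 (d j), z = \sum_j ev (r j) a * d j & w = \sum_j iota (r j).@[x] * d j].
have R0 w : Rl 0 w -> w = 0.
  move=> [J [r [d [hd e ->]]]]; have [T [r' [hT [e1 ->]]]] := B_normal r hd.
  apply: big1 => t tT; rewrite hx ?rmorph0 ?mul0r //.
  by apply: (hT (fun t => ev (r' t) a)) => // [j|]; [apply: L_poly|rewrite -e1 -e].
have RB z w z' w' : Rl z w -> Rl z' w' -> Rl (z - z') (w - w').
  move=> [J1 [r1 [d1 [h1 -> ->]]]] [J2 [r2 [d2 [h2 -> ->]]]].
  exists (J1 + J2)%type, (fun j => match j with inl j => r1 j | inr j => r2 j end),
   (fun j => match j with inl j => d1 j | inr j => - d2 j end); split.
  - by case=> j //; apply: srN.
  - by rewrite big_sumType /= -sumrN; congr (_ + _); apply: eq_bigr => j _; rewrite mulrN.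
  - by rewrite big_sumType /= -sumrN; congr (_ + _); apply: eq_bigr => j _; rewrite mulrN.
have RM z w z' w' : Rl z w -> Rl z' w' -> Rl (z * z') (w * w').
  move=> [J1 [r1 [d1 [h1 -> ->]]]] [J2 [r2 [d2 [h2 -> ->]]]].
  exists (J1 * J2)%type, (fun j => r1 j.1 * r2 j.2), (fun j => d1 j.1 * d2 j.2); split.
  - by move=> j; apply: srM.
  - rewrite big_distrlr /= pair_big /=; apply: eq_bigr => j _.
    by rewrite rmorphM mevalM mulrACA.
  - rewrite big_distrlr /= pair_big /=; apply: eq_bigr => j _.
    by rewrite mevalM rmorphM mulrACA.
have Rf z w w' : Rl z w -> Rl z w' -> w = w'.
  move=> h1 h2; apply/eqP; rewrite -subr_eq0; apply/eqP/R0.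
  by rewrite -(subrr z); apply: RB.
have Rp p d : D0 d -> Rl (ev p a * d) (iota p.@[x] * d).
  by move=> hd; exists unit, (fun=> p), (fun=> d); split=> //; rewrite (bigD1 tt) //= big1 ?addr0 // => -[].
pose th z := epsilon (inhabits (0 : U)) (Rl z).
have hth z w : Rl z w -> th z = w.
  move=> h; apply: (Rf z) (h).
  by apply: (epsilon_spec (inhabits (0 : U))); exists w.
have hB z : Bring z -> Rl z (th z).
  move=> [J [r [d [hd ->]]]].
  by apply: (epsilon_spec (inhabits (0 : U))); exists (\sum_j iota (r j).@[x] * d j), J, r, d.
exists th; split.
- split.
  + by apply: hth; have := Rp 1 _ (sr1 D0R); rewrite rmorph1 !meval1 rmorph1 mulr1.
  + by move=> z z' hz hz'; apply: hth; apply: RB; apply: hB.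
  + by move=> z z' hz hz'; apply: hth; apply: RM; apply: hB.
- by move=> d hd; apply: hth; have := Rp 1 d hd; rewrite rmorph1 !meval1 rmorph1 !mul1r.
- by move=> p; apply: hth; have := Rp p 1 (sr1 D0R); rewrite !mulr1.
Qed.

(** ** Subsets of the locus *)

Definition irreducible_set (X : ('I_n -> k) -> Prop) :=
  forall (p1 p2 : {mpoly k[n]}) x1 x2, X x1 -> X x2 -> p1.@[x1] != 0 -> p2.@[x2] != 0 ->
  exists x, [/\ X x, p1.@[x] != 0 & p2.@[x] != 0].

(** The map takes [x] to a point of the transform of the variety; [x1] is the
    point of the variety having that point as its transform. *)
Definition invariant_set (X : ('I_n -> k) -> Prop) :=
  forall x x1, X x -> (forall i, (den i).@[x] != 0) ->
    (forall i, sk (x1 i) = (num i).@[x] / (den i).@[x]) -> X x1.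

Section Coordinates.
Variables (J : finType) (c : J -> U) (C : J -> ('I_n -> U) -> U) (Q : ('I_n -> U) -> U).
Hypotheses (hC : forall j, polyfun K (C j)) (hQ : polyfun K Q) (nQ : Q a != 0).
Hypothesis hc : forall j, c j = C j a / Q a.

Let cx (x : 'I_n -> k) j := C j (io x) / Q (io x).

(** Substituting [C j / Q] for the [c j] turns the relation into an equation of
    [a] over [K], which holds on the locus by independence. *)
Lemma transfer (R : ('I_n + J -> U) -> U) x : polyfun K R ->
  R (fun i => match i with inl i => a i | inr j => c j end) = 0 ->
  locus x -> Q (io x) != 0 ->
  R (fun i => match i with inl i => iota (x i) | inr j => cx x j end) = 0.
Proof.
move=> hRf R0 hx nx.
pose A (i : 'I_n + J) (v : 'I_n -> U) := match i with inl i => v i | inr j => C j v end.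
pose D (i : 'I_n + J) (v : 'I_n -> U) := match i with inl i => 1 | inr j => Q v end.
have hA i : polyfun K (A i) by case: i => i; [apply: PfX|apply: hC].
have hD i : polyfun K (D i) by case: i => i //; apply: PfC; apply: sr1.
have nD v i : Q v != 0 -> D i v != 0 by case: i => i //= _; apply: oner_neq0.
have [P [d [hP eP]]] := polyfun_clear hR hRf hA hD.
have P0 : P a = 0.
  rewrite eP => [|i]; last exact: nD.
  rewrite -[RHS](mul0r ((\prod_i D i a) ^+ d)); congr (_ * _); rewrite -[RHS]R0; congr (R _).
  by apply: functional_extensionality => -[i|j] /=; rewrite ?divr1 ?hc.
have := hdisj hP P0 hx; rewrite eP => [|i]; last exact: nD.
move/eqP; rewrite mulf_eq0 expf_eq0 => /orP[/eqP e|/andP[_]]; last first.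
  by move/prodf_eq0 => [i _ /eqP e]; have := nD _ i nx; rewrite e eqxx.
rewrite -[RHS]e; congr (R _).
by apply: functional_extensionality => -[i|j] /=; rewrite ?divr1.
Qed.

Hypothesis hcs : forall j, M (c j) /\ s (c j) = c j.
Variables (A D : 'I_n -> (J -> U) -> U).
Hypotheses (hA : forall i, polyfun K (A i)) (hD : forall i, polyfun K (D i)).
Hypotheses (nD : forall i, D i c != 0) (eAD : forall i, a i * D i c = A i c).

Let fx (x : 'I_n -> k) : 'I_n -> k := fun i => (num i).@[x] / (den i).@[x].

(** The identity [s (c j) = c j] is a relation between [a] and its image under
    the dynamics. It specialises to the points of the locus at which none of
    the denominators involved vanishes. *)
Lemma cx_stable : exists h : {mpoly k[n]}, ev h a != 0 /\
  forall x x1, locus x -> Q (io x) != 0 -> (forall i, (den i).@[x] != 0) -> h.@[x] != 0 ->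
    (forall i, sk (x1 i) = fx x i) ->
    Q (io x1) != 0 /\ forall j, cx x j = s (cx x1 j).
Proof.
have [Qs [hQs eQs]] := polyfun_twist sK hQ.
have /choice_fun [Cs hCs] j := polyfun_twist sK (hC j).
have cl f : polyfun K f -> exists P d, polyfun K P /\ forall y, (forall i, ev (den i) y != 0) ->
    P y = f (fun i => ev (num i) y / ev (den i) y) * (\prod_i ev (den i) y) ^+ d.
  by move=> hf; apply: (polyfun_clear hR hf (A := fun i y => ev (num i) y)
      (D := fun i y => ev (den i) y)) => i; apply: pfk.
have [Q' [d [hQ' eQ']]] := cl _ hQs.
have esa : (fun i => ev (num i) a / ev (den i) a) = (fun i => s (a i)).
  by apply: functional_extensionality => i; rewrite hsa.
have nden : \prod_i ev (den i) a != 0 by apply/prodf_neq0 => i _.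
have nQ' : Q' a != 0.
  by rewrite eQ' // esa eQs mulf_neq0 ?expf_neq0 // fmorph_eq0.
have [h [nh hh]] := nonzero_over_k hQ' nQ'.
exists h; split=> // x x1 hx nx dx hx' ex1.
have dx' i : ev (den i) (io x) != 0 by rewrite meval_map fmorph_eq0.
have efx : (fun i => ev (num i) (io x) / ev (den i) (io x)) = (fun i => s (iota (x1 i))).
  by apply: functional_extensionality => i; rewrite !meval_map -comm ex1 fmorph_div.
have ndx : \prod_i ev (den i) (io x) != 0 by apply/prodf_neq0 => i _.
have nx1 : Q (io x1) != 0.
  rewrite -(fmorph_eq0 s) -eQs -efx; have := hh _ hx'.
  by rewrite eQ' // mulf_eq0 negb_or => /andP[].
split=> // j.
have [Cj' [e [hCj' eCj']]] := cl _ (proj1 (hCs j)).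
pose R (v : 'I_n + J -> U) := v (inr j) * Q' (fun i => v (inl i)) * (\prod_i ev (den i) (fun i => v (inl i))) ^+ e
   - Cj' (fun i => v (inl i)) * (\prod_i ev (den i) (fun i => v (inl i))) ^+ d.
have hcomp f : polyfun K f -> polyfun K (fun v : 'I_n + J -> U => f (fun i => v (inl i))).
  by move=> hf; apply: (polyfun_comp hf (G := fun i v => v (inl i))) => i; apply: PfX.
have hRR : polyfun K R.
  have hpr d' : polyfun K (fun v : 'I_n + J -> U => (\prod_i ev (den i) (fun i => v (inl i))) ^+ d').
    by apply: polyfun_exp => //; apply: polyfun_prod => // i _; apply: (hcomp _ (pfk _)).
  apply: polyfun_sub => //; apply: PfM => //; last exact: hcomp.
  by apply: PfM; [apply: PfX|apply: hcomp].
have := transfer hRR _ hx nx; rewrite /R.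
have -> : c j * Q' a * (\prod_i ev (den i) a) ^+ e - Cj' a * (\prod_i ev (den i) a) ^+ d = 0.
  rewrite eQ' // eCj' // esa eQs (proj2 (hCs j)).
  have -> : s (C j a) = c j * s (Q a).
    by rewrite -{1}(proj2 (hcs j)) -rmorphM hc divfK.
  by rewrite mulrA mulrAC subrr.
move=> /(_ erefl) /eqP; rewrite subr_eq0 eQ' // eCj' // efx eQs (proj2 (hCs j)).
rewrite mulrA mulrAC => /eqP E.
have nn : (\prod_i ev (den i) (io x)) ^+ e * (\prod_i ev (den i) (io x)) ^+ d != 0.
  by rewrite mulf_neq0 ?expf_neq0.
have ns : s (Q (io x1)) != 0 by rewrite fmorph_eq0.
have E2 : cx x j * s (Q (io x1)) = s (C j (io x1)).
  by apply: (mulIf nn); rewrite !mulrA.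
by rewrite [in RHS]/cx fmorph_div -E2 mulfK.
Qed.

End Coordinates.

(** Let [c] be a tuple of constants of [K(a)] such that [a] and [c] are
    rational functions of each other over [K]. Suppose that [X] is not dense in
    the locus. Then the set [cx X] of the values of [c] on [X] satisfies an
    equation over [K] that [c] does not satisfy.

    By [cx_stable] the dynamics acts on [cx X] through [s], so the invariance of
    [X] and its irreducibility make the ideal of [cx X] over [K] stable under
    [s]. By [fixed_span] it contains an equation [P0] with constant coefficients
    and [P0 c <> 0].

    Now take a point [x0] of [X] with [h <> 0] and specialise [a] to [x0]. The
    constants of [K(a)] can be kept fixed in this specialisation, by
    [B_specialise], so [P0 c <> 0] survives. But [c] is a rational function of
    [a], so [c] is also sent to [cx x0], where [P0] vanishes. The polynomial [h]
    keeps away from the denominators and from the finitely many obstructions to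
    extending the specialisation; it does not depend on [X]. *)
Theorem invariant_sets_dense : exists h : {mpoly k[n]}, ev h a != 0 /\
  forall X : ('I_n -> k) -> Prop, (forall x, X x -> locus x) ->
    irreducible_set X -> invariant_set X -> (exists x, X x /\ h.@[x] != 0) ->
    forall p, (forall x, X x -> p.@[x] = 0) -> ev p a = 0.
Proof.
have [J [c [A [D [hAD hcs nD eAD]]]]] := rational_over_constants.
have hA i : polyfun K (A i) by case: (hAD i).
have hD i : polyfun K (D i) by case: (hAD i).
have /choice_fun [fg hfg] : forall j, exists fg : (('I_n -> U) -> U) * (('I_n -> U) -> U),
    [/\ polyfun K fg.1, polyfun K fg.2, fg.2 a != 0 & c j = fg.1 a / fg.2 a].
  by move=> j; have [[f [g [h1 h2 h3 h4]]] _] := hcs j; exists (f, g).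
pose Q v := \prod_j (fg j).2 v.
pose C j v := (fg j).1 v * \prod_(i | i != j) (fg i).2 v.
have hQ : polyfun K Q by apply: polyfun_prod => // j _; case: (hfg j).
have hC j : polyfun K (C j).
  by apply: PfM; [case: (hfg j)|apply: polyfun_prod => // i _; case: (hfg i)].
have nQ : Q a != 0 by apply/prodf_neq0 => j _; case: (hfg j).
have hc j : c j = C j a / Q a.
  have -> : Q a = (fg j).2 a * \prod_(i | i != j) (fg i).2 a by rewrite /Q (bigD1 j).
  have [_ _ n1 ->] := hfg j; rewrite /C -mulf_div divff ?mulr1 //.
  by apply/prodf_neq0 => i _; case: (hfg i).
clearbody Q C; clear fg hfg.
(* the specialisation has to extend to the coefficients of [C] and [Q] *)
have [lQ [hlQ pQ]] := polyfun_finite hQ.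
have /choice_fun [lC hlC] j := polyfun_finite (hC j).
pose l := lQ ++ flatten [seq lC j | j <- enum J].
have pQl : polyfun (fun z => z \in l) Q.
  by apply: polyfun_mono pQ => z hz; rewrite mem_cat hz.
have pCl j : polyfun (fun z => z \in l) (C j).
  have [_] := hlC j; apply: polyfun_mono => z hz; rewrite mem_cat; apply/orP; right.
  by apply/flattenP; exists (lC j) => //; apply: map_f; rewrite mem_enum.
pose B' := ring_adjs Bring l.
have hB' : subring B' by apply: adjs_subring; apply: B_subring.
have lB' z : z \in l -> B' z by apply: adjs_gen; apply: B_subring.
have BB' z : Bring z -> B' z by apply: adjs_base; apply: B_subring.
have aB i : Bring (a i) by have := B_poly 'X_i; rewrite map_mpolyX mevalXU.
have kB z : Bring (iota z) by have := B_poly z%:MP; rewrite map_mpolyC mevalC.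
have QB' : B' (Q a) by apply: (polyfun_val hB' pQl) => // i; apply: BB'.
have [g [hg ng ext]] := extend_list B_subring QB' nQ.
have [Jg [r [d [hd eg]]]] := hg.
have [T [r' [hT [e1 e2]]]] := B_normal r hd.
have [t0 [t0T nt0]] : exists t, t \in T /\ ev (r' t) a != 0.
  apply: NNPP => h; case/negP: ng; rewrite eg e1; apply/eqP/big1 => t tT.
  have [->|nt] := eqVneq (ev (r' t) a) 0; first by rewrite mul0r.
  by case: h; exists t.
have [hq [nhq hhq]] := nonzero_over_k hQ nQ.
have [h' [nh' hh']] := cx_stable hC hQ nQ hc hcs.
exists (\prod_i den i * r' t0 * hq * h'); split.
  rewrite !evM; apply: mulf_neq0 nh'; apply: mulf_neq0 nhq; apply: mulf_neq0 nt0.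
  by rewrite ev_prod; apply/prodf_neq0 => i _; apply: hden.
move=> X XL irrX invX [x0 [Xx0 nx0]] p pX.
set h := \prod_i den i * _ * _ * _ in nx0.
have hprop x : h.@[x] != 0 -> [/\ forall i, (den i).@[x] != 0, (r' t0).@[x] != 0,
    Q (io x) != 0 & h'.@[x] != 0].
  rewrite /h !mevalM !mulf_eq0 !negb_or => /andP[/andP[/andP[n1 n2] n3] n4].
  split; [|exact: n2|exact: hhq|exact: n4].
  by move=> i; move: n1; rewrite meval_prodr => /prodf_neq0/(_ i isT).
pose cx (x : 'I_n -> k) j := C j (io x) / Q (io x).
pose q (P : (J -> U) -> U) := forall x, X x -> Q (io x) != 0 -> P (cx x) = 0.
apply: NNPP => /eqP np.
(* pull [p] back along [a = A c / D c] *)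
have [P [hP qP nP]] : exists P, [/\ polyfun K P, q P & P c != 0].
  have [P1 [e [hP1 eP1]]] := polyfun_clear hR (pfk p) hA hD.
  have hDp : polyfun K (fun y => \prod_i D i y) by apply: polyfun_prod.
  exists (fun y => P1 y * \prod_i D i y); split; first exact: PfM.
    move=> x Xx nx; apply/eqP; have [|nDx] := eqVneq (\prod_i D i (cx x)) 0.
      by move=> ->; rewrite mulr0.
    have nDi i : D i (cx x) != 0 by move: nDx => /prodf_neq0/(_ i isT).
    have := eP1 _ nDi; have -> : (fun i => A i (cx x) / D i (cx x)) = io x; last first.
      by rewrite meval_map pX // rmorph0 mul0r => ->; rewrite mul0r.
    apply: functional_extensionality => i; apply/eqP; rewrite eq_sym -(can2_eq (mulfK (nDi i)) (divfK (nDi i))).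
    rewrite -subr_eq0; apply/eqP.
    pose R (v : 'I_n + J -> U) := v (inl i) * D i (fun j => v (inr j)) - A i (fun j => v (inr j)).
    apply: (transfer hC hQ nQ hc (R := R)) => //; last exact: XL.
      apply: polyfun_sub => //; first apply: PfM; first exact: PfX.
        by apply: (polyfun_comp (hD i) (G := fun j v => v (inr j))) => j; apply: PfX.
      by apply: (polyfun_comp (hA i) (G := fun j v => v (inr j))) => j; apply: PfX.
    by rewrite /R eAD subrr.
  have nDc : \prod_i D i c != 0 by apply/prodf_neq0 => i _.
  have := eP1 c nD; have -> : (fun i => A i c / D i c) = a.
    by apply: functional_extensionality => i; rewrite -eAD mulfK.
  by move=> ->; exact: (mulf_neq0 (mulf_neq0 np (expf_neq0 _ nDc)) nDc).
have [JP [kap [gP [hkap hgP eP]]]] := polyfun_decomp hR (fix_subring s hR) hP.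
pose W (w : JP -> U) := (forall j, K (w j)) /\ q (fun y => \sum_j w j * gP j y).
case/negP: nP; rewrite eP; apply/eqP.
apply: (fixed_span hK (s := s) (W := W)).
- by move=> w [].
- move=> w w' [h1 h2] [h1' h2']; split=> [j|x Xx nx]; first exact: srB.
  by under eq_bigr do rewrite mulrBl; rewrite sumrB h2 // h2' // subr0.
- move=> z w hz [h1 h2]; split=> [j|x Xx nx]; first exact: srM.
  by under eq_bigr do rewrite -mulrA; rewrite -big_distrr /= h2 // mulr0.
- move=> w [hw qw]; split=> [j|x1 Xx1 nx1]; first exact: sK.
  pose Ps y := \sum_j s (w j) * gP j y.
  have hgK j : polyfun K (gP j) by apply: polyfun_mono (hgP j) => z [].
  have hPs : polyfun K Ps.
    by apply: polyfun_sum => // j _; apply: PfM => //; apply: PfC; apply: sK.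
  have [G [e [hG eG]]] := polyfun_clear hR hPs hC (fun _ : J => hQ).
  apply: NNPP => /eqP nz.
  have nG : G (io x1) != 0.
    rewrite eG; last by move=> ?; exact: nx1.
    by apply: mulf_neq0 nz _; apply: expf_neq0; apply/prodf_neq0 => j _; exact: nx1.
  have [pG [npG hpG]] := nonzero_over_k hG nG.
  rewrite meval_map fmorph_eq0 in npG.
  have [x [Xx nx1' nx]] := irrX pG h x1 x0 Xx1 Xx0 npG nx0.
  have [dx _ Qx hx] := hprop x nx.
  have /choice_fun [y ey] : forall i, exists y, sk y = (num i).@[x] / (den i).@[x].
    by move=> i; apply: inv.
  have Xy := invX _ _ Xx dx ey.
  have [nQy cxy] := hh' x y (XL _ Xx) Qx dx hx ey.
  have := hpG _ nx1'; rewrite eG // => /negP; apply.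
  rewrite mulf_eq0; apply/orP; left; apply/eqP.
  rewrite -[RHS](rmorph0 s) -(qw y Xy nQy) rmorph_sum; apply: eq_bigr => j _ /=.
  rewrite rmorphM -(polyfun_fixed _ _ (hgP j)); last by move=> z [].
  by congr (_ * gP j _); apply: functional_extensionality => i; exact: cxy.
- move=> w [hw qw] fw.
  have [dx0 rx0 Qx0 _] := hprop x0 nx0.
  have [th [hth thd thp]] := B_specialise (XL _ Xx0).
  have nthg : th g != 0.
    rewrite eg (ho_sum B_subring hth); last first.
      by move=> j _; apply: B_intro.
    have -> : \sum_i th (ev (r i) a * d i) = \sum_i iota (r i).@[x0] * d i.
      apply: eq_bigr => i _; rewrite (hoM hth) ?thp ?thd //; first exact: B_poly.
      exact: B_const.
    rewrite e2; apply: contra rx0 => /eqP E.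
    have := hT (fun t => iota (r' t).@[x0]) _ E t0 t0T => H.
    rewrite -(fmorph_eq0 iota); apply/eqP/H => j.
    by apply: fgen_base => //; exists (r' j).@[x0].
  have [F [j [phi [hphi ephi nphi]]]] := ext U th chU hth nthg.
  have ea i : phi (a i) = phi (iota (x0 i)).
    rewrite !ephi //; congr (j _); have := thp 'X_i; rewrite map_mpolyX !mevalXU => ->.
    by have := thp (x0 i)%:MP; rewrite map_mpolyC !mevalC.
  have aB' i : B' (a i) by apply: BB'.
  have kB' z : B' (iota z) by apply: BB'.
  have spec f : polyfun (fun z => z \in l) f -> phi (f a) = phi (f (io x0)).
    by move=> hf; apply: (ho_polyfun hB' hphi hf).
  pose P0 y := \sum_j w j * gP j y.
  pose E z := K z /\ s z = z.
  have hE : subring E by apply: fix_subring.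
  have hP0 : polyfun E P0.
    by apply: polyfun_sum => // i _; apply: PfM => //; apply: PfC.
  have ED0 z : E z -> D0 z by move=> [h1 h2]; split=> //; apply: fgen_base.
  rewrite -/(P0 c).
  have DB' z : D0 z -> B' z by move=> hz; apply: BB'; apply: B_const.
  have phid z : D0 z -> phi z = j z by move=> hz; rewrite ephi ?thd //; apply: B_const.
  have cB' i : B' (c i) by apply: DB'.
  have hQx : B' (Q (io x0)) by apply: (polyfun_val hB' pQl).
  have hCx i : B' (C i (io x0)) by apply: (polyfun_val hB' (pCl i)).
  have hCa i : B' (C i a) by apply: (polyfun_val hB' (pCl i)).
  have nphi0 : phi (Q (io x0)) != 0 by rewrite -spec.
  (* [phi] maps [c i] to the image of [cx x0 i], up to the denominator *)
  have cphi i : phi (c i) * phi (Q (io x0)) = phi (C i (io x0)).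
    by rewrite -(spec _ (pCl i)) -(spec _ pQl) -(hoM hphi (cB' i) QB') {1}hc divfK.
  have EB' u : E u -> B' u by move/ED0/DB'.
  have [z [e [hz ez ephiz]]] := hom_fraction hB' hphi EB' hQx hCx Qx0 cB' hP0 cphi.
  have z0 : z = 0 by rewrite ez [P0 _]qw // mul0r.
  move/eqP: ephiz; rewrite z0 (ho0 hB' hphi) eq_sym mulf_eq0 expf_eq0 (negPf nphi0) andbF orbF.
  move=> /eqP PP; apply/eqP; rewrite -(fmorph_eq0 j) -phid; last exact/(polyfun_val D0R hP0 ED0).
  by rewrite PP.
- by split; [exact: hkap|move=> x Xx nx; rewrite -eP; exact: qP].
Qed.

End Core.

(** * Noetherianity *)

Lemma nat_subseq (g : nat -> nat) : exists e : nat -> nat,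
  (forall a, (e a < e a.+1)%N) /\ forall a b, (a <= b)%N -> (g (e a) <= g (e b))%N.
Proof.
have /choice_fun [j hj] : forall N, exists j, (N <= j)%N /\ forall l, (N <= l)%N -> (g j <= g l)%N.
  move=> N; have [|v [[j [hj ev]] hv]] := @ex_min (fun v => exists j, (N <= j)%N /\ g j = v).
    by exists (g N), N.
  by exists j; split=> // l hl; rewrite ev; apply: hv; exists l.
pose e := fix e a := if a is a'.+1 then j (e a').+1 else j 0%N.
have he a : (e a < e a.+1)%N by case: (hj (e a).+1).
exists e; split=> // a b /subnK <-; elim: (b - a)%N => // d IH.
apply: leq_trans IH _; rewrite addSn.
have [h1 h2] := hj (if (d + a)%N is a'.+1 then (e a').+1 else 0%N).
have -> : e (d + a)%N = j (if (d + a)%N is a'.+1 then (e a').+1 else 0%N) by case: (d + a)%N.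
apply: h2; apply: leq_trans h1 _.
have -> : j (if (d + a)%N is a'.+1 then (e a').+1 else 0%N) = e (d + a)%N by case: (d + a)%N.
exact/ltnW/he.
Qed.

Lemma mono_seq (e : nat -> nat) : (forall a, (e a < e a.+1)%N) ->
  forall a b, (a < b)%N -> (e a < e b)%N.
Proof.
move=> he a b /subnK <-; elim: (b - a.+1)%N => [|d IH]; first exact: he.
exact: ltn_trans IH (he _).
Qed.

(** Pass to a subsequence along which every coordinate is nondecreasing, one
    coordinate after the other. *)
Lemma dickson n (f : nat -> 'X_{1..n}) : exists i j, (i < j)%N /\ (f i <= f j)%MM.
Proof.
suff [e [he hm]] : exists e : nat -> nat, (forall a, (e a < e a.+1)%N) /\
    forall i a b, i \in enum 'I_n -> (a <= b)%N -> (f (e a) i <= f (e b) i)%N.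
  exists (e 0%N), (e 1%N); split; first exact: he.
  by apply/mnm_lepP => i; apply: hm; rewrite ?mem_enum.
elim: (enum 'I_n) => [|i s [e [he hm]]].
  by exists id; split.
have [e' [he' hm']] := nat_subseq (fun a => f (e a) i).
exists (e \o e'); split=> [a|i' a b] /=; first exact: mono_seq.
rewrite inE => /orP[/eqP ->|hi'] ab; first exact: hm'.
apply: hm => //; move: ab; rewrite leq_eqVlt => /orP[/eqP ->//|lt].
by apply: ltnW; apply: mono_seq.
Qed.

Lemma dickson_basis n (S : 'X_{1..n} -> Prop) : exists l : seq 'X_{1..n},
  (forall m, m \in l -> S m) /\ forall m, S m -> exists2 m', m' \in l & (m' <= m)%MM.
Proof.
apply: NNPP => hno.
have /choice_fun [next hnext] : forall l : seq 'X_{1..n}, exists m,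
    (forall m, m \in l -> S m) -> S m /\ forall m', m' \in l -> ~ (m' <= m)%MM.
  move=> l; have [hl|hl] := classic (forall m, m \in l -> S m); last first.
    by exists 0%MM.
  apply: NNPP => h; apply: hno; exists l; split=> // m Sm.
  apply: NNPP => h2; apply: h; exists m => _; split=> // m' hm' le.
  by apply: h2; exists m'.
pose L := fix L t := if t is t'.+1 then rcons (L t') (next (L t')) else [::].
have LS t : forall m, m \in L t -> S m.
  elim: t => [|t IH] m //=; rewrite mem_rcons inE => /orP[/eqP ->|/IH //].
  by case: (hnext (L t) IH).
have [i [j [ij le]]] := dickson (fun t => next (L t)).
have [_] := hnext (L j) (LS j); move/(_ (next (L i))); apply=> //.
move: ij => /subnK <-; elim: (j - i.+1)%N => [|d IH] /=; first by rewrite mem_rcons mem_head.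
by rewrite mem_rcons inE IH orbT.
Qed.

Section Hilbert.
Variables (k : fieldType) (n : nat).
Implicit Types (F : {mpoly k[n]} -> Prop) (p q : {mpoly k[n]}).

Inductive ideal F : {mpoly k[n]} -> Prop :=
| Ideal0 : ideal F 0
| IdealD r p q : F p -> ideal F q -> ideal F (q + r * p).

Lemma ideal_mul_sub F c p q : ideal F p -> ideal F q -> ideal F (p - c * q).
Proof.
move=> hp; elim=> [|r p' q' hp' _ IH]; first by rewrite mulr0 subr0.
have -> : p - c * (q' + r * p') = p - c * q' + (- c * r) * p' by ring.
exact: IdealD.
Qed.

(** Finitely many members of the ideal generated by [F] have leading monomials
    dividing all the others; each is a combination of finitely many members of
    [F], which form [l]. Reduction by these members, by induction on the leading
    monomial, shows that every polynomial of the ideal vanishes where [l] does. *)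
Lemma hilbert_zeros F : exists l : seq {mpoly k[n]},
  (forall p, p \in l -> F p) /\
  forall v, (forall p, p \in l -> p.@[v] = 0) -> forall p, F p -> p.@[v] = 0.
Proof.
have [lm [h1 h2]] := dickson_basis (fun m => exists q, [/\ ideal F q, q != 0 & mlead q = m]).
have fin q : ideal F q -> exists l : seq {mpoly k[n]},
    (forall p, p \in l -> F p) /\ forall v, (forall p, p \in l -> p.@[v] = 0) -> q.@[v] = 0.
  elim=> [|r p' q' hp' _ [l [l1 l2]]]; first by exists [::]; split=> // v _; rewrite meval0.
  exists (p' :: l); split=> [p|v hv]; first by rewrite inE => /orP[/eqP ->|/l1].
  rewrite mevalD mevalM (hv p') ?mem_head // mulr0 addr0; apply: l2 => p hp.
  by apply: hv; rewrite inE hp orbT.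
have [l [l1 l2]] : exists l : seq {mpoly k[n]}, (forall p, p \in l -> F p) /\
    forall m, m \in lm -> exists q, [/\ q != 0, mlead q = m, ideal F q &
      forall v, (forall p, p \in l -> p.@[v] = 0) -> q.@[v] = 0].
  elim: lm h1 {h2} => [|m lm IH] h1; first by exists [::]; split.
  have [m0|l [l1 l2]] := IH; first by move=> hm; apply: h1; rewrite inE hm orbT.
  have [q [hq nq eq]] := h1 m (mem_head _ _).
  have [l' [l1' l2']] := fin q hq.
  exists (l' ++ l); split=> [p|m']; first by rewrite mem_cat => /orP[/l1'|/l1].
  rewrite inE => /orP[/eqP ->|/l2 [q' [a1 a2 a3 a4]]].
    exists q; split=> // v hv; apply: l2' => p hp; apply: hv; rewrite mem_cat hp //.
  exists q'; split=> // v hv; apply: a4 => p hp; apply: hv; rewrite mem_cat hp orbT //.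
exists l; split=> // v hv.
suff H q : ideal F q -> q.@[v] = 0.
  move=> p hp; apply: H; have -> : p = 0 + 1 * p by rewrite mul1r add0r.
  by apply: IdealD => //; apply: Ideal0.
move: {2}(mlead q) (erefl (mlead q)) => m; elim/(ltmwf (n := n)): m q => m IH q em hq.
have [->|nq] := eqVneq q 0; first by rewrite meval0.
have [|m' hm' le] := h2 (mlead q); first by exists q.
have [g [ng eg hg hgv]] := l2 m' hm'.
pose c : {mpoly k[n]} := (mleadc q / mleadc g) *: 'X_[mlead q - m'].
have e : q.@[v] = (q - c * g).@[v] by rewrite mevalB mevalM hgv // mulr0 subr0.
have nc : mleadc q / mleadc g != 0 by rewrite mulf_neq0 ?invr_eq0 ?mleadc_eq0.
have nX : c != 0.
  rewrite /c scaler_eq0 (negPf nc) /=; apply/eqP => /(congr1 (mcoeff (mlead q - m')%MM)) /eqP.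
  by rewrite mcoeffX eqxx mcoeff0 oner_eq0.
have lcg : mlead (c * g) = mlead q by rewrite mleadM // mleadZ // mleadXm eg submK.
rewrite e; have [->|nr] := eqVneq (q - c * g) 0; first by rewrite meval0.
apply: (IH (mlead (q - c * g))) => //; last exact: ideal_mul_sub.
rewrite -em lt_neqAle; apply/andP; split; last first.
  by apply: le_trans (mleadB_le _ _) _; rewrite lcg joinxx.
apply: contra nr => /eqP e2; rewrite -mleadc_eq0 e2 mcoeffB.
suff -> : (c * g)@_(mlead q) = mleadc q by rewrite subrr.
rewrite -{1}lcg mleadM // mleadcM /c mleadcZE mleadXm mcoeffX eqxx mulr1.
by rewrite divfK ?mleadc_eq0.
Qed.

End Hilbert.

(** * Quantifier-free types *)

Section DiffSubfields.
Variables (U : fieldType) (s : {rmorphism U -> U}).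

Lemma diff_subfield_sf K : diff_subfield s K -> subfield K.
Proof.
case=> h1 hB hD _; have hV x : K x -> K x^-1 by move=> hx; rewrite -div1r; apply: hD.
split=> //; split=> // x y hx hy; rewrite -[y]invrK; exact/hD/hV.
Qed.

Lemma sf_diff_subfield K : subfield K -> (forall x, K x -> K (s x)) -> diff_subfield s K.
Proof.
move=> hK sK; split=> //; first exact: sr1 (sf_sr hK).
- by move=> x y; exact: (srB (sf_sr hK)).
- by move=> x y; apply: sf_div.
Qed.

Lemma dgen_min A L : diff_subfield s L -> (forall y, A y -> L y) -> forall x, dgen s A x -> L x.
Proof. by move=> hL hA x; apply. Qed.

Lemma dgen_base A x : A x -> dgen s A x.
Proof. by move=> hx L _; apply. Qed.

Lemma dgen_diff A : diff_subfield s (dgen s A).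
Proof.
split.
- by move=> L [].
- by move=> x y hx hy L hL hA; case: (hL) => _ h _ _; apply: h; [apply: hx|apply: hy].
- by move=> x y hx hy L hL hA; case: (hL) => _ _ h _; apply: h; [apply: hx|apply: hy].
- by move=> x hx L hL hA; case: (hL) => _ _ _ h; apply: h; apply: hx.
Qed.

Lemma alg_closure_base (L : U -> Prop) x : subfield L -> L x -> alg_closure L x.
Proof.
move=> hL hx; exists ('X - x%:P); split; first by rewrite polyXsubC_eq0.
- have hR := sf_sr hL; exact: (poB hR (poX hR) (poC hR hx)).
- by rewrite root_XsubC.
Qed.

Lemma alg_indep_mono (L L' : U -> Prop) n (u : 'I_n -> U) : (forall x, L x -> L' x) ->
  alg_indep L' u -> alg_indep L u.
Proof. by move=> h hu p hp; apply: hu => m; apply: h. Qed.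

End DiffSubfields.

Section Formulas.
Variables (k U : fieldType) (s : {rmorphism U -> U}) (iota : {rmorphism k -> U}) (n : nat).
Notation ev p v := ((map_mpoly iota p).@[v]).

Lemma term_of_mpoly (p : {mpoly k[n]}) : exists t : dterm k n,
  forall e, deval s iota e t = ev p e.
Proof.
suff H f : polyfun (img iota) f -> exists t : dterm k n, forall e, deval s iota e t = f e.
  exact: H (polyfun_mpoly iota p).
elim=> [_ [c ->]|i|f1 f2 _ [t1 e1] _ [t2 e2]|f1 f2 _ [t1 e1] _ [t2 e2]].
- by exists (DCst n c).
- by exists (DVar k i).
- by exists (DAdd t1 t2) => e /=; rewrite e1 e2.
- by exists (DMul t1 t2) => e /=; rewrite e1 e2.
Qed.

Lemma conjunction (J : finType) (g : J -> dform k n) : (forall j, qfree (g j)) ->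
  exists f, qfree f /\ forall e : 'I_n -> U, dholds s iota e f <-> forall j, dholds s iota e (g j).
Proof.
move=> hg; suff [f [hf e]] : exists f, qfree f /\ forall e : 'I_n -> U,
    dholds s iota e f <-> forall j, j \in enum J -> dholds s iota e (g j).
  exists f; split=> // v; split=> [/e h j|h]; first by apply: h; rewrite mem_enum.
  by apply/e.
elim: (enum J) => [|j l [f [hf e]]].
  by exists (DEq (DZero _ _) (DZero _ _)).
exists (DAnd (g j) f); split=> [|v] /=; first by rewrite hg.
split=> [[h1 /e h2] i|h]; first by rewrite inE => /orP[/eqP ->|/h2].
by split; [apply: h; rewrite mem_head|apply/e => i hi; apply: h; rewrite inE hi orbT].
Qed.

(** The dynamics makes [s (N y')] a rational function of [y] with coefficients
    in [k], the endomorphism being applied to the coefficients of [N]. *)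
Lemma twist_clear (num den : 'I_n -> {mpoly k[n]}) (N : {mpoly k[n]}) :
  (forall c, img iota c -> img iota (s c)) ->
  exists (P : {mpoly k[n]}) d, forall y y' : 'I_n -> U, (forall i, ev (den i) y != 0) ->
    (forall i, s (y' i) = ev (num i) y / ev (den i) y) ->
    ev P y = s (ev N y') * (\prod_i ev (den i) y) ^+ d.
Proof.
move=> hs; have hR := sf_sr (img_subfield iota).
have [f [hf ef]] := polyfun_twist hs (polyfun_mpoly iota N).
have [P [d [hP eP]]] := polyfun_clear hR hf (A := fun i y => ev (num i) y)
   (D := fun i y => ev (den i) y) (fun i => polyfun_mpoly iota _) (fun i => polyfun_mpoly iota _).
have [P' eP'] := mpoly_of_polyfun hP.
exists P', d => y y' hd hy; rewrite -eP' eP // -ef; congr (f _ * _).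
by apply: functional_extensionality => i; rewrite hy.
Qed.

End Formulas.

Lemma qf_atoms (k U : fieldType) (s : U -> U) (iota : k -> U) n (f : dform k n) (a b : 'I_n -> U) :
  (forall t u, deval s iota a t = deval s iota a u <-> deval s iota b t = deval s iota b u) ->
  qfree f -> (dholds s iota a f <-> dholds s iota b f).
Proof.
elim: f a b => [{}n t u|{}n f IH|{}n f IHf g IHg|{}n f IH] a b hab //=.
- by move=> /(IH _ _ hab) h; split=> h1 h2; apply: h1; apply/h.
- by move=> /andP[/(IHf _ _ hab) h1 /(IHg _ _ hab) h2]; split=> -[/h1 ? /h2 ?].
Qed.

Section RationalTypes.
Variables (k : closedFieldType) (sk : {rmorphism k -> k}).
Hypothesis inversive : forall y : k, exists x : k, sk x = y.
Variables (U : fieldType) (s : {rmorphism U -> U}) (iota : {rmorphism k -> U}).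
Hypotheses (comm : forall x : k, iota (sk x) = s (iota x)) (chU : [pchar U] =i pred0).
Notation ev p v := ((map_mpoly iota p).@[v]).
Notation io x := (fun i => iota (x i)).

Let hk := img_subfield iota.
Let hs c : img iota c -> img iota (s c).
Proof. by move=> [x ->]; exists (sk x). Qed.

Lemma k_algebraic z : algebraic_el (img iota) z -> img iota z.
Proof.
move=> [P [hP nP Pz]]; have /choice_fun [c hc] := hP.
pose p0 := \poly_(i < size P) c i.
have eP : P = map_poly iota p0.
  apply/polyP => i; rewrite coef_map coef_poly; case: ltnP => hi; first exact: hc.
  by rewrite raddf0 nth_default.
have np0 : p0 != 0 by apply: contraNneq nP => e; rewrite eP e map_poly0.
apply: (root_closed (p := p0)) => //; rewrite -eP; exact/rootP.
Qed.

Lemma k_alg_closure z : alg_closure (dgen s (img iota)) z -> img iota z.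
Proof.
move=> [P [nP hP rP]]; apply: k_algebraic; exists P; split=> //; last exact/rootP.
by move=> i; apply: (dgen_min _ _ (hP i)) => //; apply: sf_diff_subfield.
Qed.

(** Specialisation over the base field itself: in the absence of further
    parameters the independence hypothesis is void. *)
Lemma k_points n (a : 'I_n -> U) (h : {mpoly k[n]}) : ev h a != 0 ->
  exists x, locus iota a x /\ h.@[x] != 0.
Proof.
move=> nh; have kk c : img iota (iota c) by exists c.
have hind r (u : 'I_r -> U) : (forall i, exists j, u i = a j) ->
  alg_indep (img iota) u -> alg_indep (img iota) u by [].
have [x [h1 h2]] := specialise chU (sf_sr hk) kk hind (polyfun_mpoly iota h) nh.
exists x; split; last by move: h1; rewrite meval_map fmorph_eq0.
move=> p /(h2 _ (polyfun_mpoly iota p)) /eqP; rewrite meval_map fmorph_eq0 => /eqP //.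
Qed.

(** If [f] did not vanish at [x], neither would one of the polynomials over [k]
    provided by [nonzero_over_k], nor would that polynomial vanish at [a]. Then [a] could
    be specialised over [K] to a point of [k] at which it is nonzero, and at
    that point [f] is nonzero although [f] vanishes at [a]. *)
Lemma disjoint_specialise n (a : 'I_n -> U) (K : U -> Prop) :
  subfield K -> (forall c, K (iota c)) -> indep s (img a) (img iota) K ->
  forall f, polyfun K f -> f a = 0 -> forall x, locus iota a x -> f (io x) = 0.
Proof.
move=> hK kK hind f hf f0 x hx; apply: NNPP => /eqP nf.
have [p [np hp]] := nonzero_over_k iota hK hf nf.
have npa : ev p a != 0.
  by apply: contra np => /eqP/hx e; rewrite meval_map e rmorph0.
have hind' r (u : 'I_r -> U) : (forall i, exists j, u i = a j) ->
  alg_indep (img iota) u -> alg_indep K u.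
  move=> hu hku.
  have : alg_indep (alg_closure (dgen s (union K (img iota)))) u.
    apply: hind; last by apply: alg_indep_mono hku => z; apply: k_alg_closure.
    move=> i; have [j ->] := hu i; apply: alg_closure_base.
      exact: diff_subfield_sf (dgen_diff s _).
    by apply: dgen_base; left; exists j.
  apply: alg_indep_mono => z hz; apply: alg_closure_base.
    exact: diff_subfield_sf (dgen_diff s _).
  by apply: dgen_base; left.
have pK : polyfun K (fun v => ev p v) by apply: polyfun_mono (polyfun_mpoly iota p) => _ [c ->].
have [x' [h1 h2]] := specialise chU (sf_sr hK) kK hind' pK npa.
have := hp x'; rewrite -(fmorph_eq0 iota) -meval_map h1 => /(_ isT).
by rewrite h2 // eqxx.
Qed.

(** A constant of [k(a)] is independent from itself over [k], hence algebraic
    over [k]. *)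
Lemma orthogonal_fixed n (a : 'I_n -> U) :
  (forall m (c : 'I_m -> U), (forall i, fixed_field s (c i)) ->
    indep s (img a) (img iota) (img c)) ->
  forall z, fgen (img iota) a z -> s z = z -> img iota z.
Proof.
move=> horth z hz sz; apply: NNPP => nz.
pose u := fun _ : nat => z.
have hu : alg_indep (img iota) (fun i : 'I_1 => u i).
  apply: NNPP => h; apply: nz; apply: k_algebraic.
  exact: (@alg_dep_algebraic U (img iota) (sf_sr hk) 0 u (@alg_indep0 _ _ _) h).
have hind := horth 1%N (fun=> z) (fun=> sz).
have hd A := diff_subfield_sf (dgen_diff s A).
have : alg_indep (dgen s (union (img (fun _ : 'I_1 => z)) (img iota))) (fun i : 'I_1 => u i).
  apply: alg_indep_mono (hind 1%N _ _ _).
  - by move=> x; apply: alg_closure_base.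
  - move=> i; apply: alg_closure_base => //.
    have hgen j : dgen s (union (img a) (img iota)) (a j) by apply: dgen_base; left; exists j.
    have hbase x : img iota x -> dgen s (union (img a) (img iota)) x.
      by move=> hx; apply: dgen_base; right.
    exact: (fgen_min (hd _) hbase hgen hz).
  - by apply: alg_indep_mono hu => x; apply: k_alg_closure.
move=> /(_ ('X_ord0 - z%:MP)) H; have : ('X_ord0 - z%:MP : {mpoly U[1]}) = 0.
  apply: H; last by rewrite mevalB mevalXU mevalC subrr.
  have hD := sf_sr (hd (union (img (fun _ : 'I_1 => z)) (img iota))).
  move=> m; rewrite mcoeffB mcoeffX mcoeffC; apply: (srB hD); first exact: sr_nat.
  apply: (srM hD); last exact: sr_nat.
  by apply: dgen_base; left; exists ord0.
move=> /(congr1 (mcoeff U_(ord0))) /eqP.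
by rewrite mcoeffB mcoeffX mcoeffC eqxx mnm1_eq0 mulr0 subr0 mcoeff0 oner_eq0.
Qed.

(** In characteristic zero the perfect closure adds nothing, and the field
    generated over [K] by fixed elements is already stable under [s]. *)
Lemma internal_fgen n (a : 'I_n -> U) (K : U -> Prop) m (c : 'I_m -> U) :
  diff_subfield s K -> (forall i, s (c i) = c i) ->
  (forall i, perf_closure (dgen s (union K (img c))) (a i)) ->
  forall i, fgen K c (a i).
Proof.
move=> hK hc ha i; have hK' := diff_subfield_sf hK; have hR := sf_sr hK'.
have [|[p [e [hp _]]]] := ha i; last by move: hp; rewrite chU.
apply: dgen_min => [|z [hz|[j ->]]]; last exact: fgen_gen.
- apply: sf_diff_subfield; first exact: fgen_subfield.
  apply: fgen_stable => // [z hz|j]; last by rewrite hc; apply: fgen_gen.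
  by apply: fgen_base => //; case: hK => _ _ _; apply.
- exact: fgen_base.
Qed.

Section Isolation.
Variables (n : nat) (num den : 'I_n -> {mpoly k[n]}).
Definition follows (b : 'I_n -> U) := (forall i, ev (den i) b != 0) /\
  forall i, s (b i) = ev (num i) b / ev (den i) b.

(** The equations [s (b i) = num i b / den i b] eliminate every occurrence of
    [s] in a term. *)
Lemma term_value (a : 'I_n -> U) (t : dterm k n) : follows a -> exists N D : {mpoly k[n]},
  ev D a != 0 /\ forall b, follows b -> ev D b != 0 -> deval s iota b t = ev N b / ev D b.
Proof.
move=> fa; have evM (p q : {mpoly k[n]}) v : ev (p * q) v = ev p v * ev q v.
  by rewrite rmorphM mevalM.
have ev1 v : ev (1 : {mpoly k[n]}) v = 1 by rewrite (rmorph1 (map_mpoly iota)) meval1.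
elim: t => [i|c|||t [N1 [D1 [n1 e1]]] u [N2 [D2 [n2 e2]]]|t [N [D [nD e]]]
    |t [N1 [D1 [n1 e1]]] u [N2 [D2 [n2 e2]]]|t [N [D [nD e]]]].
- exists 'X_i, 1; split=> [|b _ _]; first by rewrite ev1 oner_neq0.
  by rewrite ev1 divr1 map_mpolyX mevalXU.
- exists c%:MP, 1; split=> [|b _ _]; first by rewrite ev1 oner_neq0.
  by rewrite ev1 divr1 map_mpolyC mevalC.
- exists 0, 1; split=> [|b _ _]; first by rewrite ev1 oner_neq0.
  by rewrite (rmorph0 (map_mpoly iota)) meval0 mul0r.
- by exists 1, 1; split=> [|b _ _]; rewrite ev1 ?oner_neq0 ?divr1.
- exists (N1 * D2 + N2 * D1), (D1 * D2); rewrite evM; split=> [|b fb]; first exact: mulf_neq0.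
  rewrite evM mulf_eq0 negb_or => /andP[m1 m2] /=; rewrite (e1 b fb m1) (e2 b fb m2).
  by rewrite (rmorphD (map_mpoly iota)) mevalD (evM N1) (evM N2) addf_div.
- exists (- N), D; split=> // b fb nb /=.
  by rewrite e // rmorphN mevalN mulNr.
- exists (N1 * N2), (D1 * D2); rewrite evM; split=> [|b fb]; first exact: mulf_neq0.
  rewrite evM mulf_eq0 negb_or => /andP[m1 m2] /=; rewrite (e1 b fb m1) (e2 b fb m2).
  by rewrite (evM N1) mulf_div.
- have [P1 [d1 h1]] := twist_clear num den N hs.
  have [P2 [d2 h2]] := twist_clear num den D hs.
  have evp v : ev (\prod_i den i) v = \prod_i ev (den i) v by apply: ev_prod.
  have evX d v : ev ((\prod_i den i) ^+ d) v = (\prod_i ev (den i) v) ^+ d.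
    by rewrite rmorphXn /= -evp; exact: rmorphXn.
  have nd b : follows b -> \prod_i ev (den i) b != 0.
    by move=> [hb _]; apply/prodf_neq0 => i _.
  exists (P1 * (\prod_i den i) ^+ d2), (P2 * (\prod_i den i) ^+ d1); split.
    rewrite evM evX; apply: mulf_neq0; last by apply: expf_neq0; apply: nd.
    case: (fa) => f1 f2; rewrite (h2 a a f1 f2); apply: mulf_neq0; first by rewrite fmorph_eq0.
    exact/expf_neq0/nd.
  move=> b fb; rewrite !evM !evX; case: (fb) => f1 f2; rewrite (h2 b b f1 f2) (h1 b b f1 f2).
  rewrite !mulf_eq0 !negb_or fmorph_eq0 => /andP[/andP[nb _] _] /=.
  rewrite e // fmorph_div; have nb' := nd b fb.
  have E1 : (\prod_i ev (den i) b) ^+ d1 != 0 by apply: expf_neq0.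
  have E2 : (\prod_i ev (den i) b) ^+ d2 != 0 by apply: expf_neq0.
  set x := _ ^+ d1 in E1 *; set y := _ ^+ d2 in E2 *.
  have E3 : s (ev D b) != 0 by rewrite fmorph_eq0.
  by rewrite -(mulrA (s _)) -(mulrA (s (ev D b))) (mulrC y) -mulf_div divff ?mulr1 ?mulf_neq0.
Qed.

(** By [term_value] atomic formulas reduce to polynomial equations over [k]. *)
Lemma same_ideal_qf (a b : 'I_n -> U) : follows a -> follows b ->
  (forall p, ev p a = 0 <-> ev p b = 0) ->
  forall f, qfree f -> (dholds s iota a f <-> dholds s iota b f).
Proof.
move=> fa fb hab f; apply: qf_atoms => t u.
have hn p : ev p a != 0 -> ev p b != 0 by apply: contra => /eqP/hab/eqP.
have [N1 [D1 [n1 e1]]] := term_value t fa.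
have [N2 [D2 [n2 e2]]] := term_value u fa.
have m1 := hn _ n1; have m2 := hn _ n2.
rewrite (e1 a fa n1) (e1 b fb m1) (e2 a fa n2) (e2 b fb m2).
have evE v : ev (N1 * D2 - N2 * D1) v = ev N1 v * ev D2 v - ev N2 v * ev D1 v.
  by rewrite (rmorphB (map_mpoly iota)) mevalB (evM _ N1) (evM _ N2).
split=> [/(div_eq_cross _ _ n1 n2) h|/(div_eq_cross _ _ m1 m2) h].
  by apply/(div_eq_cross _ _ m1 m2); rewrite -evE; apply/hab; rewrite evE.
by apply/(div_eq_cross _ _ n1 n2); rewrite -evE; apply/hab; rewrite evE.
Qed.

End Isolation.

(** The isolating formula says of [b] that it satisfies the equations of [a]
    over [k], that it follows the dynamics of [q], and that [h b <> 0] for the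
    polynomial [h] of [invariant_sets_dense]. The locus of such a [b] is irreducible and
    invariant and has points with [h <> 0], so it is dense in the locus of [a]:
    the two tuples have the same ideal. *)
Theorem rational_isolated (kappa : Type) n (q : dform k n -> Prop) :
  complete_qf_type s iota q -> rational_type s iota q -> qf_internal s iota kappa q ->
  weakly_orthogonal s iota q -> qf_isolated s iota q.
Proof.
move=> [qqf _ qdec] [num [den hq]] hint [a [ra horth]].
have [K [dK kK _ indK [m [c0 [hc0 hac0]]]]] := hint a ra.
have hK := diff_subfield_sf dK.
have fa : follows num den a by split=> i; case: (hq a ra i).
have [hden hsa] := fa.
have sK x : K x -> K (s x) by case: dK => _ _ _; apply.
have [h [nh hcore]] := invariant_sets_dense chU comm inversive hden hsa hK sK kK hc0
  (internal_fgen dK hc0 hac0) (disjoint_specialise hK kK indK) (orthogonal_fixed horth).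
have [l [hl1 hl2]] := hilbert_zeros (fun p : {mpoly k[n]} => ev p a = 0).
have /choice_fun [T hT] := @term_of_mpoly k U s iota n.
have [f1 [qf1 e1]] := @conjunction k U s iota n 'I_(size l)
  (fun i => DEq (T (nth 0 l i)) (DZero _ _)) (fun=> isT).
have [f2 [qf2 e2]] := @conjunction k U s iota n 'I_n
  (fun i => DAnd (DNot (DEq (T (den i)) (DZero _ _)))
    (DEq (DMul (DSig (DVar _ i)) (T (den i))) (T (num i)))) (fun=> isT).
pose f := DAnd f1 (DAnd f2 (DNot (DEq (T h) (DZero _ _)))).
have qff : qfree f by rewrite /= qf1 qf2.
have fE b : dholds s iota b f <-> [/\ forall p, p \in l -> ev p b = 0, follows num den b & ev h b != 0].
  split=> [[/e1 h1 [/e2 h2 h3]]|[h1 [h2 h3] h4]] /=.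
    split.
    - move=> p hp; have := h1 (Ordinal (etrans (index_mem p l) hp)).
      by rewrite /= hT nth_index.
    - split=> i; have [/= n1 n2] := h2 i; rewrite !hT in n1 n2; first exact/eqP.
      by rewrite -n2 mulfK //; apply/eqP.
    - by apply/eqP; move: h3 => /=; rewrite hT.
  split; first by apply/e1 => i /=; rewrite hT; apply: h1; apply: mem_nth.
  split; last by rewrite hT; apply/eqP.
  apply/e2 => i; split=> /=; rewrite !hT; first exact/eqP/h2.
  by rewrite h3 divfK.
have faf : dholds s iota a f by apply/fE; split=> // p /hl1.
exists f; split=> //.
  by have [//|/ra] := qdec f qff; move=> /(_ faf).
move=> b /fE [hb1 fb hb2] g qg.
have [dfb sfb] := fb.
pose X (x : 'I_n -> k) := locus iota b x.
have XL x : X x -> locus iota a x.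
  by move=> hx; apply: hl2 => p hp; apply: hx; apply: hb1.
have irrX : irreducible_set X.
  move=> p1 p2 x1 x2 h1 h2 n1 n2.
  have nb (p : {mpoly k[n]}) x : X x -> p.@[x] != 0 -> ev p b != 0.
    by move=> hx; apply: contra => /eqP/hx ->.
  have [|x [hx]] := @k_points n b (p1 * p2).
    by rewrite rmorphM mevalM; apply: mulf_neq0; [apply: nb n1|apply: nb n2].
  by rewrite mevalM mulf_eq0 negb_or => /andP[? ?]; exists x.
have invX : invariant_set sk num den X.
  move=> x x1 hx dx ex1 p pb.
  have [P [d hP]] := twist_clear num den p hs.
  have dx' i : ev (den i) (io x) != 0 by rewrite meval_map fmorph_eq0.
  have Pb : ev P b = 0 by rewrite (hP b b) // pb rmorph0 mul0r.
  have := hP (io x) (io x1) dx' (fun i => _).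
  move=> H; have /eqP : ev P (io x) = 0 by rewrite meval_map hx // rmorph0.
  rewrite H; last by move=> i; rewrite -comm ex1 fmorph_div !meval_map.
  rewrite mulf_eq0 expf_eq0 => /orP[|/andP[_ /prodf_eq0 [i _]]]; last by rewrite (negPf (dx' i)).
  by rewrite meval_map !fmorph_eq0 => /eqP.
have neX : exists x, X x /\ h.@[x] != 0 by apply: k_points.
have hX := hcore X XL irrX invX neX.
have hab p : ev p a = 0 <-> ev p b = 0.
  split=> [pa|pb]; last by apply: hX => x hx; apply: hx.
  apply: NNPP => /eqP /k_points [x [hx]]; rewrite XL ?eqxx //.
have qfg := qqf g qg.
by apply/(same_ideal_qf fa fb hab qfg); apply: ra.
Qed.

End RationalTypes.

(** * Zariski topology and rational maps *)

Section RationalTuples.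
Variable k : fieldType.

Lemma fdef_prod m n (den : 'I_n -> {mpoly k[m]}) v :
  fdef den v <-> (\prod_i den i).@[v] != 0.
Proof.
rewrite meval_prodr; split=> [h|/prodf_neq0 h i]; last exact: h.
by apply/prodf_neq0 => i _.
Qed.

Lemma mpoly_clear m n (p : {mpoly k[n]}) (num den : 'I_n -> {mpoly k[m]}) :
  exists (P : {mpoly k[m]}) d, forall v, fdef den v ->
    P.@[v] = p.@[fval num den v] * (\prod_i (den i).@[v]) ^+ d.
Proof.
have hT : subring (fun _ : k => True) by [].
have hp l (q : {mpoly k[l]}) : polyfun (fun _ => True) (fun v => q.@[v]).
  suff -> : (fun v => q.@[v]) = (fun v => \sum_(m <- msupp q) q@_m * \prod_i v i ^+ m i).
    apply: polyfun_sum => // mm _; apply: PfM; first exact: PfC.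
    by apply: polyfun_prod => // i _; apply: polyfun_exp => //; apply: PfX.
  by apply: functional_extensionality => v; rewrite mevalE.
have [P [d [hP eP]]] := polyfun_clear hT (hp _ p) (fun i => hp _ (num i)) (fun i => hp _ (den i)).
by have [P' [_ e]] := mpoly_over_of_polyfun hT hP; exists P', d => v hv; rewrite -e eP.
Qed.

Lemma pullback m n (p : {mpoly k[n]}) (num den : 'I_n -> {mpoly k[m]}) :
  exists P : {mpoly k[m]}, forall v,
    P.@[v] != 0 <-> fdef den v /\ p.@[fval num den v] != 0.
Proof.
have [P [d hP]] := mpoly_clear p num den.
exists (P * \prod_i den i) => v; rewrite mevalM mulf_eq0 negb_or; split.
  move=> /andP[h1 h2]; have hv : fdef den v by apply/fdef_prod.
  by split=> //; move: h1; rewrite hP // mulf_eq0 negb_or => /andP[].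
move=> [hv h]; have /fdef_prod hv' := hv; rewrite hv' hP // andbT mulf_neq0 // expf_neq0 //.
by move: hv'; rewrite meval_prodr.
Qed.

Lemma compose m n l (num1 den1 : 'I_n -> {mpoly k[m]}) (num2 den2 : 'I_l -> {mpoly k[n]}) :
  exists num3 den3 : 'I_l -> {mpoly k[m]}, forall v, fdef den1 v ->
    fdef den2 (fval num1 den1 v) ->
    fdef den3 v /\ fval num3 den3 v = fval num2 den2 (fval num1 den1 v).
Proof.
have /choice_fun [F hF] : forall i, exists F : {mpoly k[m]} * {mpoly k[m]}, forall v, fdef den1 v ->
    (den2 i).@[fval num1 den1 v] != 0 ->
    F.2.@[v] != 0 /\ F.1.@[v] / F.2.@[v] = (num2 i).@[fval num1 den1 v] / (den2 i).@[fval num1 den1 v].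
  move=> i; have [P [d hP]] := mpoly_clear (num2 i) num1 den1.
  have [Q [e hQ]] := mpoly_clear (den2 i) num1 den1.
  exists (P * (\prod_i den1 i) ^+ e, Q * (\prod_i den1 i) ^+ d) => v hv h2 /=.
  have nz : \prod_i (den1 i).@[v] != 0 by rewrite -meval_prodr; apply/fdef_prod.
  rewrite !mevalM !rmorphXn /= !meval_prodr hP // hQ //.
  set x := \prod_i _ in nz *; have nx r : x ^+ r != 0 by apply: expf_neq0.
  split; first by rewrite !mulf_neq0.
  by field; rewrite h2 !nx.
exists (fun i => (F i).1), (fun i => (F i).2) => v h1 h2; split=> [i|].
  by case: (hF i v h1 (h2 i)).
by apply: functional_extensionality => i; rewrite /fval; case: (hF i v h1 (h2 i)).
Qed.

End RationalTuples.

Section Points.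
Variables (k : fieldType) (V : atlas k).
Hypothesis hV : is_variety V.

Lemma ptE (x : pt V) : mkpt (i := tag x) (tagged x) = x.
Proof. by case: x. Qed.

Lemma same_on1 (x y : pt V) : same x y -> onv x. Proof. by case. Qed.
Lemma same_on2 (x y : pt V) : same x y -> onv y. Proof. by case. Qed.

Lemma same_refl (x : pt V) : onv x -> same x x.
Proof. by case: hV => h _ _ _ ox; rewrite -(ptE x); apply/h; split=> //; rewrite ptE. Qed.
Lemma same_sym (x y : pt V) : same x y -> same y x. Proof. by case: hV => _ h _ _; apply: h. Qed.
Lemma same_trans (y x z : pt V) : same x y -> same y z -> same x z.
Proof. by case: hV => _ _ h _; apply: h. Qed.
Lemma same_chart (i : chart V) v w : same (mkpt (i := i) v) (mkpt (i := i) w) -> v = w.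
Proof. by case: hV => h _ _ _ /h [_ e]; apply: functional_extensionality. Qed.
Lemma transition (x y : pt V) : same x y ->
  exists num den : 'I_(adim (tag y)) -> {mpoly k[adim (tag x)]},
    [/\ fdef den (tagged x), fval num den (tagged x) = tagged y &
      forall v, onv (mkpt (i := tag x) v) -> fdef den v ->
        same (mkpt (i := tag x) v) (mkpt (i := tag y) (fval num den v))].
Proof.
move=> sxy; case: (hV) => _ _ _ /(_ x y sxy) [num [den [h1 h2]]].
exists num, den; split=> //; apply: (@same_chart (tag y)).
have := h2 (tagged x); rewrite !ptE => h; apply: (same_trans _ sxy).
by apply: same_sym; apply: h => //; apply: same_on1 sxy.
Qed.

(** Openness is tested with principal neighbourhoods in the chart presenting the
    point, so that no equations of the complement are needed. *)
Definition is_open (O : pt V -> Prop) :=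
  [/\ forall x, O x -> onv x, forall x y, same x y -> O x -> O y
    & forall x, O x -> exists P : {mpoly k[adim (tag x)]}, P.@[tagged x] != 0 /\
        forall v, onv (mkpt (i := tag x) v) -> P.@[v] != 0 -> O (mkpt (i := tag x) v)].

(** Irreducibility for open sets: unlike the form with closed sets, it passes
    to products by an elementary argument. *)
Definition dense_opens := forall O1 O2 : pt V -> Prop, is_open O1 -> is_open O2 ->
  (exists x, O1 x) -> (exists x, O2 x) -> exists x, O1 x /\ O2 x.

Lemma open_onv : is_open (fun x => onv x).
Proof.
split=> [//|x y s _|x ox]; first exact: same_on2 s.
by exists 1; rewrite meval1 oner_neq0.
Qed.

(** By [hilbert_zeros] finitely many equations suffice in each chart. *)
Lemma closed_of_set (S : pt V -> Prop) :
  (forall x, S x -> onv x) -> (forall x y, same x y -> S x -> S y) ->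
  (forall x, onv x -> ~ S x -> exists P : {mpoly k[adim (tag x)]}, P.@[tagged x] != 0 /\
     forall v, S (mkpt (i := tag x) v) -> P.@[v] = 0) ->
  exists C : closed_data V, is_closed C /\ forall x, inC C x <-> S x.
Proof.
move=> Son Ssat Scl.
have /choice_fun [C hC] : forall i : chart V, exists l : seq {mpoly k[adim i]},
    (forall p, p \in l -> forall v, S (mkpt (i := i) v) -> p.@[v] = 0) /\
    forall v, (forall p, p \in l -> p.@[v] = 0) -> forall p : {mpoly k[adim i]},
      (forall v, S (mkpt (i := i) v) -> p.@[v] = 0) -> p.@[v] = 0.
  by move=> i; apply: (hilbert_zeros (fun p => forall v, S (mkpt (i := i) v) -> p.@[v] = 0)).
have CE x : inC C x <-> S x.
  split=> [[ox zx]|Sx].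
    apply: NNPP => /(Scl x ox) [P [nP hP]]; case/eqP: nP.
    by have [_ h] := hC (tag x); apply: (h (tagged x) zx P hP).
  split; first exact: Son.
  move=> p hp; have [h _] := hC (tag x); apply: (h p hp (tagged x)); by rewrite ptE.
exists C; split=> // x y s /CE Sx; apply/CE; exact: Ssat Sx.
Qed.

Lemma irreducible_dense : irreducible V -> dense_opens.
Proof.
move=> [_ hirr] O1 O2 h1 h2 [x1 o1] [x2 o2]; apply: NNPP => hno.
have cl O : is_open O -> exists C : closed_data V, is_closed C /\ forall x, inC C x <-> onv x /\ ~ O x.
  move=> [a b c]; apply: closed_of_set => [x []//|x y s [ox nx]|x ox nx].
    by split; [apply: same_on2 s|move=> /(b _ _ (same_sym s))].
  have Ox : O x by apply: NNPP => h; apply: nx.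
  have [P [nP hP]] := c x Ox; exists P; split=> // v [ov nv].
  by apply/eqP/negPn/negP => /(hP v ov).
have [C1 [c1 e1]] := cl _ h1; have [C2 [c2 e2]] := cl _ h2.
have [|h|h] := hirr C1 C2 c1 c2.
- move=> x ox; have [o|o] := classic (O1 x); last by left; apply/e1.
  by right; apply/e2; split=> // o'; apply: hno; exists x.
- by case: h1 => a _ _; have /e1 [_] := h x1 (a _ o1).
- by case: h2 => a _ _; have /e2 [_] := h x2 (a _ o2).
Qed.

(** The saturation of an open set of one chart is open because the transition
    maps are regular. *)
Lemma chart_open (i : chart V) (A : ('I_(adim i) -> k) -> Prop) :
  (forall v, onv (mkpt (i := i) v) -> A v -> exists P : {mpoly k[adim i]}, P.@[v] != 0 /\
     forall w, onv (mkpt (i := i) w) -> P.@[w] != 0 -> A w) ->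
  is_open (fun x => exists v, same x (mkpt (i := i) v) /\ A v).
Proof.
move=> hA; split=> [x [v [/same_on1 //]]|x y s [v [s' Av]]|x [v [s Av]]].
  by exists v; split=> //; apply: same_trans s'; apply: same_sym.
have [num [den [d1 d2 d3]]] := transition s.
have [P [nP hP]] := hA v (same_on2 s) Av.
have [P' hP'] := pullback P num den.
exists P'; split; first by apply/hP'; split=> //; rewrite d2.
move=> w ow /hP' [dw nw]; have sw := d3 w ow dw.
by exists (fval num den w); split=> //; apply: hP => //; apply: same_on2 sw.
Qed.

Lemma basic_open (i : chart V) (P : {mpoly k[adim i]}) :
  is_open (fun x => exists v, same x (mkpt (i := i) v) /\ P.@[v] != 0).
Proof. by apply: chart_open => v _ nv; exists P. Qed.

End Points.

(** ** Locally rational correspondences *)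

Section LocRat.
Variable k : fieldType.

(** Correspondences that locally are graphs of tuples of rational functions.
    Rational maps on their full domain of definition and composites of them are
    of this kind; density and extension arguments are carried out for all of
    them at once, and composites need not be presented by formulas. *)
Record locrat (V W : atlas k) (R : pt V -> pt W -> Prop) : Prop := Locrat {
  lr_on1 : forall x y, R x y -> onv x;
  lr_on2 : forall x y, R x y -> onv y;
  lr_sat1 : forall x x' y, same x x' -> R x y -> R x' y;
  lr_sat2 : forall x y y', same y y' -> R x y -> R x y';
  lr_loc : forall x y, R x y ->
    exists (j : chart W) (num den : 'I_(adim j) -> {mpoly k[adim (tag x)]}) (P : {mpoly k[adim (tag x)]}),
    [/\ P.@[tagged x] != 0, same y (mkpt (i := j) (fval num den (tagged x)))
      & forall v, onv (mkpt (i := tag x) v) -> P.@[v] != 0 ->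
          fdef den v /\ R (mkpt (i := tag x) v) (mkpt (i := j) (fval num den v))] }.

Lemma locrat_open (V W : atlas k) (R : pt V -> pt W -> Prop) (O : pt W -> Prop) :
  locrat R -> is_open O -> is_open (fun x => exists y, R x y /\ O y).
Proof.
move=> hR [a b c]; split=> [x [y [/(lr_on1 hR) //]]|x x' s [y [h o]]|x [y [h o]]].
  by exists y; split=> //; apply: (lr_sat1 hR) h.
have [j [num [den [P [nP s hP]]]]] := lr_loc hR h.
have o' := b _ _ s o; have [Q [nQ hQ]] := c _ o'.
have [Q' hQ'] := pullback Q num den.
have ox : onv (mkpt (i := tag x) (tagged x)) by rewrite ptE; apply: (lr_on1 hR) h.
have [dx Rx] := hP _ ox nP.
exists (P * Q'); rewrite mevalM mulf_neq0 //; last by apply/hQ'.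
split=> // v ov; rewrite mevalM mulf_eq0 negb_or => /andP[nv /hQ' [dv nv']].
have [_ Rv] := hP v ov nv.
exists (mkpt (i := j) (fval num den v)); split=> //.
by apply: hQ => //; apply: (lr_on2 hR) Rv.
Qed.

Lemma locrat_comp (A B C : atlas k) (R : pt A -> pt B -> Prop) (S : pt B -> pt C -> Prop) :
  locrat R -> locrat S -> locrat (rcomp R S).
Proof.
move=> hR hS; split.
- by move=> x z [y [/(lr_on1 hR)]].
- by move=> x z [y [_ /(lr_on2 hS)]].
- by move=> x x' z s [y [h1 h2]]; exists y; split=> //; apply: (lr_sat1 hR) h1.
- by move=> x z z' s [y [h1 h2]]; exists y; split=> //; apply: (lr_sat2 hS) h2.
move=> x z [y [h1 h2]].
have [j [num1 [den1 [P1 [n1 s1 p1]]]]] := lr_loc hR h1.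
have h2' := lr_sat1 hS s1 h2.
have [l [num2 [den2 [P2 [n2 s2 p2]]]]] := lr_loc hS h2'.
have [num3 [den3 h3]] := compose num1 den1 num2 den2.
have [Q hQ] := pullback P2 num1 den1.
have ox : onv (mkpt (i := tag x) (tagged x)) by rewrite ptE; apply: (lr_on1 hR) h1.
have key v : onv (mkpt (i := tag x) v) -> P1.@[v] != 0 -> Q.@[v] != 0 ->
   [/\ fdef den3 v, fval num3 den3 v = fval num2 den2 (fval num1 den1 v)
     & rcomp R S (mkpt (i := tag x) v) (mkpt (i := l) (fval num3 den3 v))].
  move=> ov nv /hQ [dv nv2]; have [_ Rv] := p1 v ov nv.
  have ov' := lr_on2 hR Rv; have [dv2 Sv] := p2 _ ov' nv2.
  have [d3 e3] := h3 v dv dv2; split=> //; rewrite e3.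
  by exists (mkpt (i := j) (fval num1 den1 v)).
have nQ : Q.@[tagged x] != 0 by apply/hQ; split=> //; case: (p1 _ ox n1).
have [d e _] := key _ ox n1 nQ.
exists l, num3, den3, (P1 * Q); split; first by rewrite mevalM mulf_neq0.
  by rewrite e.
move=> v ov; rewrite mevalM mulf_eq0 negb_or => /andP[nv1 nv2].
by have [] := key v ov nv1 nv2.
Qed.

Lemma locrat_pval (V W : atlas k) (g : ratmap V W) : is_variety V -> is_variety W ->
  is_ratmap g -> locrat (pval g).
Proof.
move=> hV hW [_ hg]; split.
- by move=> x y [v [/same_on1]].
- by move=> x y [v [_ _ /same_on1]].
- move=> x x' y s [v [h1 h2 h3]]; exists v; split=> //.
  by apply: same_trans h1 => //; apply: same_sym.
- move=> x y y' s [v [h1 h2 h3]]; exists v; split=> //.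
  by apply: same_trans h3 => //; apply: same_sym.
move=> x y [v [s1 d1 s2]].
have [num [den [t1 t2 t3]]] := transition hV s1.
have [num3 [den3 h3]] := compose num den (@rnum _ _ _ g) (@rden _ _ _ g).
have [Q hQ] := pullback (\prod_i rden (r := g) i) num den.
have nQ : Q.@[tagged x] != 0 by apply/hQ; split=> //; apply/fdef_prod; rewrite t2.
exists (rtgt g), num3, den3, Q; split=> //.
  by have [|_ ->] := h3 _ t1; rewrite t2.
move=> w ow /hQ [dw /fdef_prod dw2]; have sw := t3 w ow dw.
have [d3 e3] := h3 w dw dw2; split=> //.
exists (fval num den w); split=> //; rewrite e3.
by apply: same_refl => //; apply: hg => //; apply: same_on2 sw.
Qed.

Lemma locrat_rval (V W : atlas k) (f : ratmap V W) : is_variety V -> is_variety W ->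
  locrat (rval f).
Proof.
move=> hV hW; split.
- by move=> x y [g [hg _ h]]; apply: (lr_on1 (locrat_pval hV hW hg)) h.
- by move=> x y [g [hg _ h]]; apply: (lr_on2 (locrat_pval hV hW hg)) h.
- by move=> x x' y s [g [hg e h]]; exists g; split=> //; apply: (lr_sat1 (locrat_pval hV hW hg)) h.
- by move=> x y y' s [g [hg e h]]; exists g; split=> //; apply: (lr_sat2 (locrat_pval hV hW hg)) h.
move=> x y [g [hg e h]].
have [j [num [den [P [n s p]]]]] := lr_loc (locrat_pval hV hW hg) h.
exists j, num, den, P; split=> // v ov nv; have [d pv] := p v ov nv.
by split=> //; exists g.
Qed.

(** Varieties are separated, so that disagreement at a point spreads to a
    neighbourhood of it; this neighbourhood would meet [O]. *)
Lemma locrat_agree (V W : atlas k) (R S : pt V -> pt W -> Prop) (O : pt V -> Prop) :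
  is_variety V -> is_variety W -> dense_opens V -> locrat R -> locrat S ->
  is_open O -> (exists x, O x) ->
  (forall x y y', O x -> R x y -> S x y' -> same y y') ->
  forall x y y', R x y -> S x y' -> same y y'.
Proof.
move=> hV hW dV hR hS hO neO hRS x y y' Rx Sx; apply: NNPP => nsame.
have ox : onv (mkpt (i := tag x) (tagged x)) by rewrite ptE; apply: (lr_on1 hR) Rx.
have [j1 [num1 [den1 [P1 [n1 s1 p1]]]]] := lr_loc hR Rx.
have [j2 [num2 [den2 [P2 [n2 s2 p2]]]]] := lr_loc hS Sx.
have [d1 _] := p1 _ ox n1; have [d2 _] := p2 _ ox n2.
pose f1 v := mkpt (i := j1) (fval num1 den1 v).
pose f2 v := mkpt (i := j2) (fval num2 den2 v).
have [p [hp np]] : exists p, p \in aglue j1 j2 /\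
    p.@[vcat (fval num1 den1 (tagged x)) (fval num2 den2 (tagged x))] != 0.
  apply: NNPP => h; apply: nsame; apply: (same_trans hW s1).
  apply: (same_sym hW); apply: (same_trans hW s2); apply: (same_sym hW).
  split; [exact: same_on2 s1|exact: same_on2 s2|].
  by move=> p hp; apply/eqP/negPn/negP => np; apply: h; exists p.
pose num := vcat num1 num2; pose den := vcat den1 den2.
have ev v : fval num den v = vcat (fval num1 den1 v) (fval num2 den2 v).
  by apply: functional_extensionality => i; rewrite /fval /num /den /vcat; case: split.
have [Q hQ] := pullback p num den.
have hB := basic_open hV (P1 * P2 * Q).
have [|z [Oz [v [sv nv]]]] := dV _ _ hO hB neO.
  exists x, (tagged x); rewrite ptE; split; first by apply: same_refl => //; move: ox; rewrite ptE.
  rewrite !mevalM !mulf_neq0 //; apply/hQ; rewrite ev; split=> // i.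
  by rewrite /den /vcat; case: split => j; [apply: d1|apply: d2].
move: nv; rewrite !mevalM !mulf_eq0 !negb_or => /andP[/andP[m1 m2] /hQ [_]].
rewrite ev; have ov := same_on2 sv.
have [_ Rv] := p1 v ov m1; have [_ Sv] := p2 v ov m2.
have [_ _ /(_ p hp) ->] := hRS z _ _ Oz (lr_sat1 hR (same_sym hV sv) Rv) (lr_sat1 hS (same_sym hV sv) Sv).
by rewrite eqxx.
Qed.

(** The local presentation near [v0] may use another chart of the target than
    [j]: it is composed with the transition map between the two. *)
Lemma locrat_chart (V W : atlas k) (R : pt V -> pt W -> Prop) (i : chart V) (j : chart W) v0 w0 :
  is_variety W -> locrat R -> R (mkpt (i := i) v0) (mkpt (i := j) w0) ->
  exists (num den : 'I_(adim j) -> {mpoly k[adim i]}) (Q : {mpoly k[adim i]}),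
    Q.@[v0] != 0 /\ forall v, onv (mkpt (i := i) v) -> Q.@[v] != 0 ->
      fdef den v /\ R (mkpt (i := i) v) (mkpt (i := j) (fval num den v)).
Proof.
move=> hW hR R0.
have [l [num1 [den1 [P1 [/= n1 s1 p1]]]]] := lr_loc hR R0.
have [num2 [den2 [/= t1 t2 t3]]] := transition hW (same_sym hW s1).
have [num3 [den3 h3]] := compose num1 den1 num2 den2.
have [Q hQ] := pullback (\prod_i den2 i) num1 den1.
have o0 := lr_on1 hR R0; have [d0 _] := p1 _ o0 n1.
exists num3, den3, (P1 * Q); split.
  by rewrite mevalM mulf_neq0 //; apply/hQ; split=> //; exact/fdef_prod.
move=> v ov; rewrite mevalM mulf_eq0 negb_or => /andP[m1 /hQ [dv /fdef_prod dv2]].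
have [_ Rv] := p1 v ov m1; have sv := t3 _ (lr_on2 hR Rv) dv2.
have [d3 e3] := h3 v dv dv2; split=> //; rewrite e3.
exact: (lr_sat2 hR) sv Rv.
Qed.

(** By density the domain contains a point of the chart [i] whose value lies in
    the chart [j]. *)
Lemma locrat_extract (V W : atlas k) (R : pt V -> pt W -> Prop) (i : chart V) (j : chart W) :
  is_variety V -> is_variety W -> dense_opens V -> locrat R ->
  (exists v, onv (mkpt (i := i) v)) -> (exists x w, R x (mkpt (i := j) w)) ->
  exists (num den : 'I_(adim j) -> {mpoly k[adim i]}) (Q : {mpoly k[adim i]}),
    (exists v, onv (mkpt (i := i) v) /\ Q.@[v] != 0) /\
    forall v, onv (mkpt (i := i) v) -> Q.@[v] != 0 ->
      fdef den v /\ R (mkpt (i := i) v) (mkpt (i := j) (fval num den v)).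
Proof.
move=> hV hW dV hR [v1 ov1] [x [w Rx]].
have hj := basic_open hW (1 : {mpoly k[adim j]}).
have hi := basic_open hV (1 : {mpoly k[adim i]}).
have [||z [[y [Rz [w0 [sw _]]]] [v0 [sz _]]]] := dV _ _ (locrat_open hR hj) hi.
- exists x, (mkpt (i := j) w); split=> //; exists w; rewrite meval1 oner_neq0; split=> //.
  by apply: same_refl => //; apply: (lr_on2 hR) Rx.
- by exists (mkpt (i := i) v1), v1; rewrite meval1 oner_neq0; split=> //; apply: same_refl.
have R0 : R (mkpt (i := i) v0) (mkpt (i := j) w0).
  by apply: (lr_sat2 hR) sw _; apply: (lr_sat1 hR) Rz.
have [num [den [Q [nQ hQ]]]] := locrat_chart hW hR R0.
by exists num, den, Q; split=> //; exists v0; split=> //; apply: (lr_on1 hR) R0.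
Qed.

Lemma pval_functional (V W : atlas k) (f : ratmap V W) : is_variety V -> is_variety W ->
  rat_equiv f f.
Proof.
move=> hV hW x y y' [v [s1 _ t1]] [w [s2 _ t2]].
have e := same_chart hV (same_trans hV (same_sym hV s1) s2); rewrite -e in t2.
exact: same_trans t1 (same_sym hW t2).
Qed.

(** All presentations agree with [f] itself where [f] is defined as it stands,
    which is a dense open set. *)
Lemma rval_functional (V W : atlas k) (f : ratmap V W) :
  is_variety V -> is_variety W -> dense_opens V -> is_ratmap f ->
  forall x y y', rval f x y -> rval f x y' -> same y y'.
Proof.
move=> hV hW dV hf; have hR := locrat_rval f hV hW; have hp := locrat_pval hV hW hf.
have hO : is_open (fun x => exists y, pval f x y /\ onv y).
  by apply: locrat_open => //; apply: open_onv.
apply: (locrat_agree hV hW dV hR hR hO).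
  have [[v [ov dv]] h] := hf; exists (mkpt v), (mkpt (fval (@rnum _ _ _ f) (@rden _ _ _ f) v)).
  have ow := h v ov dv; split=> //; exists v.
  by split=> //; apply: same_refl.
move=> x y y' [y0 [p0 _]] [g [_ e p]] [g' [_ e' p']].
exact: same_trans (same_sym hW (e _ _ _ p0 p)) (e' _ _ _ p0 p').
Qed.

(** Otherwise the image would lie in the complement of [O]. *)
Lemma dominant_open (V W : atlas k) (f : ratmap V W) (O : pt W -> Prop) :
  is_variety W -> dominant f -> is_open O -> (exists y, O y) ->
  exists x y, rval f x y /\ O y.
Proof.
move=> hW hf hO [y0 Oy0]; apply: NNPP => hno; have [a b c] := hO.
have [||| C [hC eC]] := @closed_of_set k W (fun y => onv y /\ ~ O y).
- by move=> x [].
- move=> x y s [ox nx]; split; first exact: same_on2 s.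
  by move/(b _ _ (same_sym hW s)).
- move=> x ox nx; have Ox : O x by apply: NNPP => h; apply: nx.
  have [P [nP hP]] := c x Ox; exists P; split=> // v [ov nv].
  by apply/eqP/negPn/negP => /(hP v ov).
have H y : onv y -> inC C y.
  apply: hf => // x {}y r; apply/eC; split; last by move=> Oy; apply: hno; exists x, y.
  by case: r => g [_ _ [v [_ _ /same_on1]]].
by have /eC [_] := H y0 (a _ Oy0).
Qed.

(** Principal open subsets of a chart are open in the variety, hence meet. *)
Lemma chart_irreducible (V : atlas k) (i : chart V) : is_variety V -> dense_opens V ->
  irreducible_set (fun v => onv (mkpt (i := i) v)).
Proof.
move=> hV dV p1 p2 x1 x2 o1 o2 n1 n2.
have [||x [[v [s1 m1]] [w [s2 m2]]]] := dV _ _ (basic_open hV p1) (basic_open hV p2).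
- by exists (mkpt x1), x1; split=> //; apply: same_refl.
- by exists (mkpt x2), x2; split=> //; apply: same_refl.
have e := same_chart hV (same_trans hV (same_sym hV s1) s2).
by exists v; split=> //; [apply: same_on2 s1|rewrite e].
Qed.

End LocRat.

(** * Constructions of varieties *)

Section Zeros.
Variable k : fieldType.

Lemma zeros_cat n (E F : seq {mpoly k[n]}) v : zeros (E ++ F) v <-> zeros E v /\ zeros F v.
Proof.
split=> [h|[h1 h2] p]; first by split=> p hp; apply: h; rewrite mem_cat hp ?orbT.
by rewrite mem_cat => /orP[/h1|/h2].
Qed.

Lemma meval_mren m n (f : 'I_m -> 'I_n) (p : {mpoly k[m]}) v :
  (mren f p).@[v] = p.@[fun i => v (f i)].
Proof.
rewrite /mren comp_mpoly_meval; apply: meval_eq => i.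
by rewrite tnth_mktuple mevalXU.
Qed.

Lemma zeros_mren m n (f : 'I_m -> 'I_n) (E : seq {mpoly k[m]}) v :
  zeros (map (mren f) E) v <-> zeros E (fun i => v (f i)).
Proof.
split=> [h p hp|h _ /mapP[p hp ->]]; last by rewrite meval_mren; apply: h.
by rewrite -meval_mren; apply: h; apply: map_f.
Qed.

Lemma vcat_l (T : Type) m n (v : 'I_m -> T) (w : 'I_n -> T) a : vcat v w (lshift n a) = v a.
Proof. by rewrite /vcat; have -> : split (lshift n a) = inl a := unsplitK (inl a). Qed.
Lemma vcat_r (T : Type) m n (v : 'I_m -> T) (w : 'I_n -> T) b : vcat v w (rshift m b) = w b.
Proof. by rewrite /vcat; have -> : split (rshift m b) = inr b := unsplitK (inr b). Qed.
Lemma vcat_eta (T : Type) m n (v : 'I_(m + n) -> T) :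
  vcat (fun a => v (lshift n a)) (fun b => v (rshift m b)) = v.
Proof.
apply: functional_extensionality => i; rewrite /vcat; case: splitP => j e; congr v; exact: val_inj.
Qed.
Lemma vcat_comp (S T : Type) m n (f : S -> T) (v : 'I_m -> S) (w : 'I_n -> S) i :
  f (vcat v w i) = vcat (fun a => f (v a)) (fun b => f (w b)) i.
Proof. by rewrite /vcat; case: split. Qed.
Lemma vcat_vcat (T : Type) m n m' n' (f : 'I_m -> 'I_m') (g : 'I_n -> 'I_n') (v : 'I_m' -> T) (w : 'I_n' -> T) :
  (fun i => vcat v w (vcat (fun a => lshift _ (f a)) (fun b => rshift _ (g b)) i))
  = vcat (fun a => v (f a)) (fun b => w (g b)).
Proof.
apply: functional_extensionality => i; rewrite [X in vcat v w X]/vcat [RHS]/vcat.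
by case: (split i) => a; rewrite ?vcat_l ?vcat_r.
Qed.
Lemma vcat_forall (T : Type) m n (P : T -> Prop) (v : 'I_m -> T) (w : 'I_n -> T) :
  (forall a, P (v a)) -> (forall b, P (w b)) -> forall i, P (vcat v w i).
Proof. by move=> h1 h2 i; rewrite /vcat; case: split. Qed.

Lemma fval_mren_l m n m' (num den : 'I_n -> {mpoly k[m]}) v :
  fval (fun a => mren (@lshift m m') (num a)) (fun a => mren (@lshift m m') (den a)) v
  = fval num den (fun a => v (lshift _ a)).
Proof. by apply: functional_extensionality => a; rewrite /fval !meval_mren. Qed.
Lemma fval_mren_r m n m' (num den : 'I_n -> {mpoly k[m]}) v :
  fval (fun a => mren (@rshift m' m) (num a)) (fun a => mren (@rshift m' m) (den a)) v
  = fval num den (fun a => v (rshift _ a)).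
Proof. by apply: functional_extensionality => a; rewrite /fval !meval_mren. Qed.
Lemma fval_vcat m n1 n2 (num1 den1 : 'I_n1 -> {mpoly k[m]}) (num2 den2 : 'I_n2 -> {mpoly k[m]}) v :
  fval (vcat num1 num2) (vcat den1 den2) v = vcat (fval num1 den1 v) (fval num2 den2 v).
Proof. by apply: functional_extensionality => i; rewrite /fval /vcat; case: split. Qed.
Lemma fdef_vcat m n1 n2 (den1 : 'I_n1 -> {mpoly k[m]}) (den2 : 'I_n2 -> {mpoly k[m]}) v :
  fdef (vcat den1 den2) v <-> fdef den1 v /\ fdef den2 v.
Proof.
split=> [h|[h1 h2]]; last exact: (vcat_forall (P := fun p : {mpoly k[m]} => p.@[v] != 0)).
by split=> i; [have := h (lshift _ i); rewrite vcat_l|have := h (rshift _ i); rewrite vcat_r].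
Qed.
Lemma fdef_mren_l m n m' (den : 'I_n -> {mpoly k[m]}) v :
  fdef (fun a => mren (@lshift m m') (den a)) v <-> fdef den (fun a => v (lshift _ a)).
Proof. by split=> h i; have := h i; rewrite meval_mren. Qed.
Lemma fdef_mren_r m n m' (den : 'I_n -> {mpoly k[m]}) v :
  fdef (fun a => mren (@rshift m' m) (den a)) v <-> fdef den (fun a => v (rshift _ a)).
Proof. by split=> h i; have := h i; rewrite meval_mren. Qed.

Lemma slice_ev (U : fieldType) (iota : {rmorphism k -> U}) m n N (p : {mpoly k[N]})
    (G : 'I_N -> 'I_m + 'I_n) (x : 'I_m -> k) : exists q : {mpoly k[n]}, forall y : 'I_n -> U,
  (map_mpoly iota q).@[y] =
    (map_mpoly iota p).@[fun i => match G i with inl a => iota (x a) | inr b => y b end].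
Proof.
have h : polyfun (img iota) (fun y : 'I_n -> U => (map_mpoly iota p).@[fun i =>
    match G i with inl a => iota (x a) | inr b => y b end]).
  apply: (polyfun_comp (polyfun_mpoly iota p) (G := fun i y => match G i with inl a => iota (x a) | inr b => y b end)) => i.
  by case: (G i) => j; [apply: PfC; exists (x j)|apply: PfX].
by have [q hq] := mpoly_of_polyfun h; exists q => y; rewrite -hq.
Qed.

Lemma slice_ev_r (U : fieldType) (iota : {rmorphism k -> U}) m n (p : {mpoly k[m + n]}) (x : 'I_m -> k) :
  exists q : {mpoly k[n]}, forall y : 'I_n -> U,
  (map_mpoly iota q).@[y] = (map_mpoly iota p).@[vcat (fun a => iota (x a)) y].
Proof. exact: (slice_ev iota p (@split m n) x). Qed.

Lemma map_mpoly_idfun n (p : {mpoly k[n]}) : map_mpoly idfun p = p.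
Proof. by apply/mpolyP => m; rewrite mcoeff_map_mpoly. Qed.

Lemma slice_r m n (p : {mpoly k[m + n]}) (x : 'I_m -> k) :
  exists q : {mpoly k[n]}, forall z, q.@[z] = p.@[vcat x z].
Proof.
have [q hq] := slice_ev idfun p (@split m n) x; exists q => z.
by have := hq z; rewrite !map_mpoly_idfun.
Qed.

Lemma slice_l m n (p : {mpoly k[m + n]}) (z : 'I_n -> k) :
  exists q : {mpoly k[m]}, forall x, q.@[x] = p.@[vcat x z].
Proof.
have [q hq] := slice_ev idfun p (fun i => match @split m n i with inl a => inr a | inr b => inl b end) z.
exists q => x; have := hq x; rewrite !map_mpoly_idfun => ->; apply: meval_eq => i.
by rewrite /vcat; case: split.
Qed.

End Zeros.

Section Product.
Variables (k : fieldType) (V W : atlas k).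

Definition pr1 (x : pt (prodv V W)) : pt V :=
  mkpt (i := (tag x).1) (fun a => tagged x (lshift _ a)).

Definition ppair (x : pt V) (z : pt W) : pt (prodv V W) :=
  @mkpt k (prodv V W) (tag x, tag z) (vcat (tagged x) (tagged z)).

Lemma pr1_pair x z : pr1 (ppair x z) = x.
Proof.
case: x z => [i v] [j w]; rewrite /pr1 /ppair /=; congr existT.
by apply: functional_extensionality => a; rewrite vcat_l.
Qed.
Lemma pr2_pair x z : pr2 (ppair x z) = z.
Proof.
case: x z => [i v] [j w]; rewrite /pr2 /ppair /=; congr existT.
by apply: functional_extensionality => a; rewrite vcat_r.
Qed.
Lemma pair_pr x : ppair (pr1 x) (pr2 x) = x.
Proof.
by case: x => [[i j] v]; rewrite /pr1 /pr2 /ppair /=; congr existT; apply: vcat_eta.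
Qed.

Lemma onv_prod (x : pt (prodv V W)) : onv x <-> onv (pr1 x) /\ onv (pr2 x).
Proof. by rewrite /onv /= zeros_cat !zeros_mren. Qed.

Lemma same_prod (x y : pt (prodv V W)) :
  same x y <-> same (pr1 x) (pr1 y) /\ same (pr2 x) (pr2 y).
Proof.
have e : zeros (aglue (tag x) (tag y)) (vcat (tagged x) (tagged y)) <->
    zeros (aglue (tag x).1 (tag y).1) (vcat (tagged (pr1 x)) (tagged (pr1 y))) /\
    zeros (aglue (tag x).2 (tag y).2) (vcat (tagged (pr2 x)) (tagged (pr2 y))).
  rewrite /= zeros_cat !zeros_mren.
  by rewrite !vcat_vcat.
split=> [[/onv_prod[a1 a2] /onv_prod[b1 b2] /e[c1 c2]]|[[a1 b1 c1] [a2 b2 c2]]].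
  by split; split.
by split; [apply/onv_prod|apply/onv_prod|apply/e].
Qed.

Hypotheses (hV : is_variety V) (hW : is_variety W).

Lemma prod_variety : is_variety (prodv V W).
Proof.
split.
- move=> [i j] v w; split=> [/same_prod [/= s1 s2]|[/onv_prod [o1 o2] e]].
    have e1 := same_chart hV s1; have e2 := same_chart hW s2.
    split; first by apply/onv_prod; split; [apply: same_on1 s1|apply: same_on1 s2].
    move=> a; rewrite -[v]vcat_eta -[w]vcat_eta; congr (vcat _ _ a).
      exact: e1. exact: e2.
  have <- : v = w by apply: functional_extensionality.
  by apply/same_prod; split; apply: same_refl.
- by move=> x y /same_prod [s1 s2]; apply/same_prod; split; apply: same_sym.
- move=> x y z /same_prod [s1 s2] /same_prod [t1 t2]; apply/same_prod; split.
    exact: same_trans s1 t1.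
  exact: same_trans s2 t2.
- move=> x y /same_prod [s1 s2].
  have [num1 [den1 [/= a1 b1 c1]]] := transition hV s1.
  have [num2 [den2 [/= a2 b2 c2]]] := transition hW s2.
  exists (vcat (fun a => mren (@lshift _ _) (num1 a)) (fun b => mren (@rshift _ _) (num2 b))),
    (vcat (fun a => mren (@lshift _ _) (den1 a)) (fun b => mren (@rshift _ _) (den2 b))).
  split; first by apply/fdef_vcat; rewrite fdef_mren_l fdef_mren_r.
  move=> v /onv_prod [/= o1 o2] /fdef_vcat; rewrite fdef_mren_l fdef_mren_r => -[d1 d2].
  apply/same_prod; split.
    move: (c1 _ o1 d1).
    suff -> : fval num1 den1 (fun a => v (lshift _ a))
       = (fun a => fval (vcat (fun a => mren (@lshift _ _) (num1 a)) (fun b => mren (@rshift _ _) (num2 b)))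
        (vcat (fun a => mren (@lshift _ _) (den1 a)) (fun b => mren (@rshift _ _) (den2 b))) v (lshift _ a)) by [].
    by apply: functional_extensionality => a; rewrite fval_vcat vcat_l fval_mren_l.
  move: (c2 _ o2 d2).
  suff -> : fval num2 den2 (fun a => v (rshift _ a))
       = (fun a => fval (vcat (fun a => mren (@lshift _ _) (num1 a)) (fun b => mren (@rshift _ _) (num2 b)))
        (vcat (fun a => mren (@lshift _ _) (den1 a)) (fun b => mren (@rshift _ _) (den2 b))) v (rshift _ a)) by [].
  by apply: functional_extensionality => a; rewrite fval_vcat vcat_r fval_mren_r.
Qed.

(** The slices of an open set of the product are open in one factor, and the
    points at which a slice is nonempty form an open set of the other: density
    holds in each factor in turn. *)
Lemma dense_prod : dense_opens V -> dense_opens W -> dense_opens (prodv V W).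
Proof.
move=> dV dW O1 O2 h1 h2 [x1 o1] [x2 o2].
have slice1 x O : onv x -> is_open O -> is_open (fun z : pt W => onv z /\ O (ppair x z)).
  move=> ox [a b c]; split=> [z []//|z z' s [oz h]|z [oz h]].
    split; first exact: same_on2 s.
    apply: b h; apply/same_prod; rewrite !pr1_pair !pr2_pair; split=> //.
    exact: same_refl.
  have [P [nP hP]] := c _ h; have [q hq] := slice_r P (tagged x).
  exists q; rewrite hq; split=> // w ow; rewrite hq => nw; split=> //.
  apply: hP => //; apply/onv_prod; split.
    by have := pr1_pair x (mkpt w); rewrite /ppair => ->.
  by have := pr2_pair x (mkpt w); rewrite /ppair => ->.
have slice2 z O : onv z -> is_open O -> is_open (fun x : pt V => onv x /\ O (ppair x z)).
  move=> oz [a b c]; split=> [x []//|x x' s [ox h]|x [ox h]].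
    split; first exact: same_on2 s.
    apply: b h; apply/same_prod; rewrite !pr1_pair !pr2_pair; split=> //.
    exact: same_refl.
  have [P [nP hP]] := c _ h; have [q hq] := slice_l P (tagged z).
  exists q; rewrite hq; split=> // w ow; rewrite hq => nw; split=> //.
  apply: hP => //; apply/onv_prod; split.
    by have := pr1_pair (mkpt w) z; rewrite /ppair => ->.
  by have := pr2_pair (mkpt w) z; rewrite /ppair => ->.
have [a1 _ _] := h1; have [a2 _ _] := h2.
have [u1 u2] := proj1 (onv_prod _) (a1 _ o1); have [v1 v2] := proj1 (onv_prod _) (a2 _ o2).
have [||z [[oz z1] [_ z2]]] := dW _ _ (slice1 _ _ u1 h1) (slice1 _ _ v1 h2).
- by exists (pr2 x1); rewrite pair_pr.
- by exists (pr2 x2); rewrite pair_pr.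
have [||x [[_ y1] [_ y2]]] := dV _ _ (slice2 _ _ oz h1) (slice2 _ _ oz h2).
- by exists (pr1 x1).
- by exists (pr1 x2).
by exists (ppair x z).
Qed.

End Product.

Section Subvariety.
Variables (k : fieldType) (V : atlas k) (X : closed_data V).
Hypotheses (hV : is_variety V) (hX : is_closed X).

Lemma onv_sub (x : pt V) : @onv k (sub X) x <-> inC X x.
Proof. by rewrite /onv /= zeros_cat. Qed.

Lemma same_sub (x y : pt V) : @same k (sub X) x y <-> same x y /\ inC X x.
Proof.
split=> [[/onv_sub h1 /onv_sub h2 h3]|[s h]].
  by split=> //; case: h1 => o1 _; case: h2 => o2 _; split.
have h' := hX s h; case: s => _ _ s; split=> //; exact/onv_sub.
Qed.

Lemma sub_variety : is_variety (sub X).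
Proof.
split.
- move=> i v w; split=> [/(same_sub (mkpt v) (mkpt w)) [s h]|[/(onv_sub (mkpt v)) h e]].
    by split; [apply/(onv_sub (mkpt v))|have := same_chart hV s; move=> ->].
  apply/(same_sub (mkpt v) (mkpt w)); split=> //.
  have <- : v = w by apply: functional_extensionality.
  by apply: same_refl => //; case: h.
- move=> x y /same_sub [s h]; apply/same_sub; split; first exact: same_sym.
  exact: hX h.
- move=> x y z /same_sub [s h] /same_sub [t _]; apply/same_sub; split=> //.
  exact: same_trans s t.
- move=> x y /same_sub [s h].
  have [num [den [a b c]]] := transition hV s.
  exists num, den; split=> // v /(onv_sub (mkpt v)) ov dv.
  apply/(same_sub (mkpt v) (mkpt (fval num den v))); split=> //.
  by apply: c => //; case: ov.
Qed.

End Subvariety.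

Section AffineSpace.
Variables (k : fieldType) (l : nat).

Lemma same_aspace (x y : pt (aspace k l)) : same x y <-> tagged x =1 (tagged y : 'I_l -> k).
Proof.
case: x y => [[] v] [[] w]; split=> [[_ _ h] i|h].
  have hp : ('X_(lshift l i) - 'X_(rshift l i) : {mpoly k[l + l]}) \in
      [seq 'X_(lshift l i) - 'X_(rshift l i) | i <- enum 'I_l].
    by apply: (map_f (fun i => 'X_(lshift l i) - 'X_(rshift l i))); rewrite mem_enum.
  have /eqP := h _ hp; rewrite mevalB !mevalXU vcat_l vcat_r subr_eq0 => /eqP //.
split=> //; move=> _ /mapP[i _ ->].
by rewrite mevalB !mevalXU vcat_l vcat_r; apply/eqP; rewrite subr_eq0 /=; apply/eqP/h.
Qed.

Lemma aspace_variety : is_variety (aspace k l).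
Proof.
split.
- by move=> [] v w; rewrite same_aspace; split=> [h|[_ h]].
- by move=> x y /same_aspace h; apply/same_aspace.
- by move=> x y z /same_aspace h /same_aspace h'; apply/same_aspace => i; rewrite h.
- case=> [[] v] [[] w] s; exists (fun i => 'X_i), (fun=> 1); split=> /=.
    by move=> i; rewrite meval1 oner_neq0.
  move=> v' _ _; apply/same_aspace => i /=.
  by rewrite /fval mevalXU meval1 divr1.
Qed.

End AffineSpace.

Section Transform.
Variables (k : fieldType) (sk : {rmorphism k -> k}).
Hypothesis inv : forall y : k, exists x, sk x = y.

Definition tw (V : atlas k) (x : pt V) : pt (twist sk V) :=
  @mkpt k (twist sk V) (tag x) (fun a => sk (tagged x a)).

Lemma sk_tuple n (w : 'I_n -> k) : exists v : 'I_n -> k, w = fun i => sk (v i).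
Proof.
have /choice_fun [v hv] i : exists x, sk x = w i by apply: inv.
by exists v; apply: functional_extensionality.
Qed.

Lemma sk_mpoly n (P : {mpoly k[n]}) : exists P', P = map_mpoly sk P'.
Proof.
elim/mpolyind: P => [|c m p _ _ [p' ->]]; first by exists 0; rewrite raddf0.
have [d <-] := inv c; exists (d *: 'X_[m] + p').
by rewrite raddfD /= map_mpolyZ map_mpolyX.
Qed.

(** As [sk] is onto, every point of the transform of [V] is the transform of a
    point of [V], and facts about the transform follow from facts about [V]. *)
Lemma tw_surj (V : atlas k) (y : pt (twist sk V)) : exists x, y = tw x.
Proof. by case: y => i w; have [v ->] := sk_tuple w; exists (@mkpt k V i v). Qed.

Lemma zeros_sk n (E : seq {mpoly k[n]}) v :
  zeros (map (map_mpoly sk) E) (fun i => sk (v i)) <-> zeros E v.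
Proof.
split=> [h p hp|h _ /mapP[p hp ->]]; last by rewrite meval_map h // rmorph0.
by apply/eqP; rewrite -(fmorph_eq0 sk) -meval_map; apply/eqP; apply: h; apply: map_f.
Qed.

Lemma vcat_sk m n (v : 'I_m -> k) (w : 'I_n -> k) :
  vcat (fun a => sk (v a)) (fun b => sk (w b)) = (fun i => sk (vcat v w i)).
Proof. by apply: functional_extensionality => i; rewrite (vcat_comp sk). Qed.

Lemma onv_tw (V : atlas k) (x : pt V) : onv (tw x) <-> onv x.
Proof. exact: zeros_sk. Qed.

Lemma same_tw (V : atlas k) (x y : pt V) : same (tw x) (tw y) <-> same x y.
Proof.
split=> [[/onv_tw h1 /onv_tw h2]|[h1 h2 h3]].
  by rewrite /= vcat_sk => /zeros_sk h3; split.
by split; [apply/onv_tw|apply/onv_tw|rewrite /= vcat_sk; apply/zeros_sk].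
Qed.

Lemma inC_tw (V : atlas k) (X : closed_data V) (x : pt V) :
  inC (twistC X : closed_data (twist sk V)) (tw x) <-> inC X x.
Proof.
split=> [[/onv_tw h1 h2]|[h1 h2]]; split=> //.
- by apply/zeros_sk.
- exact/onv_tw.
- by apply/zeros_sk.
Qed.

Lemma fval_sk m n (num den : 'I_n -> {mpoly k[m]}) v :
  fval (fun i => map_mpoly sk (num i)) (fun i => map_mpoly sk (den i)) (fun i => sk (v i))
  = (fun i => sk (fval num den v i)).
Proof. by apply: functional_extensionality => i; rewrite /fval !meval_map fmorph_div. Qed.

Lemma fdef_sk m n (den : 'I_n -> {mpoly k[m]}) v :
  fdef (fun i => map_mpoly sk (den i)) (fun i => sk (v i)) <-> fdef den v.
Proof. by split=> h i; have := h i; rewrite meval_map fmorph_eq0. Qed.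

Lemma twist_variety (V : atlas k) : is_variety V -> is_variety (twist sk V).
Proof.
move=> hV; split.
- move=> i v w; have [v' ->] := sk_tuple v; have [w' ->] := sk_tuple w.
  have := same_tw (@mkpt k V i v') (@mkpt k V i w') => H.
  have O := onv_tw (@mkpt k V i v').
  case: (hV) => h _ _ _; split=> [/H /h [/O o e]|[/O o e]].
    by split=> // a; rewrite e.
  by apply/H/h; split=> // a; apply: (fmorph_inj sk); apply: e.
- move=> x y; have [x' ->] := tw_surj x; have [y' ->] := tw_surj y.
  by move=> /same_tw s; apply/same_tw; apply: same_sym.
- move=> x y z; have [x' ->] := tw_surj x; have [y' ->] := tw_surj y; have [z' ->] := tw_surj z.
  by move=> /same_tw s /same_tw t; apply/same_tw; apply: same_trans s t.
- move=> x y; have [x' ->] := tw_surj x; have [y' ->] := tw_surj y.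
  move=> /same_tw s; have [num [den [a b c]]] := transition hV s.
  exists (fun i => map_mpoly sk (num i)), (fun i => map_mpoly sk (den i)).
  split; first by apply/fdef_sk.
  move=> w; have [v ->] := sk_tuple w => o /fdef_sk d.
  have o' : onv (@mkpt k V (tag x') v) by apply/onv_tw.
  have := c v o' d; rewrite -same_tw /tw /=.
  by rewrite -fval_sk.
Qed.

Lemma pval_tw (V W : atlas k) (f : ratmap V W) (x : pt V) (y : pt W) :
  pval (twistR sk f) (tw x) (tw y) <-> pval f x y.
Proof.
split.
  move=> [w [s1 d s2]]; have [v ev] := sk_tuple w; exists v.
  split.
  - by apply/same_tw; rewrite /tw /= -ev.
  - by apply/fdef_sk; rewrite -ev.
  - by apply/same_tw; rewrite /tw /= -fval_sk -ev.
move=> [v [s1 d s2]]; exists (fun i => sk (v i)); split.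
- by move/same_tw: s1.
- exact/fdef_sk.
- by move/same_tw: s2; rewrite /tw /= -fval_sk.
Qed.

Lemma is_ratmap_tw (V W : atlas k) (f : ratmap V W) : is_ratmap f -> is_ratmap (twistR sk f).
Proof.
move=> [[v [o d]] h]; split.
  by exists (fun i => sk (v i)); split; [apply/(onv_tw (mkpt v))|apply/fdef_sk].
move=> w; have [u ->] := sk_tuple w => o' /fdef_sk d'.
have o2 : onv (@mkpt k V (rsrc f) u) by apply/onv_tw.
have := h u o2 d'; rewrite -onv_tw /tw /=.
by rewrite -fval_sk.
Qed.

Lemma rval_tw (V W : atlas k) (f : ratmap V W) (x : pt V) (y : pt W) :
  rval f x y -> rval (twistR sk f) (tw x) (tw y).
Proof.
move=> [g [hg e p]]; exists (twistR sk g); split.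
- exact: is_ratmap_tw.
- move=> a b b'; have [a' ->] := tw_surj a; have [b1 ->] := tw_surj b; have [b2 ->] := tw_surj b'.
  by move=> /pval_tw p1 /pval_tw p2; apply/same_tw; apply: e p1 p2.
- exact/pval_tw.
Qed.

(** A presentation of the transform of [f] is itself the transform of a
    presentation of [f], since [sk] is onto. *)
Lemma rval_tw_inv (V W : atlas k) (f : ratmap V W) (x : pt V) (y : pt W) :
  rval (twistR sk f) (tw x) (tw y) -> rval f x y.
Proof.
move=> [[src tgt num den] [hg e p]].
have /choice_fun [num0 en] i := sk_mpoly (num i).
have /choice_fun [den0 ed] i := sk_mpoly (den i).
have eg : @Ratmap k (twist sk V) (twist sk W) src tgt num den = twistR sk (@Ratmap k V W src tgt num0 den0).
  by rewrite /twistR /=; congr Ratmap; apply: functional_extensionality.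
rewrite {}eg in hg e p; exists (@Ratmap k V W src tgt num0 den0); split.
- case: hg => [[w]]; have [v ->] := sk_tuple w => -[o /fdef_sk d] h; split.
    by exists v; split=> //; apply/(onv_tw (@mkpt k V src v)).
  move=> u /= ou /fdef_sk du.
  have := h (fun i => sk (u i)) (proj2 (onv_tw (@mkpt k V src u)) ou) du.
  rewrite -(onv_tw (@mkpt k W tgt _)) /tw /=.
  by rewrite -fval_sk.
- move=> a b b' p1 p2; apply/same_tw.
  by apply: (e (tw a)); apply/pval_tw.
- exact/pval_tw.
Qed.

Lemma same_twaspace l (x y : pt (twist sk (aspace k l))) :
  same x y <-> tagged x =1 (tagged y : 'I_l -> k).
Proof.
have [x' ->] := tw_surj x; have [y' ->] := tw_surj y; rewrite same_tw same_aspace.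
by split=> h i; [rewrite /= h|apply: (fmorph_inj sk); apply: h].
Qed.

(** Affine space is its own transform, with the same identification of points,
    but the two atlases are different terms. *)
Lemma locrat_twaspace (V : atlas k) l (R : pt V -> pt (aspace k l) -> Prop) :
  locrat R -> @locrat k V (twist sk (aspace k l)) R.
Proof.
move=> hR; split.
- exact: lr_on1 hR.
- by move=> x y _.
- exact: lr_sat1 hR.
- by move=> x y y' /same_twaspace/same_aspace s; apply: (lr_sat2 hR s).
- move=> x y /(lr_loc hR) [j [nm [dn [P [nP st hP]]]]]; exists j, nm, dn, P; split=> //.
  by apply/same_twaspace/same_aspace.
Qed.

Lemma rval_aspace_id l (y : pt (aspace k l)) (y' : pt (twist sk (aspace k l))) :
  tagged y =1 (tagged y' : 'I_l -> k) -> rval (aspace_id sk l) y y'.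
Proof.
move=> e; have hA := aspace_variety k l; exists (aspace_id sk l); split.
- split=> //; exists (tagged y); split=> // i; first by rewrite /= meval1 oner_neq0.
- exact: pval_functional hA (twist_variety hA).
exists (tagged y); split.
- exact/same_aspace.
- by move=> i; rewrite /= meval1 oner_neq0.
- by apply/same_twaspace => i; rewrite /= /fval mevalXU meval1 divr1 -e.
Qed.

(** ** Products of dynamical systems *)

Lemma same_tprod (V Z : atlas k) (y y' : pt (twist sk (prodv V Z))) :
  same y y' <-> @same k (twist sk V) (@pr1 k (twist sk V) (twist sk Z) y) (@pr1 k (twist sk V) (twist sk Z) y')
   /\ @same k (twist sk Z) (@pr2 k (twist sk V) (twist sk Z) y) (@pr2 k (twist sk V) (twist sk Z) y').
Proof.
have [x ->] := tw_surj y; have [x' ->] := tw_surj y'; rewrite same_tw same_prod.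
by rewrite -(same_tw (pr1 x)) -(same_tw (pr2 x)).
Qed.

Lemma onv_tprod (V Z : atlas k) (y : pt (twist sk (prodv V Z))) :
  onv y <-> @onv k (twist sk V) (@pr1 k (twist sk V) (twist sk Z) y)
   /\ @onv k (twist sk Z) (@pr2 k (twist sk V) (twist sk Z) y).
Proof.
have [x ->] := tw_surj y; rewrite onv_tw onv_prod.
by rewrite -(onv_tw (pr1 x)) -(onv_tw (pr2 x)).
Qed.

Section Sprod.
Variables (V Z : atlas k) (phi : ratmap V (twist sk V)) (psi : ratmap Z (twist sk Z)).

Lemma sprod_fdef v : fdef (@rden _ _ _ (sprod phi psi)) v <->
  fdef (@rden _ _ _ phi) (fun a => v (lshift _ a)) /\ fdef (@rden _ _ _ psi) (fun b => v (rshift _ b)).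
Proof. by rewrite -fdef_mren_l -fdef_mren_r -fdef_vcat. Qed.

Lemma sprod_fval v : fval (@rnum _ _ _ (sprod phi psi)) (@rden _ _ _ (sprod phi psi)) v =
  vcat (fval (@rnum _ _ _ phi) (@rden _ _ _ phi) (fun a => v (lshift _ a)))
       (fval (@rnum _ _ _ psi) (@rden _ _ _ psi) (fun b => v (rshift _ b))).
Proof. by rewrite -fval_mren_l -fval_mren_r -fval_vcat. Qed.

Lemma sprod_pval (x : pt (prodv V Z)) (y : pt (twist sk (prodv V Z))) :
  pval (sprod phi psi) x y <->
  pval phi (pr1 x) (@pr1 k (twist sk V) (twist sk Z) y) /\
  pval psi (pr2 x) (@pr2 k (twist sk V) (twist sk Z) y).
Proof.
split.
  move=> [v [/same_prod [s1 s2] /sprod_fdef [d1 d2] /same_tprod [t1 t2]]]; split.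
    exists (fun a => v (lshift _ a)); split=> //.
    move: t1; rewrite sprod_fval.
    have := @pr1_pair k (twist sk V) (twist sk Z)
      (mkpt (fval (@rnum _ _ _ phi) (@rden _ _ _ phi) (fun a => v (lshift _ a))))
      (mkpt (fval (@rnum _ _ _ psi) (@rden _ _ _ psi) (fun a => v (rshift _ a)))).
    by rewrite /ppair /= => ->.
  exists (fun a => v (rshift _ a)); split=> //.
  move: t2; rewrite sprod_fval.
  have := @pr2_pair k (twist sk V) (twist sk Z)
      (mkpt (fval (@rnum _ _ _ phi) (@rden _ _ _ phi) (fun a => v (lshift _ a))))
      (mkpt (fval (@rnum _ _ _ psi) (@rden _ _ _ psi) (fun a => v (rshift _ a)))).
  by rewrite /ppair /= => ->.
move=> [[v [s1 d1 t1]] [w [s2 d2 t2]]].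
have el : (fun a => vcat v w (lshift _ a)) = v.
  by apply: functional_extensionality => a; rewrite vcat_l.
have er : (fun a => vcat v w (rshift _ a)) = w.
  by apply: functional_extensionality => a; rewrite vcat_r.
exists (vcat v w); split.
- by apply/same_prod; rewrite /pr1 /pr2 /= el er.
- by apply/sprod_fdef; rewrite el er.
- apply/same_tprod; rewrite sprod_fval el er; split.
    by have := @pr1_pair k (twist sk V) (twist sk Z) (mkpt (fval (@rnum _ _ _ phi) (@rden _ _ _ phi) v))
      (mkpt (fval (@rnum _ _ _ psi) (@rden _ _ _ psi) w)); rewrite /ppair /= => ->.
  by have := @pr2_pair k (twist sk V) (twist sk Z) (mkpt (fval (@rnum _ _ _ phi) (@rden _ _ _ phi) v))
      (mkpt (fval (@rnum _ _ _ psi) (@rden _ _ _ psi) w)); rewrite /ppair /= => ->.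
Qed.

Lemma sprod_ratmap : is_ratmap phi -> is_ratmap psi -> is_ratmap (sprod phi psi).
Proof.
move=> [[v [o1 d1]] h1] [[w [o2 d2]] h2]; split.
  exists (vcat v w).
  have el : (fun a => vcat v w (lshift _ a)) = v.
    by apply: functional_extensionality => a; rewrite vcat_l.
  have er : (fun a => vcat v w (rshift _ a)) = w.
    by apply: functional_extensionality => a; rewrite vcat_r.
  split; first by apply/onv_prod; rewrite /pr1 /pr2 /= el er.
  by apply/sprod_fdef; rewrite el er.
move=> u /onv_prod [/= p1 p2] /sprod_fdef [e1 e2]; rewrite sprod_fval.
apply/onv_tprod; split.
  have := @pr1_pair k (twist sk V) (twist sk Z) (mkpt (fval (@rnum _ _ _ phi) (@rden _ _ _ phi) (fun a => u (lshift _ a))))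
      (mkpt (fval (@rnum _ _ _ psi) (@rden _ _ _ psi) (fun a => u (rshift _ a)))); rewrite /ppair /= => ->.
  exact: h1.
have := @pr2_pair k (twist sk V) (twist sk Z) (mkpt (fval (@rnum _ _ _ phi) (@rden _ _ _ phi) (fun a => u (lshift _ a))))
      (mkpt (fval (@rnum _ _ _ psi) (@rden _ _ _ psi) (fun a => u (rshift _ a)))); rewrite /ppair /= => ->.
exact: h2.
Qed.

End Sprod.

Lemma rval_sprod (V Z : atlas k) (phi : ratmap V (twist sk V)) (psi : ratmap Z (twist sk Z))
    x y z w : rval phi x y -> rval psi z w ->
  @rval k (prodv V Z) (twist sk (prodv V Z)) (sprod phi psi) (ppair x z)
    (@ppair k (twist sk V) (twist sk Z) y w).
Proof.
move=> [g1 [h1 e1 p1]] [g2 [h2 e2 p2]]; exists (sprod g1 g2); split.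
- exact: sprod_ratmap.
- move=> a b b' /sprod_pval [a1 a2] /sprod_pval [b1 b2]; apply/same_tprod; split.
    exact: e1 a1 b1.
  exact: e2 a2 b2.
- apply/sprod_pval; rewrite pr1_pair pr2_pair.
  by rewrite (@pr1_pair k (twist sk V) (twist sk Z)) (@pr2_pair k (twist sk V) (twist sk Z)).
Qed.

End Transform.

(** * Function fields *)

(** Prime ideals as propositions, since the vanishing ideal of a set of points
    is not given by a boolean test. *)
Record prime_ideal (R : comNzRingType) := PrimeIdeal {
  pid :> R -> Prop;
  pid0 : pid 0;
  pid1 : ~ pid 1;
  pidDM : forall a x y, pid x -> pid y -> pid (a * x + y);
  pidP : forall x y, pid (x * y) -> pid x \/ pid y }.

Section PrimeQuotient.
Variables (R : comNzRingType) (I : prime_ideal R).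

Definition in_pid (x : R) : bool :=
  if excluded_middle_informative (I x) then true else false.

Lemma in_pidP x : reflect (I x) (in_pid x).
Proof. by rewrite /in_pid; case: excluded_middle_informative => h; constructor. Qed.

Lemma in_pid_ideal : idealr_closed in_pid.
Proof.
split=> [||a x y /in_pidP hx /in_pidP hy]; first exact/in_pidP/pid0.
  by apply/in_pidP/pid1.
by apply/in_pidP/pidDM.
Qed.

Lemma in_pid_prime : prime_idealr_closed in_pid.
Proof. by move=> x y /in_pidP/pidP[] h; apply/orP; [left|right]; apply/in_pidP. Qed.

HB.instance Definition _ := isIdealr.Build R in_pid in_pid_ideal.
HB.instance Definition _ := isPrimeIdealrClosed.Build R in_pid in_pid_prime.

Definition pid_str : prime_idealr R := PrimeIdealr.clone R in_pid _.
Definition pquot : Type := {ideal_quot pid_str}.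
HB.instance Definition _ := GRing.ComNzRing.on pquot.

Definition pq_unit : {pred pquot} := fun x =>
  if excluded_middle_informative (exists y, y * x = 1) then true else false.
Definition pq_inv (x : pquot) : pquot :=
  match excluded_middle_informative (exists y, y * x = 1) with
  | left h => proj1_sig (constructive_indefinite_description _ h)
  | right _ => x end.

Lemma pq_mulVx : {in pq_unit, left_inverse 1 pq_inv *%R}.
Proof.
move=> x; rewrite /pq_inv /in_mem /= /pq_unit; case: excluded_middle_informative => // h _.
by case: constructive_indefinite_description.
Qed.
Lemma pq_unitPl x y : y * x = 1 -> pq_unit x.
Proof. by move=> e; rewrite /pq_unit; case: excluded_middle_informative => // -[]; exists y. Qed.
Lemma pq_inv_out : {in [predC pq_unit], pq_inv =1 id}.
Proof.
by move=> x; rewrite inE /= /in_mem /= /pq_unit /pq_inv; case: excluded_middle_informative.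
Qed.

HB.instance Definition _ := GRing.ComNzRing_hasMulInverse.Build pquot pq_mulVx pq_unitPl pq_inv_out.

Lemma pq_integral (x y : pquot) : x * y = 0 -> (x == 0) || (y == 0).
Proof. exact: (@Quotient.rquot_IdomainAxiom R pid_str). Qed.

HB.instance Definition _ := GRing.ComUnitRing_isIntegral.Build pquot pq_integral.

Definition pq_pi (x : R) : pquot := (\pi_({ideal_quot pid_str}) x)%qT.

Lemma pq_piB : {morph pq_pi : x y / x - y}.
Proof. exact: (rmorphB (\pi_({ideal_quot pid_str})%qT : {rmorphism R -> {ideal_quot pid_str}})). Qed.
Lemma pq_piM : {morph pq_pi : x y / x * y}.
Proof. exact: (rmorphM (\pi_({ideal_quot pid_str})%qT : {rmorphism R -> {ideal_quot pid_str}})). Qed.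
Lemma pq_pi1 : pq_pi 1 = 1.
Proof. exact: (rmorph1 (\pi_({ideal_quot pid_str})%qT : {rmorphism R -> {ideal_quot pid_str}})). Qed.
Lemma pq_pi0 x : pq_pi x = 0 <-> I x.
Proof.
have -> : (pq_pi x = 0) <-> (pq_pi x == pq_pi 0).
  have -> : pq_pi 0 = 0 by rewrite -(subrr 0) pq_piB subrr.
  by split=> /eqP.
have -> : (pq_pi x == pq_pi 0) = (x - 0 \in pid_str).
  exact/esym/(@Quotient.idealrBE R pid_str x 0).
by rewrite subr0; split=> /in_pidP.
Qed.
Lemma pq_pi_surj y : exists x, y = pq_pi x.
Proof. by exists (repr (y : {ideal_quot pid_str})); rewrite /pq_pi reprK. Qed.

Definition pq_frac (x : R) : {fraction pquot} := @tofrac pquot (pq_pi x).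

Lemma pq_frac_zmod : zmod_morphism pq_frac.
Proof. by move=> x y; rewrite /pq_frac pq_piB rmorphB. Qed.
Lemma pq_frac_monoid : monoid_morphism pq_frac.
Proof.
by split=> [|x y]; rewrite /pq_frac; [rewrite pq_pi1 rmorph1|rewrite pq_piM rmorphM].
Qed.

HB.instance Definition _ := GRing.isZmodMorphism.Build R {fraction pquot} pq_frac pq_frac_zmod.
HB.instance Definition _ := GRing.isMonoidMorphism.Build R {fraction pquot} pq_frac pq_frac_monoid.

Lemma fraction_numden (D : idomainType) (z : {fraction D}) :
  exists x y : D, y != 0 /\ z = tofrac x / tofrac y.
Proof.
elim/quotW: z => r; exists (frac r).1, (frac r).2; split; first exact: denom_ratioP.
have nd : tofrac (frac r).2 != 0 by rewrite tofrac_eq0 denom_ratioP.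
apply: (mulIf nd); rewrite divfK //.
rewrite !piE; apply/eqP; rewrite eqmodE /= FracField.equivfE /FracField.mulf.
rewrite !numden_Ratio ?mulf_neq0 ?denom_ratioP ?oner_eq0 //.
by rewrite !mulr1 mulrC.
Qed.

(** The fraction field of the quotient domain. *)
Lemma prime_residue : exists (F : fieldType) (f : {rmorphism R -> F}),
  (forall x, f x = 0 <-> I x) /\ forall z, exists x y, f y != 0 /\ z = f x / f y.
Proof.
exists {fraction pquot}, pq_frac; split=> [x|z].
  rewrite -pq_pi0 /=; split=> [/eqP|e]; last by rewrite /pq_frac e rmorph0.
  by rewrite /pq_frac tofrac_eq0 => /eqP.
have [u [v [nv ->]]] := fraction_numden z.
have [x eu] := pq_pi_surj u; have [y ev] := pq_pi_surj v.
by exists x, y; rewrite /= /pq_frac -eu -ev tofrac_eq0.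
Qed.

End PrimeQuotient.

Lemma fracB (F : fieldType) (a b c d : F) : b != 0 -> d != 0 ->
  a / b - c / d = (a * d - c * b) / (b * d).
Proof. by move=> nb nd; field; rewrite nb nd. Qed.

Section GenericPoint.
Variables (k : fieldType) (N : nat) (T : ('I_N -> k) -> Prop).
Hypotheses (irrT : irreducible_set T) (neT : exists x, T x).

(** The polynomials vanishing on [T] form a prime ideal because [T] is
    irreducible; [xi] is the tuple of the classes of the variables. *)
Lemma generic_point : exists (Om : fieldType) (iota : {rmorphism k -> Om}) (xi : 'I_N -> Om),
  (forall p : {mpoly k[N]}, (map_mpoly iota p).@[xi] = 0 <-> forall x, T x -> p.@[x] = 0) /\
  forall z, exists p q, (map_mpoly iota q).@[xi] != 0 /\
    z = (map_mpoly iota p).@[xi] / (map_mpoly iota q).@[xi].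
Proof.
pose I (p : {mpoly k[N]}) := forall x, T x -> p.@[x] = 0.
have I0 : I 0 by move=> x _; rewrite meval0.
have I1 : ~ I 1.
  by have [x Tx] := neT; move=> /(_ x Tx) /eqP; rewrite meval1 oner_eq0.
have IDM a p q : I p -> I q -> I (a * p + q).
  by move=> hp hq x Tx; rewrite mevalD mevalM hp // hq // mulr0 addr0.
have IP p q : I (p * q) -> I p \/ I q.
  move=> h; have [hp|hp] := classic (I p); [by left|right].
  move=> x2 T2; apply: NNPP => /eqP n2.
  have [x1 [T1 n1]] : exists x, T x /\ p.@[x] != 0.
    by apply: NNPP => h'; apply: hp => x Tx; apply/eqP/negPn/negP => n; apply: h'; exists x.
  have [x [Tx m1 m2]] := irrT T1 T2 n1 n2.
  by have /eqP := h x Tx; rewrite mevalM mulf_eq0 (negPf m1) (negPf m2).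
have [Om [f [f0 fs]]] := prime_residue (PrimeIdeal I0 I1 IDM IP).
pose iota : {rmorphism k -> Om} := f \o @mpolyC N k.
pose xi i := f 'X_i.
have evf p : (map_mpoly iota p).@[xi] = f p.
  elim/mpolyind: p => [|c m p _ _ IH]; first by rewrite !raddf0.
  rewrite raddfD /= mevalD IH [RHS]rmorphD; congr (_ + _).
  rewrite map_mpolyZ mevalZ map_mpolyX mevalX -mul_mpolyC [RHS]rmorphM; congr (_ * _).
  by rewrite mpolyXE_id rmorph_prod; apply: eq_bigr => i _; rewrite rmorphXn.
exists Om, iota, xi; split=> [p|z]; first by rewrite evf f0.
by have [p [q [nq ->]]] := fs z; exists p, q; rewrite !evf.
Qed.

End GenericPoint.

(** A fraction evaluated at [xi] is sent to the transformed fraction evaluated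
    at [eta]; the hypothesis on ideals makes this well defined. *)
Lemma generic_endo (k Om : fieldType) (sk : {rmorphism k -> k}) (iota : {rmorphism k -> Om})
    N (xi eta : 'I_N -> Om) :
  (forall z, exists p q : {mpoly k[N]}, (map_mpoly iota q).@[xi] != 0 /\
    z = (map_mpoly iota p).@[xi] / (map_mpoly iota q).@[xi]) ->
  (forall p : {mpoly k[N]}, (map_mpoly iota p).@[xi] = 0 <->
     (map_mpoly iota (map_mpoly sk p)).@[eta] = 0) ->
  exists s : {rmorphism Om -> Om}, (forall c, s (iota c) = iota (sk c)) /\
    forall i, s (xi i) = eta i.
Proof.
move=> gen hI.
pose f (p : {mpoly k[N]}) := (map_mpoly iota p).@[xi].
pose g (p : {mpoly k[N]}) := (map_mpoly iota (map_mpoly sk p)).@[eta].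
have fB p q : f (p - q) = f p - f q.
  by rewrite /f (rmorphB (map_mpoly iota)) mevalB.
have fM p q : f (p * q) = f p * f q.
  by rewrite /f (rmorphM (map_mpoly iota)) mevalM.
have f1 : f 1 = 1 by rewrite /f (rmorph1 (map_mpoly iota)) meval1.
have gB p q : g (p - q) = g p - g q.
  by rewrite /g (rmorphB (map_mpoly sk)) (rmorphB (map_mpoly iota)) mevalB.
have gM p q : g (p * q) = g p * g q.
  by rewrite /g (rmorphM (map_mpoly sk)) (rmorphM (map_mpoly iota)) mevalM.
have g1 : g 1 = 1 by rewrite /g (rmorph1 (map_mpoly sk)) (rmorph1 (map_mpoly iota)) meval1.
have gn p : f p != 0 -> g p != 0 by apply: contra => /eqP/hI/eqP.
have /choice_fun [F hF] : forall z, exists pq : {mpoly k[N]} * {mpoly k[N]},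
    f pq.2 != 0 /\ z = f pq.1 / f pq.2.
  by move=> z; have [p [q h]] := gen z; exists (p, q).
pose s z := g (F z).1 / g (F z).2.
have hs z p q : f q != 0 -> z = f p / f q -> s z = g p / g q.
  move=> nq ez; have [n2 e2] := hF z; apply/(div_eq_cross _ _ (gn _ n2) (gn _ nq)).
  rewrite -gM -gM -gB; apply/hI; rewrite -/(f _) fB fM fM.
  by apply/(div_eq_cross _ _ n2 nq); rewrite -e2 ez.
have sB : zmod_morphism s.
  move=> z w; have [n1 e1] := hF z; have [n2 e2] := hF w.
  rewrite (@hs _ ((F z).1 * (F w).2 - (F w).1 * (F z).2) ((F z).2 * (F w).2)).
  - by rewrite /s gB !gM fracB ?gn.
  - by rewrite fM mulf_neq0.
  - by rewrite {1}e1 {1}e2 fB !fM fracB.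
have sM : monoid_morphism s.
  split=> [|z w]; first by rewrite (@hs _ 1 1) ?f1 ?g1 ?divr1 ?oner_neq0.
  have [n1 e1] := hF z; have [n2 e2] := hF w.
  rewrite (@hs _ ((F z).1 * (F w).1) ((F z).2 * (F w).2)).
  - by rewrite /s !gM mulf_div.
  - by rewrite fM mulf_neq0.
  - by rewrite {1}e1 {1}e2 !fM mulf_div.
pose m1 := GRing.isZmodMorphism.Build Om Om s sB.
pose m2 := GRing.isMonoidMorphism.Build Om Om s sM.
pose S : {rmorphism Om -> Om} := HB.pack s m1 m2.
exists S; split=> [c|i]; rewrite /S /=.
  rewrite (@hs _ c%:MP 1) ?f1 ?g1 ?oner_neq0 ?divr1 //.
    by rewrite /g !map_mpolyC mevalC.
  by rewrite /f map_mpolyC mevalC.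
rewrite (@hs _ 'X_i 1) ?f1 ?g1 ?oner_neq0 ?divr1 //.
  by rewrite /g !map_mpolyX mevalXU.
by rewrite /f map_mpolyX mevalXU.
Qed.

Section EvaluationAtGenericPoint.
Variables (k Om : fieldType) (iota : {rmorphism k -> Om}).
Notation ev p v := ((map_mpoly iota p).@[v]).

Definition evr m n (num den : 'I_n -> {mpoly k[m]}) (y : 'I_m -> Om) : 'I_n -> Om :=
  fun i => ev (num i) y / ev (den i) y.

Lemma clear_ev m n (p : {mpoly k[n]}) (num den : 'I_n -> {mpoly k[m]}) :
  exists (P : {mpoly k[m]}) d, forall y : 'I_m -> Om, (forall i, ev (den i) y != 0) ->
    ev P y = ev p (evr num den y) * (\prod_i ev (den i) y) ^+ d.
Proof.
have hR := sf_sr (img_subfield iota).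
have [P [d [hP eP]]] := polyfun_clear hR (polyfun_mpoly iota p)
  (A := fun i y => ev (num i) y) (D := fun i y => ev (den i) y)
  (fun i => polyfun_mpoly iota _) (fun i => polyfun_mpoly iota _).
by have [P' eP'] := mpoly_of_polyfun hP; exists P', d => y hy; rewrite -eP' eP.
Qed.

Lemma evr_iota m n (num den : 'I_n -> {mpoly k[m]}) x :
  evr num den (fun i => iota (x i)) = fun i => iota (fval num den x i).
Proof. by apply: functional_extensionality => i; rewrite /evr /fval !meval_map fmorph_div. Qed.

Lemma evr_vcat m n1 n2 (num1 den1 : 'I_n1 -> {mpoly k[m]}) (num2 den2 : 'I_n2 -> {mpoly k[m]}) y :
  evr (vcat num1 num2) (vcat den1 den2) y = vcat (evr num1 den1 y) (evr num2 den2 y).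
Proof. by apply: functional_extensionality => i; rewrite /evr /vcat; case: split. Qed.

Lemma evD m (p q : {mpoly k[m]}) (y : 'I_m -> Om) : ev (p + q) y = ev p y + ev q y.
Proof. by rewrite (rmorphD (map_mpoly iota)) mevalD. Qed.
Lemma evZ m c (p : {mpoly k[m]}) (y : 'I_m -> Om) : ev (c *: p) y = iota c * ev p y.
Proof. by rewrite map_mpolyZ mevalZ. Qed.

Lemma ev_mren m n (f : 'I_m -> 'I_n) (p : {mpoly k[m]}) (y : 'I_n -> Om) :
  ev (mren f p) y = ev p (fun i => y (f i)).
Proof.
elim/mpolyind: p => [|c mm p _ _ IH].
  by rewrite /mren comp_mpoly0 !(rmorph0 (map_mpoly iota)) !meval0.
rewrite /mren comp_mpolyD comp_mpolyZ comp_mpolyX !evD -/(mren f p) IH; congr (_ + _).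
rewrite !evZ map_mpolyX mevalX; congr (_ * _).
rewrite ev_prod; apply: eq_bigr => i _; rewrite tnth_mktuple.
by rewrite (rmorphXn (map_mpoly iota)) rmorphXn /= map_mpolyX mevalXU.
Qed.

Lemma ev_cross m n (p q : {mpoly k[m]}) (p' q' : {mpoly k[n]}) (y : 'I_m -> Om) (w : 'I_n -> Om) :
  ev (mren (@lshift m n) p * mren (@rshift m n) q' - mren (@lshift m n) q * mren (@rshift m n) p')
    (vcat y w) = ev p y * ev q' w - ev q y * ev p' w.
Proof.
have el (r : {mpoly k[m]}) : ev (mren (@lshift m n) r) (vcat y w) = ev r y.
  by rewrite ev_mren; congr (_.@[_]); apply: functional_extensionality => i; rewrite vcat_l.
have er (r : {mpoly k[n]}) : ev (mren (@rshift m n) r) (vcat y w) = ev r w.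
  by rewrite ev_mren; congr (_.@[_]); apply: functional_extensionality => i; rewrite vcat_r.
rewrite (rmorphB (map_mpoly iota)) mevalB.
by congr (_ - _); rewrite evM; congr (_ * _); [apply: el|apply: er|apply: el|apply: er].
Qed.

Lemma meval_cross m n (p q : {mpoly k[m]}) (p' q' : {mpoly k[n]}) (y : 'I_m -> k) (w : 'I_n -> k) :
  (mren (@lshift m n) p * mren (@rshift m n) q' - mren (@lshift m n) q * mren (@rshift m n) p').@[vcat y w]
  = p.@[y] * q'.@[w] - q.@[y] * p'.@[w].
Proof.
rewrite mevalB !mevalM !meval_mren.
have -> : (fun i => vcat y w (lshift n i)) = y.
  by apply: functional_extensionality => i; rewrite vcat_l.
by have -> : (fun i => vcat y w (rshift m i)) = w
  by apply: functional_extensionality => i; rewrite vcat_r.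
Qed.

Variables (N : nat) (T : ('I_N -> k) -> Prop) (xi : 'I_N -> Om).
Hypothesis hxi : forall p : {mpoly k[N]}, ev p xi = 0 <-> forall x, T x -> p.@[x] = 0.

Lemma generic_neq0 p : ev p xi != 0 <-> exists x, T x /\ p.@[x] != 0.
Proof.
split=> [n|[x [Tx n]]]; last by apply: contra n => /eqP/hxi ->.
apply: NNPP => h; case/eqP: n; apply/hxi => x Tx; apply/eqP/negPn/negP => n.
by apply: h; exists x.
Qed.

Lemma generic_den n (den : 'I_n -> {mpoly k[N]}) : (forall i, ev (den i) xi != 0) <->
  exists x, T x /\ fdef den x.
Proof.
split=> [h|[x [Tx d]] i]; last by apply/generic_neq0; exists x.
have : ev (\prod_i den i) xi != 0 by rewrite ev_prod; apply/prodf_neq0 => i _.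
by move/generic_neq0 => [x [Tx /fdef_prod d]]; exists x.
Qed.

(** Clear the denominators and multiply by them and by [Q]: the resulting
    polynomial vanishes on all of [T]. *)
Lemma generic_relation n (R : {mpoly k[n]}) (num den : 'I_n -> {mpoly k[N]}) (Q : {mpoly k[N]}) :
  (forall i, ev (den i) xi != 0) -> ev Q xi != 0 ->
  (forall x, T x -> Q.@[x] != 0 -> fdef den x -> R.@[fval num den x] = 0) ->
  ev R (evr num den xi) = 0.
Proof.
move=> hd nQ h; have [P [d hP]] := clear_ev R num den.
have nd : \prod_i ev (den i) xi != 0 by apply/prodf_neq0 => i _.
suff : ev (P * (\prod_i den i * Q)) xi = 0.
  move/eqP; rewrite !evM ev_prod mulf_eq0 (negPf (mulf_neq0 nd nQ)) orbF hP //.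
  by rewrite mulf_eq0 expf_eq0 (negPf nd) andbF orbF => /eqP.
apply/hxi => x Tx; rewrite !mevalM; apply/eqP; rewrite !mulf_eq0.
have [//|n1] := eqVneq (\prod_i den i).@[x] 0; first by rewrite orbT.
have [//|n2] := eqVneq Q.@[x] 0; rewrite /= ?orbT // !orbF.
have /fdef_prod fd := n1; rewrite -(fmorph_eq0 iota) -meval_map hP.
  by rewrite evr_iota meval_map h // rmorph0 mul0r.
by move=> i; rewrite meval_map fmorph_eq0.
Qed.

(** Conversely the relation with denominators cleared vanishes at [xi], hence
    on [T]. *)
Lemma generic_relation_inv n (R : {mpoly k[n]}) (num den : 'I_n -> {mpoly k[N]}) :
  (forall i, ev (den i) xi != 0) -> ev R (evr num den xi) = 0 ->
  forall x, T x -> fdef den x -> R.@[fval num den x] = 0.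
Proof.
move=> hd e x Tx dx; have [P [d hP]] := clear_ev R num den.
have Pxi : ev P xi = 0 by rewrite hP // e mul0r.
have dx' i : ev (den i) (fun i => iota (x i)) != 0 by rewrite meval_map fmorph_eq0.
have /eqP := hP (fun i => iota (x i)) dx'; rewrite evr_iota !meval_map (proj1 (hxi P) Pxi x Tx) rmorph0 eq_sym.
rewrite mulf_eq0 expf_eq0 => /orP[|/andP[_ /prodf_eq0 [i _]]]; last by rewrite (negPf (dx' i)).
by rewrite fmorph_eq0 => /eqP.
Qed.

End EvaluationAtGenericPoint.

(** * Generic dynamics *)

Section Dynamics.
Variables (k : fieldType) (sk : {rmorphism k -> k}).
Hypothesis inv : forall y : k, exists x, sk x = y.

Section SingleSystem.
Variables (V : atlas k) (phi : ratmap V (twist sk V)).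
Hypothesis hphi : rational_svariety phi.

Lemma sv_variety : is_variety V. Proof. by case: hphi. Qed.
Lemma sv_dense : dense_opens V. Proof. by case: hphi => h1 h2 _ _; apply: irreducible_dense. Qed.
Lemma sv_locrat : locrat (rval phi).
Proof. by apply: locrat_rval; [exact: sv_variety|apply: (twist_variety inv); exact: sv_variety]. Qed.
Lemma sv_functional x y y' : rval phi x y -> rval phi x y' -> same y y'.
Proof.
apply: rval_functional; [exact: sv_variety|apply: (twist_variety inv); exact: sv_variety|exact: sv_dense|].
by case: hphi.
Qed.

(** The values are read in the transform of the chart from which the arguments
    are taken, whatever the target chart of the presentation of [phi]: then
    they determine an endomorphism of the function field of that chart. *)
Definition chart_dyn (num den : 'I_(adim (rsrc phi)) -> {mpoly k[adim (rsrc phi)]})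
    (Q : {mpoly k[adim (rsrc phi)]}) :=
  forall v, onv (@mkpt k V (rsrc phi) v) -> Q.@[v] != 0 -> fdef den v /\
    rval phi (mkpt v) (@mkpt k (twist sk V) (rsrc phi) (fval num den v)).

(** By dominance some values lie in the required chart. *)
Lemma chart_dyn_exists : exists num den Q, chart_dyn num den Q /\
  exists v, onv (@mkpt k V (rsrc phi) v) /\ Q.@[v] != 0.
Proof.
have hV := sv_variety; have hW := twist_variety inv hV.
have [_ _ [[v [ov dv]] _] dom] := hphi.
have ne : exists v, onv (@mkpt k V (rsrc phi) v) by exists v.
have neW : exists y, exists w, same y (@mkpt k (twist sk V) (rsrc phi) w) /\
    (1 : {mpoly k[adim (rsrc phi)]}).@[w] != 0.
  exists (tw sk (mkpt v)), (fun i => sk (v i)); rewrite meval1 oner_neq0; split=> //.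
  by apply: same_refl => //; apply/onv_tw.
have [x [y [r [w [s _]]]]] := dominant_open hW dom (basic_open hW _) neW.
have [|num [den [Q [h1 h2]]]] := locrat_extract hV hW sv_dense sv_locrat ne (j := rsrc phi : chart (twist sk V)).
  by exists x, w; apply: (lr_sat2 sv_locrat s r).
by exists num, den, Q.
Qed.

(** By dominance [phi] takes values with [P <> 0], on a nonempty open set, which
    meets the open set [Q <> 0]. *)
Lemma chart_dyn_dominant num den Q (P : {mpoly k[adim (rsrc phi)]}) w :
  chart_dyn num den Q -> (exists v, onv (@mkpt k V (rsrc phi) v) /\ Q.@[v] != 0) ->
  onv (@mkpt k (twist sk V) (rsrc phi) w) -> P.@[w] != 0 ->
  exists v, [/\ onv (@mkpt k V (rsrc phi) v), Q.@[v] != 0 & P.@[fval num den v] != 0].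
Proof.
move=> hd [v0 [o0 n0]] ow nw.
have hV := sv_variety; have hW := twist_variety inv hV.
have [_ _ _ dom] := hphi.
have hO := basic_open hW P.
have [|x [y [r Oy]]] := dominant_open hW dom hO.
  by exists (mkpt w), w; split=> //; apply: same_refl.
have [||z [[y' [r' [u [s nu]]]] [v [s' nv]]]] := sv_dense (locrat_open sv_locrat hO) (basic_open hV Q).
- by exists x, y.
- by exists (mkpt v0), v0; split=> //; apply: same_refl.
exists v; split=> //; first exact: same_on2 s'.
have [_ rv] := hd v (same_on2 s') nv.
have := sv_functional (lr_sat1 sv_locrat s' r') rv => s2.
have e := same_chart hW (same_trans hW (same_sym hW s) s2).
by rewrite -e.
Qed.

End SingleSystem.
End Dynamics.

(** * Isotrivial dynamics *)

Section Isotrivial.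
Variables (k : fieldType) (sk : {rmorphism k -> k}).
Hypothesis inv : forall y : k, exists x, sk x = y.
Variables (V : atlas k) (phi : ratmap V (twist sk V)) (hphi : rational_svariety phi).
Variables (Z : atlas k) (psi : ratmap Z (twist sk Z)) (hpsi : rational_svariety psi).

Notation i0 := (rsrc phi).
Notation j0 := (rsrc psi).
Notation n := (adim (rsrc phi)).
Notation nz := (adim (rsrc psi)).

Variables (num den : 'I_n -> {mpoly k[n]}) (Q : {mpoly k[n]}).
Hypotheses (hd : chart_dyn num den Q) (ne : exists v, onv (@mkpt k V i0 v) /\ Q.@[v] != 0).
Variables (numz denz : 'I_nz -> {mpoly k[nz]}) (Qz : {mpoly k[nz]}).
Hypotheses (hdz : chart_dyn numz denz Qz) (nez : exists v, onv (@mkpt k Z j0 v) /\ Qz.@[v] != 0).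

Notation lf x := (fun a => x (lshift nz a)).
Notation rt x := (fun b => x (rshift n b)).
Notation PV v := (@mkpt k V i0 v).
Notation PZ z := (@mkpt k Z j0 z).
Notation PT x := (@mkpt k (prodv V Z) (i0, j0) x).

Let hV := sv_variety hphi.
Let hZ := sv_variety hpsi.
Let dV := sv_dense hphi.
Let dZ := sv_dense hpsi.
Let hVZ : is_variety (prodv V Z) := prod_variety hV hZ.
Let dVZ : dense_opens (prodv V Z) := dense_prod hV hZ dV dZ.

Definition chart_points (x : 'I_(n + nz) -> k) := onv (PT x).
Local Notation T := chart_points.

Lemma chart_points_prod x : T x <-> onv (PV (lf x)) /\ onv (PZ (rt x)).
Proof. exact: onv_prod. Qed.

Lemma lf_vcat (R : Type) (v : 'I_n -> R) (z : 'I_nz -> R) : lf (vcat v z) = v.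
Proof. by apply: functional_extensionality => a; rewrite vcat_l. Qed.
Lemma rt_vcat (R : Type) (v : 'I_n -> R) (z : 'I_nz -> R) : rt (vcat v z) = z.
Proof. by apply: functional_extensionality => a; rewrite vcat_r. Qed.

Lemma T_vcat v z : onv (PV v) -> onv (PZ z) -> T (vcat v z).
Proof. by move=> ov oz; apply/chart_points_prod; rewrite lf_vcat rt_vcat. Qed.

Lemma chart_points_irreducible : irreducible_set T.
Proof. exact: (@chart_irreducible k (prodv V Z) (i0, j0) hVZ dVZ). Qed.

Lemma chart_points_nonempty : exists x, T x.
Proof. by have [v [ov _]] := ne; have [z [oz _]] := nez; exists (vcat v z); apply: T_vcat. Qed.

Let NUM := vcat (fun a => mren (@lshift n nz) (num a)) (fun b => mren (@rshift n nz) (numz b)).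
Let DEN := vcat (fun a => mren (@lshift n nz) (den a)) (fun b => mren (@rshift n nz) (denz b)).
Let QT := mren (@lshift n nz) Q * mren (@rshift n nz) Qz.

Lemma QT_E x : QT.@[x] != 0 <-> Q.@[lf x] != 0 /\ Qz.@[rt x] != 0.
Proof. by rewrite /QT mevalM !meval_mren mulf_eq0 negb_or; split=> [/andP[]|[-> ->]]. Qed.

Lemma T_dyn x : T x -> QT.@[x] != 0 ->
  [/\ fdef DEN x, fval NUM DEN x = vcat (fval num den (lf x)) (fval numz denz (rt x)),
      rval phi (PV (lf x)) (@mkpt k (twist sk V) i0 (fval num den (lf x)))
    & rval psi (PZ (rt x)) (@mkpt k (twist sk Z) j0 (fval numz denz (rt x)))].
Proof.
move=> /chart_points_prod [o1 o2] /QT_E [n1 n2]; have [d1 r1] := hd o1 n1; have [d2 r2] := hdz o2 n2.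
split=> //; first by apply/fdef_vcat; rewrite fdef_mren_l fdef_mren_r.
by rewrite fval_vcat fval_mren_l fval_mren_r.
Qed.

Lemma T_good : exists x, T x /\ QT.@[x] != 0.
Proof.
have [v [ov nv]] := ne; have [z [oz nzz]] := nez; exists (vcat v z).
by split; [apply: T_vcat|apply/QT_E; rewrite lf_vcat rt_vcat].
Qed.

(** ** The generic point of the product *)

Variables (Om : fieldType) (iota : {rmorphism k -> Om}) (xi : 'I_(n + nz) -> Om).
Notation ev p v := ((map_mpoly iota p).@[v]).
Hypothesis hxi : forall p : {mpoly k[n + nz]}, ev p xi = 0 <-> forall x, T x -> p.@[x] = 0.

Let a := lf xi.
Let b := rt xi.

Lemma gen_QT : ev QT xi != 0.
Proof. by apply/(generic_neq0 hxi); apply: T_good. Qed.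

Lemma gen_DEN i : ev (DEN i) xi != 0.
Proof.
have [x [Tx nx]] := T_good; have [d _ _ _] := T_dyn Tx nx.
by move: i; apply/(generic_den hxi); exists x.
Qed.

Lemma evr_dyn : evr iota NUM DEN xi = vcat (evr iota num den a) (evr iota numz denz b).
Proof.
rewrite /NUM /DEN evr_vcat; congr vcat; apply: functional_extensionality => i;
by rewrite /evr !ev_mren.
Qed.

Lemma ev_den i : ev (den i) a != 0.
Proof. by have := gen_DEN (lshift _ i); rewrite /DEN vcat_l ev_mren. Qed.

(** The product of two dominant maps is dominant, so the image of the generic
    point is generic on the transform: if [sk p] does not vanish at some point
    of the transform it does not vanish at some value of the dynamics, found
    for one factor and then for the other. *)
Lemma generic_image p : ev p xi = 0 <-> ev (map_mpoly sk p) (evr iota NUM DEN xi) = 0.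
Proof.
split=> [e|e].
  apply: (generic_relation hxi gen_DEN gen_QT) => x Tx nx dx.
  have [_ ef r1 r2] := T_dyn Tx nx; rewrite ef.
  have [v ev'] := sk_tuple inv (fval num den (lf x)).
  have [z ez] := sk_tuple inv (fval numz denz (rt x)).
  rewrite ev' ez vcat_sk meval_map (proj1 (hxi p) e) ?rmorph0 //.
  apply: T_vcat.
    have /(lr_on2 (sv_locrat inv hphi)) := r1; rewrite ev'; exact: (onv_tw sk (PV v)).1.
  have /(lr_on2 (sv_locrat inv hpsi)) := r2; rewrite ez; exact: (onv_tw sk (PZ z)).1.
apply/hxi => x1 T1; apply/eqP/negPn/negP => n1.
have hR := generic_relation_inv hxi gen_DEN e.
have /chart_points_prod [o1 o2] := T1.
have n1' : (map_mpoly sk p).@[vcat (fun i => sk (lf x1 i)) (fun i => sk (rt x1 i))] != 0.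
  by rewrite vcat_sk meval_map fmorph_eq0 vcat_eta.
have [q1 hq1] := slice_l (map_mpoly sk p) (fun i => sk (rt x1 i)).
have [|v [ov nv mv]] := chart_dyn_dominant inv hphi (P := q1) hd ne (proj2 (onv_tw sk (PV (lf x1))) o1).
  by rewrite hq1.
have [q2 hq2] := slice_r (map_mpoly sk p) (fval num den v).
have [|z [oz nzz mz]] := chart_dyn_dominant inv hpsi (P := q2) hdz nez (proj2 (onv_tw sk (PZ (rt x1))) o2).
  by rewrite hq2 -hq1.
have Tx := T_vcat ov oz.
have nx : QT.@[vcat v z] != 0 by apply/QT_E; rewrite lf_vcat rt_vcat.
have [d ef _ _] := T_dyn Tx nx; have := hR _ Tx d.
rewrite ef lf_vcat rt_vcat -hq2 => /eqP; exact/negP.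
Qed.

Variable s : {rmorphism Om -> Om}.
Hypotheses (comm : forall c, iota (sk c) = s (iota c)) (sxi : forall i, s (xi i) = evr iota NUM DEN xi i).

Lemma s_a i : s (a i) = evr iota num den a i.
Proof. by rewrite /a sxi evr_dyn vcat_l. Qed.
Lemma s_b j : s (b j) = evr iota numz denz b j.
Proof. by rewrite /b sxi evr_dyn vcat_r. Qed.

Let hk := img_subfield iota.
(** The function field of [Z], over which the dynamics on [V] becomes trivial. *)
Definition Kz := fgen (img iota) b.

Lemma Kz_subfield : subfield Kz. Proof. exact: fgen_subfield (sf_sr hk) _ _. Qed.

Lemma Kz_const c : Kz (iota c).
Proof. by apply: fgen_base; [exact: sf_sr hk|exists c]. Qed.

Lemma Kz_stable z : Kz z -> Kz (s z).
Proof.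
apply: fgen_stable; first exact: sf_sr hk.
  by move=> _ [c ->]; rewrite -comm; apply: Kz_const.
move=> j; rewrite s_b; apply: (sf_div Kz_subfield);
exact: (fgen_pf (sf_sr hk) b (polyfun_mpoly iota _)).
Qed.

(** The denominators of the coefficients only involve [b]. *)
Lemma Kz_clear (f : ('I_n -> Om) -> Om) : polyfun Kz f ->
  exists (q : {mpoly k[n + nz]}) (d : {mpoly k[nz]}), ev d b != 0 /\
    forall y, f y * ev d b = ev q (vcat y b).
Proof.
elim=> [_ [g1 [g2 [h1 h2 n2 ->]]]|i|f1 f2 _ [q1 [d1 [n1 e1]]] _ [q2 [d2 [n2 e2]]]
   |f1 f2 _ [q1 [d1 [n1 e1]]] _ [q2 [d2 [n2 e2]]]].
- have [p1 e1] := mpoly_of_polyfun h1; have [p2 e2] := mpoly_of_polyfun h2.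
  exists (mren (@rshift n nz) p1), p2; rewrite -e2; split=> // y.
  by rewrite divfK // ev_mren rt_vcat e1.
- exists ('X_(lshift nz i)), 1; rewrite (rmorph1 (map_mpoly iota)) meval1 oner_neq0; split=> // y.
  by rewrite mulr1 map_mpolyX mevalXU vcat_l.
- exists (q1 * mren (@rshift n nz) d2 + q2 * mren (@rshift n nz) d1), (d1 * d2).
  rewrite evM; split=> [|y]; first exact: mulf_neq0 n1 n2.
  transitivity (ev q1 (vcat y b) * ev d2 b + ev q2 (vcat y b) * ev d1 b).
    by rewrite -e1 -e2 mulrDl mulrA mulrA (mulrAC (f2 y)).
  rewrite evD; congr (_ + _); rewrite evM; congr (_ * _); by rewrite ev_mren rt_vcat.
- exists (q1 * q2), (d1 * d2).
  rewrite evM; split=> [|y]; first exact: mulf_neq0 n1 n2.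
  by rewrite evM -e1 -e2 mulrACA.
Qed.

Lemma locus_a x : locus iota a x <-> onv (PV x).
Proof.
split=> [h|ox p e].
  suff : zeros (@aeqs k V i0) x by [].
  move=> p hp; apply: h; rewrite /a -ev_mren; apply/hxi => y /chart_points_prod [o1 _].
  by rewrite meval_mren; apply: o1.
have [_ [z [oz _]]] := (ne, nez).
have := proj1 (hxi (mren (@lshift n nz) p)); rewrite ev_mren => /(_ e _ (T_vcat ox oz)).
by rewrite meval_mren lf_vcat.
Qed.

(** On a product, [a] can be moved to any point [x] while [b] stays generic. *)
Lemma Kz_disjoint f : polyfun Kz f -> f a = 0 ->
  forall x, locus iota a x -> f (fun i => iota (x i)) = 0.
Proof.
move=> hf fa x /locus_a ox; have [q [d [nd eq]]] := Kz_clear hf.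
have q0 : ev q xi = 0 by rewrite -[xi]vcat_eta -eq -/a fa mul0r.
have [q' hq'] := slice_ev_r iota q x.
have : ev q' b = 0.
  rewrite /b -ev_mren; apply/hxi => y /chart_points_prod [_ o2]; rewrite meval_mren.
  have ei : vcat (fun a => iota (x a)) (fun b => iota (rt y b)) = (fun i => iota (vcat x (rt y) i)).
    by apply: functional_extensionality => i; rewrite (vcat_comp iota).
  apply/eqP; rewrite -(fmorph_eq0 iota) -meval_map hq' ei meval_map fmorph_eq0.
  by apply/eqP; apply: (proj1 (hxi q) q0); apply: T_vcat.
rewrite hq' -eq => /eqP; rewrite mulf_eq0 (negPf nd) orbF => /eqP //.
Qed.

Lemma s_ev N' (p : {mpoly k[N']}) (y : 'I_N' -> Om) :
  s (ev p y) = ev (map_mpoly sk p) (fun i => s (y i)).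
Proof.
rewrite -(meval_map s); congr (_.@[_]); apply/mpolyP => m.
by rewrite !mcoeff_map_mpoly /= -comm.
Qed.

Hypothesis hlam : forall lam : ratmap V (aspace k 1),
  invariant_function phi lam -> constant_function lam.

(** A constant [p a / q a] of [k(a)] is a rational function on [V]. The relation
    [s z = z] at the generic point is its invariance at all points of a dense
    open set, so this function is constant by hypothesis. *)
Lemma fixed_const z : fgen (img iota) a z -> s z = z -> img iota z.
Proof.
move=> [f [g [/mpoly_of_polyfun [p ep] /mpoly_of_polyfun [q eq] nq ez]]] sz.
rewrite ep eq in ez; rewrite eq in nq => {f g ep eq}.
have hW := twist_variety inv hV.
have hA := aspace_variety k 1; have hA' := twist_variety inv hA.
pose lam := @Ratmap k V (aspace k 1) i0 tt (fun=> p) (fun=> q).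
have esa : (fun i => s (a i)) = evr iota num den a.
  by apply: functional_extensionality => i; exact: s_a.
have nqs : ev (map_mpoly sk q) (evr iota num den a) != 0.
  by rewrite -esa -s_ev fmorph_eq0.
pose numl i := mren (@lshift n nz) (num i); pose denl i := mren (@lshift n nz) (den i).
have edl i : ev (denl i) xi != 0 by rewrite ev_mren; apply: ev_den.
have evl : evr iota numl denl xi = evr iota num den a.
  by apply: functional_extensionality => i; rewrite /evr !ev_mren.
(* the invariance of [z] as an identity of polynomials on the variety *)
have ident v : onv (PV v) -> fdef den v ->
    p.@[v] * (map_mpoly sk q).@[fval num den v] = q.@[v] * (map_mpoly sk p).@[fval num den v].
  move=> ov dv.
  pose R := mren (@lshift n n) p * mren (@rshift n n) (map_mpoly sk q)
     - mren (@lshift n n) q * mren (@rshift n n) (map_mpoly sk p).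
  pose nR := vcat (fun i => 'X_(lshift nz i)) numl.
  pose dR := vcat (fun _ : 'I_n => 1) denl.
  have edR i : ev (dR i) xi != 0.
    rewrite /dR /vcat; case: (split i) => j //.
    by rewrite (rmorph1 (map_mpoly iota)) meval1 oner_neq0.
  have eR : evr iota nR dR xi = vcat a (evr iota num den a).
    rewrite evr_vcat evl; congr vcat; apply: functional_extensionality => i.
    by rewrite /evr (rmorph1 (map_mpoly iota)) meval1 divr1 map_mpolyX mevalXU.
  have R0 : ev R (evr iota nR dR xi) = 0.
    rewrite eR ev_cross.
    have := sz; rewrite ez fmorph_div !s_ev esa => /eqP; rewrite eqr_div // => /eqP e.
    by rewrite -e; apply/eqP; rewrite subr_eq0 mulrC.
  have [z0 [oz0 _]] := nez.
  have := generic_relation_inv hxi edR R0 (T_vcat ov oz0).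
  have dRv : fdef dR (vcat v z0).
    apply/fdef_vcat; split=> i; first by rewrite meval1 oner_neq0.
    by rewrite /denl meval_mren lf_vcat.
  have efR : fval nR dR (vcat v z0) = vcat v (fval num den v).
    rewrite fval_vcat; congr vcat; last by rewrite fval_mren_l lf_vcat.
    by apply: functional_extensionality => i; rewrite /fval mevalXU meval1 divr1 vcat_l.
  move=> /(_ dRv); rewrite efR meval_cross.
  by move/eqP; rewrite subr_eq0 => /eqP.
have [Pq hPq] := pullback (map_mpoly sk q) num den.
have [v0 [ov0 nv0]] : exists v, onv (PV v) /\ (Q * q * Pq).@[v] != 0.
  apply: NNPP => hno; case/eqP: nqs; rewrite -evl.
  apply: (generic_relation hxi edl (Q := QT * mren (@lshift n nz) q)).
    by rewrite evM ev_mren mulf_neq0 // gen_QT.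
  move=> x Tx; rewrite mevalM meval_mren mulf_eq0 negb_or => /andP[nx mx] dx.
  have [n1 _] := proj1 (QT_E x) nx; have /chart_points_prod [o1 _] := Tx.
  apply/eqP/negPn/negP => nn; apply: hno; exists (lf x); split=> //.
  rewrite !mevalM !mulf_neq0 //; apply/hPq.
  by rewrite fval_mren_l in nn; split=> //; apply/fdef_mren_l.
have split3 v : (Q * q * Pq).@[v] != 0 ->
    [/\ Q.@[v] != 0, q.@[v] != 0, fdef den v & (map_mpoly sk q).@[fval num den v] != 0].
  by rewrite !mevalM !mulf_eq0 !negb_or => /andP[/andP[n1 n2] /hPq [n3 n4]].
have rmlam : is_ratmap lam.
  split; first by exists v0; split=> // i; have [] := split3 _ nv0.
  by move=> v _ _ p' .
have flam := rval_functional hV hA dV rmlam.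
have lamv v : onv (PV v) -> q.@[v] != 0 ->
    rval lam (PV v) (@mkpt k (aspace k 1) tt (fun=> p.@[v] / q.@[v])).
  move=> ov nv; exists lam; split=> //; first exact: pval_functional.
  by exists v; split=> //; [apply: same_refl|apply/same_aspace].
have [] := hlam (lam := lam) _.
  split=> //; split.
  - have [_ n2 _ _] := split3 _ nv0.
    by exists (PV v0), (@mkpt k (aspace k 1) tt (fun=> p.@[v0] / q.@[v0])); apply: lamv.
  - have [n1 n2 n3 n4] := split3 _ nv0; have [_ r] := hd ov0 n1.
    have [v1 e1] := sk_tuple inv (fval num den v0).
    rewrite e1 in r; rewrite e1 meval_map fmorph_eq0 in n4.
    have ov1 : onv (PV v1) by apply/(onv_tw sk); apply: (lr_on2 (sv_locrat inv hphi)) r.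
    exists (PV v0), (tw sk (@mkpt k (aspace k 1) tt (fun=> p.@[v1] / q.@[v1]))), (tw sk (PV v1)); split=> //.
    by apply: (rval_tw inv); apply: lamv.
  have lS : locrat (rcomp (rval phi) (rval (twistR sk lam))).
    by apply: locrat_comp; [apply: sv_locrat|apply: locrat_rval].
  have lR := locrat_twaspace inv (locrat_rval lam hV hA).
  have hO := basic_open hV (Q * q * Pq).
  move=> x y y' r1 r2; apply/same_aspace/(same_twaspace inv).
  apply: (locrat_agree hV hA' dV lR lS hO _ _ r1 r2).
    by exists (PV v0), v0; split=> //; apply: same_refl.
  move=> {x y y' r1 r2} x y y' [v [sv /split3 [n1 n2 n3 n4]]] r1 [x' [r2 r3]].
  apply/(same_twaspace inv); have ov := same_on2 sv.
  have e1 i : (tagged y : 'I_1 -> k) i = p.@[v] / q.@[v].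
    exact: (proj1 (same_aspace _ _) (flam _ _ _ (lr_sat1 (locrat_rval lam hV hA) sv r1) (lamv v ov n2))).
  have [_ r2'] := hd ov n1.
  have sx' := sv_functional inv hphi (lr_sat1 (sv_locrat inv hphi) sv r2) r2'.
  have [v1 ev1] := sk_tuple inv (fval num den v).
  rewrite ev1 in sx'; have [y1 ey1] := tw_surj inv y'.
  have lT : locrat (rval (twistR sk lam)) by apply: locrat_rval.
  have := lr_sat1 lT sx' r3; rewrite ey1 => /(rval_tw_inv inv (x := PV v1)) r4.
  have ov1 : onv (PV v1) by apply/(onv_tw sk); apply: same_on2 sx'.
  have nq1 : q.@[v1] != 0 by move: n4; rewrite ev1 meval_map fmorph_eq0.
  have e2 := proj1 (same_aspace _ _) (flam _ _ _ r4 (lamv v1 ov1 nq1)).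
  move=> i; rewrite e1 /= e2 /= fmorph_div -!meval_map -ev1.
  by apply/eqP; rewrite eqr_div // ident // mulrC.
move=> c hc; exists c.
suff : ev ((p - c *: q) * q) a = 0.
  rewrite evM => /eqP; rewrite mulf_eq0 (negPf nq) orbF (rmorphB (map_mpoly iota)) mevalB evZ.
  by rewrite subr_eq0 => /eqP e; rewrite ez e mulfK.
rewrite /a -ev_mren; apply/hxi => x /chart_points_prod [ox _]; rewrite meval_mren mevalM mevalB mevalZ.
have [->|nx] := eqVneq q.@[lf x] 0; first by rewrite mulr0.
by have /= <- := hc _ _ (lamv _ ox nx); rewrite divfK // subrr mul0r.
Qed.

(** ** Isotriviality *)

Variables (l : nat) (Y : closed_data (prodv (aspace k l) Z)) (g : ratmap (prodv V Z) (sub Y)).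
Hypotheses (clY : is_closed Y) (big : birational g).
Hypothesis eqg : @equivariant k sk (prodv V Z) (sub Y) (rval (sprod phi psi))
  (rval (sprod (aspace_id sk l) psi)) g.
Hypothesis prg : forall x y, rval g x y -> same (pr2 x) (@pr2 k (aspace k l) Z y).

Let hA := aspace_variety k l.
Let hAZ : is_variety (prodv (aspace k l) Z) := prod_variety hA hZ.
Let hY : is_variety (sub Y) := sub_variety hAZ clY.

Notation PY w := (@mkpt k (sub Y) (tt, j0) w).

Lemma T_twist x x' : T x -> QT.@[x] != 0 -> fval NUM DEN x = (fun i => sk (x' i)) -> T x'.
Proof.
move=> Tx nx; have [_ -> r1 r2] := T_dyn Tx nx => e; apply/chart_points_prod; split.
  have /(lr_on2 (sv_locrat inv hphi)) := r1.
  have -> : fval num den (lf x) = (fun i => sk (lf x' i)).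
    by apply: functional_extensionality => i; rewrite -(congr1 (fun f => f (lshift nz i)) e) vcat_l.
  exact: (onv_tw sk (PV _)).1.
have /(lr_on2 (sv_locrat inv hpsi)) := r2.
have -> : fval numz denz (rt x) = (fun i => sk (rt x' i)).
  by apply: functional_extensionality => i; rewrite -(congr1 (fun f => f (rshift n i)) e) vcat_r.
exact: (onv_tw sk (PZ _)).1.
Qed.

(** Choose a point of the product at which [g] is defined and whose image is in
    the domain of the inverse map, and read both maps in the given charts near
    these points. Compatibility with the projections to [Z] says that only the
    coordinates in affine space are new. *)
Lemma trivialisation : exists (cg dg : 'I_l -> {mpoly k[n + nz]}) (Qg : {mpoly k[n + nz]})
    (numh denh : 'I_(n + nz) -> {mpoly k[l + nz]}) (Qh : {mpoly k[l + nz]}),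
  let G x := vcat (fval cg dg x) (rt x) in
  [/\ exists x, [/\ T x, Qg.@[x] != 0 & Qh.@[G x] != 0],
      forall x, T x -> Qg.@[x] != 0 -> fdef dg x /\ rval g (PT x) (PY (G x))
    & forall x, T x -> Qg.@[x] != 0 -> Qh.@[G x] != 0 ->
        fdef denh (G x) /\ fval numh denh (G x) = x].
Proof.
have [rg [h [rh [[x1 [y1 gh1]] _ agr] _]]] := big.
have lg := locrat_rval g hVZ hY; have lh := locrat_rval h hY hVZ.
have fg := rval_functional hVZ hY dVZ rg.
have lgh := locrat_comp lg lh.
have [||X [[y0 [[w0 [g0 h0]] oy0]] [x0 [sx0 _]]]] := dVZ (locrat_open lgh (open_onv _))
    (basic_open hVZ (1 : {mpoly k[@adim k (prodv V Z) (i0, j0)]})).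
- by exists x1, y1; split=> //; apply: (lr_on2 lgh) gh1.
- have [x Tx] := chart_points_nonempty; exists (PT x), x; rewrite meval1 oner_neq0; split=> //.
  exact: same_refl.
have Tx0 : T x0 := same_on2 sx0.
have sy0 : same y0 (PT x0) := agr X y0 (PT x0) (ex_intro _ w0 (conj g0 h0)) sx0.
have {}g0 := lr_sat1 lg sx0 g0; have {}h0 := lr_sat2 lh sy0 h0.
have [w00 sw0] : exists w00, same w0 (PY w00).
  have := prg g0; have := lr_on2 lg g0; rewrite -(pair_pr (w0 : pt (prodv (aspace k l) Z))).
  case: (pr1 (w0 : pt (prodv (aspace k l) Z))) => [[] cv] /(onv_sub Y) iw sz.
  exists (vcat cv (rt x0)); apply/(same_sub clY); split=> //.
  apply/same_prod; split; first by rewrite pr1_pair; apply/same_aspace => i /=; rewrite vcat_l.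
  rewrite pr2_pair in sz *; apply: (same_sym hZ).
  have -> : pr2 (PY (vcat cv (rt x0)) : pt (prodv (aspace k l) Z)) = PZ (rt x0).
    by apply: (@pr2_pair k (aspace k l) Z (@mkpt k (aspace k l) tt cv) (PZ (rt x0))).
  exact: sz.
have {}g0 := lr_sat2 lg sw0 g0; have {}h0 := lr_sat1 lh sw0 h0.
have [numg [deng [Qg [nQg hg]]]] := locrat_chart hY lg g0.
have [numh [denh [Qh [nQh hh]]]] := locrat_chart hVZ lh h0.
pose cg i := numg (lshift nz i); pose dg i := deng (lshift nz i).
have eG x : T x -> Qg.@[x] != 0 -> fval numg deng x = vcat (fval cg dg x) (rt x).
  move=> Tx nx; have [_ r] := hg x Tx nx.
  rewrite -[LHS](@vcat_eta _ l nz); congr vcat.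
  have := prg r; exact: (fun s' => esym (@same_chart k Z hZ j0 _ _ s')).
exists cg, dg, Qg, numh, denh, Qh; split.
- exists x0; split=> //; rewrite -eG //.
  have [_ r] := hg x0 Tx0 nQg.
  by rewrite (same_chart hY (fg _ _ _ r g0)).
- move=> x Tx nx; rewrite -eG //; have [d r] := hg x Tx nx; split=> // i.
  exact: d.
- move=> x Tx nx; rewrite -eG // => nh; have [_ r] := hg x Tx nx.
  have [d r'] := hh _ (lr_on2 lg r) nh; split=> //.
  apply: (@same_chart k (prodv V Z) hVZ (i0, j0)).
  apply: (agr (PT x)); first by exists (PY (fval numg deng x)).
  exact: same_refl.
Qed.

Lemma fraction_fixed (x y : Om) : y != 0 -> x / y * s y = s x -> s (x / y) = x / y.
Proof. by move=> ny e; rewrite fmorph_div -e mulfK // fmorph_eq0. Qed.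

(** Let [c0] be the coordinates in affine space of the image of the generic
    point under [g]. Equivariance says that they are fixed, because the dynamics
    on the target is the identity on affine space. As [g] has an inverse, [a] is
    a rational function of [c0] and [b]. *)
Lemma generic_point_internal : exists c0 : 'I_l -> Om, (forall i, s (c0 i) = c0 i) /\
  forall i, fgen Kz c0 (a i).
Proof.
have [cg [dg [Qg [numh [denh [Qh [[x0 [Tx0 nQg nQh]] hg hh]]]]]]] := trivialisation.
have edg i : ev (dg i) xi != 0.
  by move: i; apply/(generic_den hxi); exists x0; have [] := hg _ Tx0 nQg.
have eQg : ev Qg xi != 0 by apply/(generic_neq0 hxi); exists x0.
pose c0 := evr iota cg dg xi; pose eta := evr iota NUM DEN xi.
have esxi : (fun i => s (xi i)) = eta by apply: functional_extensionality => i; exact: sxi.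
have hW := twist_variety inv hY.
have fixed_at x x' : T x -> QT.@[x] != 0 -> Qg.@[x] != 0 -> fval NUM DEN x = (fun i => sk (x' i)) ->
    Qg.@[x'] != 0 -> fval cg dg x = fun i => sk (fval cg dg x' i).
  move=> Tx nx mx ex mx'; have Tx' := T_twist Tx nx ex.
  have [_ r] := hg x Tx mx; have [_ r'] := hg x' Tx' mx'.
  have [_ ef r1 r2] := T_dyn Tx nx; rewrite ef in ex.
  have [_ _ agr] := eqg.
  have rL := rval_sprod inv (@rval_aspace_id k sk inv l (@mkpt k (aspace k l) tt (fval cg dg x))
    (@mkpt k (twist sk (aspace k l)) tt (fval cg dg x)) (fun=> erefl)) r2.
  have rR := rval_sprod inv r1 r2.
  have := agr (PT x) _ (tw sk (PY (vcat (fval cg dg x') (rt x')))) (ex_intro _ _ (conj r rL)).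
  have -> : PT x = @ppair k V Z (PV (lf x)) (PZ (rt x)) by rewrite /ppair /= vcat_eta.
  move=> /(_ (ex_intro _ _ (conj rR _))) H.
  have {}H := H _.
  have /(same_chart hW) e : @same k (twist sk (sub Y)) (@mkpt k (twist sk (sub Y)) (tt, j0) (vcat (fval cg dg x) (fval numz denz (rt x))))
     (@mkpt k (twist sk (sub Y)) (tt, j0) (fun i => sk (vcat (fval cg dg x') (rt x') i))).
    apply: H; rewrite /ppair /= ex; exact: (rval_tw inv r').
  apply: functional_extensionality => i.
  by have := congr1 (fun f => f (lshift nz i)) e; rewrite /= !vcat_l.
exists c0; split=> i.
- have [Pg hPg] := pullback (map_mpoly sk Qg) NUM DEN.
  have ePg : ev Pg xi != 0.
    apply/(generic_neq0 hxi); apply: NNPP => hno; case/eqP: eQg.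
    apply/eqP; rewrite -(fmorph_eq0 s) s_ev esxi; apply/eqP.
    apply: (generic_relation hxi gen_DEN gen_QT) => x Tx _ dx.
    by apply/eqP/negPn/negP => nn; apply: hno; exists x; split=> //; apply/hPg.
  pose cs := map_mpoly sk (cg i); pose ds := map_mpoly sk (dg i).
  have eds : ev ds eta = s (ev (dg i) xi) by rewrite s_ev esxi.
  have ecs : ev cs eta = s (ev (cg i) xi) by rewrite s_ev esxi.
  pose R := mren (@lshift l (n + nz)) 'X_i * mren (@rshift l (n + nz)) ds
          - mren (@lshift l (n + nz)) 1 * mren (@rshift l (n + nz)) cs.
  have edD j : ev (vcat dg DEN j) xi != 0.
    by rewrite /vcat; case: (split j) => m; [apply: edg|apply: gen_DEN].
  have R0 : ev R (evr iota (vcat cg NUM) (vcat dg DEN) xi) = 0.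
    apply: (generic_relation hxi edD (Q := QT * Qg * Pg)); first by rewrite evM evM (mulf_neq0 (mulf_neq0 gen_QT eQg) ePg).
    move=> x Tx; rewrite mevalM mevalM mulf_eq0 mulf_eq0 negb_or negb_or.
    move=> /andP[/andP[nx mx] /hPg [dx nP]] /fdef_vcat [dgx _].
    have [x' ex'] := sk_tuple inv (fval NUM DEN x).
    rewrite ex' meval_map fmorph_eq0 in nP.
    have [dgx' _] := hg x' (T_twist Tx nx ex') nP.
    rewrite fval_vcat meval_cross mevalXU meval1 mul1r ex' !meval_map (fixed_at x x') //.
    by rewrite -rmorphM /fval divfK ?subrr.
  move: R0; rewrite evr_vcat ev_cross map_mpolyX mevalXU (rmorph1 (map_mpoly iota)) meval1 mul1r.
  rewrite -/c0 -/eta eds ecs => /eqP; rewrite subr_eq0 => /eqP e.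
  exact: fraction_fixed e.
pose GN : 'I_(l + nz) -> {mpoly k[n + nz]} := vcat cg (fun j => 'X_(rshift n j)).
pose GD : 'I_(l + nz) -> {mpoly k[n + nz]} := vcat dg (fun=> 1).
have eGD j : ev (GD j) xi != 0.
  rewrite /GD /vcat; case: (split j) => m; first exact: edg.
  by rewrite (rmorph1 (map_mpoly iota)) meval1 oner_neq0.
have ew : evr iota GN GD xi = vcat c0 b.
  rewrite evr_vcat; congr vcat; apply: functional_extensionality => j.
  by rewrite /evr (rmorph1 (map_mpoly iota)) meval1 divr1 map_mpolyX mevalXU.
have fG x : fval GN GD x = vcat (fval cg dg x) (rt x).
  rewrite fval_vcat; congr vcat; apply: functional_extensionality => j.
  by rewrite /fval mevalXU meval1 divr1.
have dG x : fdef dg x -> fdef GD x.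
  by move=> d; apply/fdef_vcat; split=> // j; rewrite meval1 oner_neq0.
have [dx0 _] := hg x0 Tx0 nQg.
have edh j : ev (denh j) (vcat c0 b) != 0.
  rewrite -ew; apply/eqP => /(generic_relation_inv hxi eGD) /(_ x0 Tx0 (dG _ dx0)).
  by rewrite fG => /eqP; apply/negP; have [d _] := hh x0 Tx0 nQg nQh; apply: d.
have [Ph hPh] := pullback Qh GN GD.
have ePh : ev Ph xi != 0.
  by apply/(generic_neq0 hxi); exists x0; split=> //; apply/hPh; rewrite fG; split=> //; apply: dG.
pose j := lshift nz i.
pose R := mren (@lshift (n + nz) (l + nz)) 'X_j * mren (@rshift (n + nz) (l + nz)) (denh j)
        - mren (@lshift (n + nz) (l + nz)) 1 * mren (@rshift (n + nz) (l + nz)) (numh j).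
pose XN : 'I_(n + nz) -> {mpoly k[n + nz]} := fun i => 'X_i.
pose XD : 'I_(n + nz) -> {mpoly k[n + nz]} := fun=> 1.
have eD m : ev (vcat XD GD m) xi != 0.
  rewrite /vcat; case: (split m) => m'; last exact: eGD.
  by rewrite (rmorph1 (map_mpoly iota)) meval1 oner_neq0.
have R0 : ev R (evr iota (vcat XN GN) (vcat XD GD) xi) = 0.
  apply: (generic_relation hxi eD (Q := Qg * Ph)); first by rewrite evM mulf_neq0.
  move=> x Tx; rewrite mevalM mulf_eq0 negb_or => /andP[mx /hPh [_ nP]] _.
  rewrite fG in nP; have [d e] := hh x Tx mx nP.
  rewrite fval_vcat meval_cross mevalXU meval1 mul1r fG.
  by rewrite {1}/fval mevalXU meval1 divr1 -[in X in X * _]e /fval divfK // subrr.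
move: R0; rewrite evr_vcat ew ev_cross map_mpolyX mevalXU (rmorph1 (map_mpoly iota)) meval1 mul1r.
rewrite {1}/evr map_mpolyX mevalXU (rmorph1 (map_mpoly iota)) meval1 divr1 => /eqP; rewrite subr_eq0 => /eqP e.
have pf (p : {mpoly k[l + nz]}) : polyfun Kz (fun y => ev p (vcat y b)).
  apply: (polyfun_comp (polyfun_mono _ (polyfun_mpoly iota p)) (G := fun i y => vcat y b i)).
    by move=> _ [c ->]; apply: Kz_const.
  move=> m; rewrite /vcat; case: (split m) => m'; first exact: PfX.
  by apply: PfC; exact: (fgen_gen (sf_sr hk)).
exists (fun y => ev (numh j) (vcat y b)), (fun y => ev (denh j) (vcat y b)); split=> //.
by rewrite -e mulfK.
Qed.

End Isotrivial.

(** ** The proper invariant subvarieties are not dense *)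

Section Finiteness.
Variables (k : fieldType) (sk : {rmorphism k -> k}).
Hypotheses (pchark : [pchar k] =i pred0) (inv : forall y : k, exists x, sk x = y).
Variables (V : atlas k) (phi : ratmap V (twist sk V)).
Hypotheses (hphi : rational_svariety phi) (hiso : isotrivial phi).
Hypothesis hlam : forall lam : ratmap V (aspace k 1),
  invariant_function phi lam -> constant_function lam.

Let hV := sv_variety hphi.
Let dV := sv_dense hphi.
Notation PV v := (@mkpt k V (rsrc phi) v).

(** The chart is dense, so it is not contained in [X]. *)
Lemma proper_chart (X : closed_data V) : is_closed X -> proper_closed X ->
  exists v, onv (PV v) /\ exists p : {mpoly k[adim (rsrc phi)]},
    p.@[v] != 0 /\ forall v, inC X (PV v) -> p.@[v] = 0.
Proof.
move=> clX [y [oy ny]].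
have [P [hP nP]] : exists P, P \in X (tag y) /\ P.@[tagged y] != 0.
  apply: NNPP => hno; apply: ny; split=> // p hp.
  by apply/eqP/negPn/negP => n; apply: hno; exists p.
have [_ _ [[v1 [ov1 _]] _] _] := hphi.
have [||x [[w [sw nw]] [v [sv _]]]] := dV (basic_open hV P) (basic_open hV (1 : {mpoly k[adim (rsrc phi)]})).
- by exists y, (tagged y); split=> //; rewrite ptE; apply: same_refl.
- by exists (PV v1), v1; rewrite meval1 oner_neq0; split=> //; apply: same_refl.
exists v; split; first exact: same_on2 sv.
apply: NNPP => hno; case/eqP: nw.
have iX : inC X (PV v).
  split; first exact: same_on2 sv.
  move=> p hp; apply/eqP/negPn/negP => n; apply: hno; exists p; split=> // u [_]; exact.
have [_] := clX _ _ (same_trans hV (same_sym hV sv) sw) iX; exact.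
Qed.

(** [invariant_sets_dense] is applied to the generic point [a] of [V] and to the function field
    of [Z], which is independent from [a] because [(a, b)] is generic on the
    product. Isotriviality provides the constants generating [a], and the
    absence of invariant functions says that [k(a)] has no new constants. An
    invariant subvariety meeting the open set [h <> 0] would be dense. *)
Lemma proper_invariant_not_dense : exists h : {mpoly k[adim (rsrc phi)]},
  (exists v, onv (PV v) /\ h.@[v] != 0) /\
  forall X, invariant_subvariety phi X -> proper_closed X ->
    forall v, inC X (PV v) -> h.@[v] = 0.
Proof.
have [Z [psi [l [Y [g [hpsi iY big eqg prg]]]]]] := hiso.
have clY : is_closed Y by case: iY.
have [num [den [Q [hd ne]]]] := chart_dyn_exists inv hphi.
have [numz [denz [Qz [hdz nez]]]] := chart_dyn_exists inv hpsi.
have [Om [iota [xi [hxi gen]]]] := generic_point (chart_points_irreducible hphi hpsi) (chart_points_nonempty ne nez).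
have [s [hs hsxi]] := generic_endo gen (generic_image inv hphi hpsi hd ne hdz nez hxi).
have comm c : iota (sk c) = s (iota c) by rewrite hs.
have [c0 [hc0 hac]] := generic_point_internal inv hphi hpsi hd ne hdz nez hxi comm hsxi clY big eqg prg.
(* with the factor [Q] the denominators only vanish where [Q] does not *)
pose num' i := num i * Q; pose den' i := den i * Q.
pose a := fun i : 'I_(adim (rsrc phi)) => xi (lshift (adim (rsrc psi)) i).
have eQ : (map_mpoly iota Q).@[a] != 0.
  have [v [ov nv]] := ne; have [z [oz _]] := nez; rewrite -ev_mren.
  apply/(generic_neq0 hxi); exists (vcat v z).
  by rewrite meval_mren lf_vcat; split=> //; apply: T_vcat.
have hden i : (map_mpoly iota (den' i)).@[a] != 0.
  by rewrite evM mulf_neq0 //; exact: (ev_den hd ne hdz nez hxi).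
have hsa i : s (a i) = (map_mpoly iota (num' i)).@[a] / (map_mpoly iota (den' i)).@[a].
  by rewrite !evM -mulf_div divff // mulr1; exact: (s_a hsxi i).
have chU : [pchar Om] =i pred0 by move=> p; rewrite (fmorph_pchar iota).
have [h [nh hcore]] := invariant_sets_dense chU comm inv hden hsa (@Kz_subfield _ _ _ phi _ psi _ iota xi)
  (@Kz_stable _ _ _ _ _ _ _ _ _ _ _ _ _ _ comm hsxi) (@Kz_const _ _ _ phi _ psi _ iota xi) hc0 hac
  (@Kz_disjoint _ _ _ _ _ _ _ ne _ nez _ _ _ hxi)
  (@fixed_const _ _ inv _ _ hphi _ _ _ _ _ hd ne _ _ _ hdz nez _ _ _ hxi _ comm hsxi hlam).
exists h; split.
  move: nh; rewrite -ev_mren => /(generic_neq0 hxi) [x [/chart_points_prod [ox _] nx]].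
  by rewrite meval_mren in nx; exists (fun i => x (lshift _ i)).
move=> X hX pX v iv; have [clX irrX _ hstab _] := hX.
apply/eqP/negPn/negP => nv; have [v0 [ov0 [p [np hp]]]] := proper_chart clX pX.
case/eqP: np.
have hS := sub_variety hV clX.
have hdS : dense_opens (sub X) := irreducible_dense hS irrX.
have lE := locus_a ne nez hxi.
apply: (proj2 (lE v0) ov0); apply: (hcore (fun v => inC X (PV v))) => //.
- by move=> x [ox _]; apply/lE.
- move=> p1 p2 x1 x2 /(onv_sub X (PV x1)) o1 /(onv_sub X (PV x2)) o2 n1 n2.
  have [x [ox m1 m2]] := @chart_irreducible k (sub X) (rsrc phi) hS hdS _ _ _ _ o1 o2 n1 n2.
  by exists x; split=> //; apply/(onv_sub X (PV x)).
- move=> x x1 ix dx ex; have ox : onv (PV x) by case: ix.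
  have [[i _]|no] := classic (exists i : 'I_(adim (rsrc phi)), True); last first.
    have -> : x1 = x by apply: functional_extensionality => i; case: no; exists i.
    exact: ix.
  have nQ : Q.@[x] != 0 by have := dx i; rewrite mevalM mulf_eq0 negb_or => /andP[].
  have [_ r] := hd x ox nQ.
  have e : fval num den x = fun i => sk (x1 i).
    apply: functional_extensionality => j; rewrite ex !mevalM -mulf_div divff // mulr1.
    by [].
  by rewrite e in r; have /(inC_tw sk X (PV x1)) := hstab _ _ ix r.
- by exists v.
Qed.

(** ** Noetherian induction *)

Definition vanish_on (J : closed_data V -> Prop) (i : chart V) (p : {mpoly k[adim i]}) :=
  forall X, J X -> forall v, inC X (mkpt (i := i) v) -> p.@[v] = 0.

(** A descending sequence of families with strictly increasing vanishing ideals
    in some chart is impossible by [hilbert_zeros]: finitely many equations, which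
    all occur at some stage, have the same zeros as all of them. *)
Lemma family_ind (P : (closed_data V -> Prop) -> Prop) :
  (forall J, (forall J' : closed_data V -> Prop, (forall X, J' X -> J X) ->
      (exists i (p : {mpoly k[adim i]}), vanish_on J' p /\ ~ vanish_on J p) -> P J') -> P J) ->
  forall J, P J.
Proof.
move=> hP J0; apply: NNPP => nP.
have /choice_fun [next hnext] : forall J, exists J' : closed_data V -> Prop, ~ P J ->
    [/\ ~ P J', forall X, J' X -> J X & exists i (p : {mpoly k[adim i]}), vanish_on J' p /\ ~ vanish_on J p].
  move=> J; have [pJ|nJ] := classic (P J); first by exists J.
  apply: NNPP => hno; apply: nJ; apply: hP => J' h1 h2; apply: NNPP => h3.
  by apply: hno; exists J'.
pose F t := iter t next J0.
have nF t : ~ P (F t) by elim: t => // t /hnext [].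
have subF t d X : F (d + t)%N X -> F t X.
  by elim: d => // d IH h; apply: IH; have [_ h' _] := hnext _ (nF (d + t)%N); apply: h'.
have monoF t t' i (p : {mpoly k[adim i]}) : (t <= t')%N -> vanish_on (F t) p -> vanish_on (F t') p.
  by move=> /subnK <- h X /subF; apply: h.
have /choice_fun [l hl] : forall i : chart V, exists l : seq {mpoly k[adim i]},
    (forall p, p \in l -> exists t, vanish_on (F t) p) /\
    forall v, (forall p, p \in l -> p.@[v] = 0) ->
      forall p : {mpoly k[adim i]}, (exists t, vanish_on (F t) p) -> p.@[v] = 0.
  by move=> i; apply: (hilbert_zeros (fun p => exists t, vanish_on (F t) p)).
have /choice_fun [N hN] : forall i : chart V, exists N, forall p, p \in l i -> vanish_on (F N) p.
  move=> i; have [h _] := hl i; elim: (l i) h => [|p s IH] h; first by exists 0%N.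
  have [|N1 h1] := IH; first by move=> q hq; apply: h; rewrite inE hq orbT.
  have [N2 h2] := h p (mem_head _ _); exists (N1 + N2)%N => q.
  rewrite inE => /orP[/eqP ->|/h1 hq]; first by apply: monoF h2; apply: leq_addl.
  by apply: monoF hq; apply: leq_addr.
pose M := (\max_i N i)%N.
have [_ _ [i [p [h1 h2]]]] := hnext _ (nF M); apply: h2 => X FX v iv.
apply: (proj2 (hl i)); last by exists M.+1.
move=> q hq; have h : vanish_on (F M) q by apply: monoF (hN i q hq); apply: leq_bigmax.
exact: h FX v iv.
Qed.

Section Closure.
Variable J : closed_data V -> Prop.
Hypothesis hJ : forall X, J X -> is_closed X.

(** The closure of the union of the family. The equations of the chart do not
    suffice to define it in a given chart: a point is required to satisfy the
    equations of the family in all the charts that contain it. *)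
Lemma family_closure : exists C : closed_data V, [/\ is_closed C,
  forall X, J X -> subC X C,
  forall x, inC C x -> forall p : {mpoly k[adim (tag x)]}, vanish_on J p -> p.@[tagged x] = 0
  & forall O, is_open O -> forall x, inC C x -> O x -> exists X x', [/\ J X, inC X x' & O x']].
Proof.
pose S x := onv x /\ forall y, same x y -> forall p : {mpoly k[adim (tag y)]}, vanish_on J p -> p.@[tagged y] = 0.
have [x []//|x y s [ox hx]|x ox nS|C [clC CE]] := @closed_of_set k V S.
- split=> [|z s']; first exact: same_on2 s.
  by apply: hx; apply: same_trans s s'.
- have [y [s [p [hp np]]]] : exists y, same x y /\ exists p : {mpoly k[adim (tag y)]}, vanish_on J p /\ p.@[tagged y] != 0.
    apply: NNPP => hno; apply: nS; split=> // y s p hp; apply/eqP/negPn/negP => np.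
    by apply: hno; exists y; split=> //; exists p.
  have [_ _ c] := basic_open hV p.
  have [|P [nP hP]] := c x; first by exists (tagged y); rewrite ptE.
  exists P; split=> // v [ov hv]; apply/eqP/negPn/negP => /(hP v ov) [w [sw nw]].
  by case/eqP: nw; apply: (hv _ sw).
exists C; split=> //.
- move=> X JX x iX; apply/CE; split; first by case: iX.
  move=> y s p hp; have iy := hJ JX s iX; apply: (hp X JX (tagged y)); rewrite ptE; exact: iy.
- by move=> x /CE [ox hx]; apply: hx; apply: same_refl.
move=> O [a b c] x /CE [ox hx] Ox; apply: NNPP => hno.
have [P [nP hP]] := c x Ox; case/eqP: nP; apply: (hx x); first exact: same_refl.
move=> X JX v iv; apply/eqP/negPn/negP => nv; apply: hno; exists X, (mkpt v); split=> //.
by apply: hP => //; case: iv.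
Qed.

End Closure.

Lemma open_compl (W : atlas k) (D : closed_data W) : is_variety W -> is_closed D ->
  is_open (fun x => onv x /\ ~ inC D x).
Proof.
move=> hW cD; split=> [x []//|x y s [_ n]|x [ox n]].
  by split; [apply: same_on2 s|move=> /(cD _ _ (same_sym hW s))].
have [p [hp np]] : exists p, p \in D (tag x) /\ p.@[tagged x] != 0.
  apply: NNPP => hno; apply: n; split=> // p hp; apply/eqP/negPn/negP => np.
  by apply: hno; exists p.
exists p; split=> // v ov nv; split=> // -[_ z]; by case/eqP: nv; apply: z.
Qed.

(** If invariance failed at a point of the closure it would fail on an open
    neighbourhood of that point, which meets a member of the family. *)
Lemma closure_invariant (J : closed_data V -> Prop) (C : closed_data V) :
  (forall X, J X -> invariant_subvariety phi X) -> (exists X, J X) -> is_closed C ->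
  (forall X, J X -> subC X C) ->
  (forall O, is_open O -> forall x, inC C x -> O x -> exists X x', [/\ J X, inC X x' & O x']) ->
  irreducible (sub C) -> invariant_subvariety phi C.
Proof.
move=> hJ [X0 J0] clC sC meet irrC.
have hW := twist_variety inv hV.
have clT : is_closed (twistC C : closed_data (twist sk V)).
  move=> y y'; have [x ->] := tw_surj inv y; have [x' ->] := tw_surj inv y'.
  by move=> /same_tw s /inC_tw h; apply/inC_tw; apply: clC s h.
split=> //.
- by have [_ _ [x [ix dx]] _ _] := hJ _ J0; exists x; split=> //; apply: (sC _ J0).
- move=> x y ix r; apply: NNPP => nC.
  have lphi := sv_locrat inv hphi.
  have [|X [x' [JX ix' [y' [r' [_ n]]]]]] := meet _ (locrat_open lphi (open_compl hW clT)) x ix.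
    by exists y; split=> //; split=> //; apply: (lr_on2 lphi) r.
  have [_ _ _ st _] := hJ _ JX; have := st _ _ ix' r'; move: n.
  have [z ->] := tw_surj inv y'; move=> n /inC_tw h; apply: n; apply/inC_tw; exact: (sC _ JX).
- move=> D clD hD y; have [x ->] := tw_surj inv y => /inC_tw ix; apply: NNPP => nD.
  have hO : is_open (fun x => onv x /\ ~ inC D (tw sk x)).
    split=> [z []//|z z' s [_ n]|z [oz n]].
      split; first exact: same_on2 s.
      by move=> h; apply: n; apply: clD h; apply/same_tw; apply: same_sym.
    have [p [hp np]] : exists p, p \in D (tag z) /\ p.@[fun i => sk (tagged z i)] != 0.
      apply: NNPP => hno; apply: n; split; first exact/onv_tw.
      by move=> p hp; apply/eqP/negPn/negP => np; apply: hno; exists p.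
    have [p' ep] := sk_mpoly inv p; rewrite ep meval_map fmorph_eq0 in np.
    exists p'; split=> // v ov nv; split=> // -[_ h]; case/eqP: nv; apply/eqP.
    by rewrite -(fmorph_eq0 sk) -meval_map -ep; apply/eqP; apply: h.
  have [|X [x' [JX ix' [_ n]]]] := meet _ hO x ix; first by split=> //; case: ix.
  apply: n; have [_ _ _ _ dn] := hJ _ JX; apply: dn => //; last exact/inC_tw.
  by move=> u w iu; apply: hD; apply: (sC _ JX).
Qed.

(** If the closure of the union is irreducible it is an invariant subvariety,
    proper by [proper_invariant_not_dense], and by maximality it is the only member of the family.
    Otherwise it is the union of two smaller closed sets, and each member,
    being irreducible, is contained in one of them. *)
Lemma finitely_many (J : closed_data V -> Prop) : (forall X, J X -> max_proper_invariant phi X) ->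
  exists (N : nat) (F : 'I_N -> closed_data V),
    forall X, J X -> exists i : 'I_N, forall x : pt V, inC X x <-> inC (F i) x.
Proof.
have [h [[v0 [ov0 nv0]] hh]] := proper_invariant_not_dense.
elim/family_ind: J => J IH hJ.
have [[X0 J0]|no] := classic (exists X, J X); last first.
  by exists 0%N, (fun=> fun=> [::]) => X JX; case: no; exists X.
have hinv X : J X -> invariant_subvariety phi X by move=> /hJ [].
have hcl X : J X -> is_closed X by move=> /hinv [].
have [C [clC sC vC meet]] := family_closure hcl.
have [irrC|redC] := classic (irreducible (sub C)).
  have iC : invariant_subvariety phi C by apply: closure_invariant hinv _ clC sC meet irrC; exists X0.
  have pC : proper_closed C.
    exists (PV v0); split=> // /vC/(_ h) h0; case/eqP: nv0; apply: h0.
    by move=> X JX; apply: hh; [apply: hinv|have [] := hJ _ JX].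
  exists 1%N, (fun=> C) => X JX; exists ord0 => x; split; first exact: sC.
  by have [_ _ mX] := hJ _ JX; apply: (mX C iC pC (sC _ JX)).
have hSC := sub_variety hV clC.
have [A [B [clA clB cov nA nB]]] : exists A B : closed_data (sub C), [/\ is_closed A, is_closed B,
    forall x, onv x -> inC A x \/ inC B x, exists x, onv x /\ ~ inC A x & exists x, onv x /\ ~ inC B x].
  apply: NNPP => hno; apply: redC; split.
    have [_ _ [x [ix _]] _ _] := hinv _ J0; exists x; apply/onv_sub; exact: (sC _ J0).
  move=> A B clA clB cov; apply: NNPP => /not_or_and [h1 h2]; apply: hno; exists A, B; split=> //.
    by apply: NNPP => n; apply: h1 => x ox; apply: NNPP => n'; apply: n; exists x.
  by apply: NNPP => n; apply: h2 => x ox; apply: NNPP => n'; apply: n; exists x.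
have piece (D : closed_data (sub C)) : (exists x, onv x /\ ~ inC D x) ->
    exists (N : nat) (F : 'I_N -> closed_data V), forall X, J X /\ (forall x, inC X x -> @inC k (sub C) D x) ->
      exists i : 'I_N, forall x : pt V, inC X x <-> inC (F i) x.
  move=> [x [ox nD]]; apply: (IH (fun X => J X /\ forall x, inC X x -> @inC k (sub C) D x)).
  - by move=> X [].
  - have [p [hp np]] : exists p, p \in D (tag x) /\ p.@[tagged x] != 0.
      apply: NNPP => hno; apply: nD; split=> // p hp; apply/eqP/negPn/negP => np.
      by apply: hno; exists p.
    exists (tag x), p; split; first by move=> X [_ hX] v /hX [_]; apply.
    move=> hp'; case/eqP: np; exact: (vC x (proj1 (onv_sub C x) ox) p hp').
  - by move=> X [/hJ].
have [N1 [F1 h1]] := piece A nA; have [N2 [F2 h2]] := piece B nB.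
exists (N1 + N2)%N, (vcat F1 F2) => X JX.
have [clX [_ irrX] _ _ _] := hinv _ JX.
have clXD (D : closed_data (sub C)) : is_closed D -> @is_closed k (sub X) D.
  move=> clD x y /(same_sub clX) [s ix] [_ z]; have iy := clX _ _ s ix.
  split; first exact/onv_sub.
  have sxy : @same k (sub C) x y by apply/(same_sub clC); split=> //; apply: (sC _ JX).
  have := clD x y sxy; case=> //; split=> //; exact: same_on1 sxy.
have toC (D : closed_data (sub C)) : (forall x, @onv k (sub X) x -> @inC k (sub X) D x) ->
    forall x, inC X x -> @inC k (sub C) D x.
  move=> hD x ix; have [_ z] := hD x (proj2 (onv_sub X x) ix); split=> //.
  by apply/onv_sub; apply: (sC _ JX).
have [||| hA|hB] := irrX A B.
- exact: clXD.
- exact: clXD.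
- move=> x ox; have /(onv_sub X x) ix := ox.
  have [[_ z]|[_ z]] := cov x (proj2 (onv_sub C x) (sC _ JX _ ix)); [left|right]; by split.
- by have [i hi] := h1 X (conj JX (toC A hA)); exists (lshift N2 i); rewrite vcat_l.
- by have [i hi] := h2 X (conj JX (toC B hB)); exists (rshift N1 i); rewrite vcat_r.
Qed.

End Finiteness.

Unset Implicit Arguments.

Theorem theorem5p6 (k : closedFieldType) (sk : {rmorphism k -> k})
    (pchark : [pchar k] =i pred0)
    (inversive : forall y : k, exists x : k, sk x = y) :
  (forall (U : fieldType) (s : {rmorphism U -> U}) (iota : {rmorphism k -> U})
          (kappa : Type),
      (forall x : k, iota (sk x) = s (iota x)) ->
      acfa0 s ->
      small kappa (img iota) ->
      saturated kappa s ->
    forall (n : nat) (q : dform k n -> Prop),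
      complete_qf_type s iota q ->
      rational_type s iota q ->
      qf_internal s iota kappa q ->
      weakly_orthogonal s iota q ->
      qf_isolated s iota q)
  /\
  (forall (V : atlas k) (phi : ratmap V (twist sk V)),
      rational_svariety phi ->
      isotrivial phi ->
      (forall lam : ratmap V (aspace k 1),
          invariant_function phi lam -> constant_function lam) ->
    exists (N : nat) (F : 'I_N -> closed_data V),
      forall X : closed_data V, max_proper_invariant phi X ->
        exists i : 'I_N, forall x : pt V, inC X x <-> inC (F i) x).
Proof.
split=> [U s iota kappa comm [chU _] _ _ n q qc qr qi qo|V phi hphi hiso hlam].
  exact: (rational_isolated inversive comm chU qc qr qi qo).
exact: (finitely_many pchark inversive hphi hiso hlam (J := max_proper_invariant phi) (fun X h => h)).
Qed.
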